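(* Let $f\in L_2(\Omega)$ be given. Consider the continuous primal hybrid formulation: find $u\in H^{2,1}_0(\mathcal T)$ and $\eta\in H^{-1/2}(\mathcal S)$ such that \[ (\mathcal C D^2u,D^2\delta u)_{\mathcal T}+\langle\eta,\delta u\rangle_{\mathcal S}=(f,\delta u),\qquad \langle\delta\eta,u\rangle_{\mathcal S}=0 \] holds for any $\delta u\in H^{2,1}_0(\mathcal T)$ and $\delta\eta\in H^{-1/2}(\mathcal S)$. This problem is well posed (it has exactly one solution, depending continuously on $f$). Its solution $(u,\eta)$ satisfies \[ \|u\|_{2,\mathcal T}+\|\eta\|_{-1/2,\mathcal S}\le C\|f\| \] with a constant $C$ that is independent of $f$ and $\mathcal T$. Furthermore, $u\in H^2_0(\Omega)$, $\eta=\gamma_{\mathrm{dDiv},\mathit{nn}}(\mathcal C D^2u)$, and $u$, $\boldsymbol M:=\mathcal C D^2u$ solve the Kirchhoff–Love problem \[ \operatorname{div}\operatorname{\mathbf{div}}\boldsymbol M=f,\quad \boldsymbol M=\mathcal C D^2u\ \text{ in }\Omega,\qquad u=\partial_nu=0\ \text{ on }\Gamma. \]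
   Context: $\Omega\subset\mathbb R^2$ is a bounded, simply connected Lipschitz polygon with boundary $\Gamma=\partial\Omega$; $\partial_n$ is the exterior normal derivative. $\mathbb S$ is the space of symmetric $2\times2$ real matrices; $\mathcal C$ is a symmetric, (uniformly) positive definite $L_\infty$ tensor field on $\Omega$, acting pointwise as a linear map $\mathbb S\to\mathbb S$. $D^2$ is the Hessian and $\operatorname{\mathbf{div}}$ the row-wise divergence of tensors. $(\cdot,\cdot)$, $\|\cdot\|$ are the $L_2(\Omega)$ inner product and norm. $\|v\|_{2,T}^2:=\|v\|_{L_2(T)}^2+\|D^2v\|_{L_2(T)}^2$, and $H(\mathrm{dDiv},\Omega;\mathbb S):=\{\boldsymbol M\in L_2(\Omega;\mathbb S):\operatorname{div}\operatorname{\mathbf{div}}\boldsymbol M\in L_2(\Omega)\}$ with $\|\boldsymbol M\|_{\mathrm{dDiv}}^2:=\|\boldsymbol M\|^2+\|\operatorname{div}\operatorname{\mathbf{div}}\boldsymbol M\|^2$. $H^2_0(\Omega)$ is the subspace of $H^2(\Omega)$ with vanishing trace and normal derivative on $\Gamma$; $H^1_0(\Omega)$ is the subspace of $H^1(\Omega)$ with vanishing trace. $\mathcal T$ is a regular (conforming) mesh of shape-regular triangles $T$ covering $\Omega$, with skeleton $\mathcal S=\bigcup_{T\in\mathcal T}\partial T$. $(\cdot,\cdot)_{\mathcal T}$ is the sum of elementwise $L_2$ inner products, with differential operators taken elementwise. $H^2(\mathcal T):=\prod_{T\in\mathcal T}H^2(T)$ (piecewise functions), $\|v\|_{2,\mathcal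 T}^2=\sum_T\|v\|_{2,T}^2$, and $H^{2,1}_0(\mathcal T):=H^2(\mathcal T)\cap H^1_0(\Omega)$. Trace operator $\gamma_{\mathrm{dDiv},\mathit{nn}}:H(\mathrm{dDiv},\Omega;\mathbb S)\to H^{2,1}_0(\mathcal T)^*$, $\langle\gamma_{\mathrm{dDiv},\mathit{nn}}(\boldsymbol M),v\rangle_{\mathcal S}:=(\operatorname{div}\operatorname{\mathbf{div}}\boldsymbol M,v)-(\boldsymbol M,D^2v)_{\mathcal T}$. Trace space $H^{-1/2}(\mathcal S):=\gamma_{\mathrm{dDiv},\mathit{nn}}(H(\mathrm{dDiv},\Omega;\mathbb S))$ with norm $\|\eta\|_{-1/2,\mathcal S}:=\inf\{\|\boldsymbol M\|_{\mathrm{dDiv}}:\gamma_{\mathrm{dDiv},\mathit{nn}}(\boldsymbol M)=\eta\}$; $\langle\eta,v\rangle_{\mathcal S}$ is the action of the functional $\eta$ on $v\in H^{2,1}_0(\mathcal T)$. *)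

(* Defs.v *)
(* Conventions.  Points of the plane are pairs x : R * R.  Elements of Lebesgue
   and Sobolev spaces are represented by Borel functions on R * R of which only
   the values on the relevant domain matter; two representatives are the same
   element iff they agree almost everywhere on that domain.  Derivatives of
   such functions are weak ones; as they are only determined almost everywhere,
   a representative is picked with [xget] (and is 0 if there is none). *)
From HB Require Import structures.
From mathcomp Require Import all_boot all_order all_algebra.
From mathcomp Require Import all_classical all_reals all_analysis.
Set Implicit Arguments.
Unset Strict Implicit.
Unset Printing Implicit Defensive.
Import Order.TTheory GRing.Theory Num.Theory.
Import numFieldNormedType.Exports.
Local Open Scope classical_set_scope.
Local Open Scope ring_scope.

Section Plane.
Variable R : realType.
Implicit Types (A : set (R * R)) (x y : R * R).

Definition mu2 :
    {measure set (measurableTypeR R * measurableTypeR R) 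
       -> \bar R} :=
  (@lebesgue_measure R \x @lebesgue_measure R)%E.

Definition dotp x y : R := x.1 * y.1 + x.2 * y.2.

Definition enorm x : R := Num.sqrt (dotp x x).

Definition crd (i : 'I_2) x : R := if i == 0 then x.1 else x.2.

Definition unit_vec (i : 'I_2) : R * R := if i == 0 then (1, 0) else (0, 1).

(* clockwise rotation by a right angle *)
Definition rotcw x : R * R := (x.2, - x.1).

Definition boundary A : set (R * R) := closure A `\` interior A.

Definition frob (M N : 'M[R]_2) : R := \sum_i \sum_j M i j * N i j.

Definition Sym : set 'M[R]_2 := [set M | M^T = M].

End Plane.
Arguments mu2 {R}.
Arguments Sym {R}.

Section SmoothFunctions.
Variable R : realType.
Implicit Types (A : set (R * R)) (phi : R * R -> R).

Definition pd (i : 'I_2) phi : R * R -> R := fun x => 'D_(unit_vec R i) phi x.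

Fixpoint Ck (k : nat) phi : Prop :=
  if k is k'.+1 then
    continuous phi /\
    (forall i, (forall x, derivable phi x (unit_vec R i)) /\ Ck k' (pd i phi))
  else continuous phi.

Definition smooth phi : Prop := forall k, Ck k phi.

(* C_c^oo(A) *)
Definition test_fun A phi : Prop :=
  smooth phi /\
  (exists K : set (R * R),
     [/\ compact K, K `<=` A & forall x, ~ K x -> phi x = 0]).

End SmoothFunctions.

Section Sobolev.
Variable R : realType.
Implicit Types (A : set (R * R)) (v w g : R * R -> R) (H M : R * R -> 'M[R]_2).

Definition L2 A v : Prop :=
  measurable_fun A v /\ mu2.-integrable A (fun x => (v x ^+ 2)%:E).

Definition L2norm A v : R := Num.sqrt (\int[mu2]_(x in A) (v x ^+ 2)).

Definition L2Sym A M : Prop :=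
  (forall x, A x -> Sym (M x)) /\ (forall i j, L2 A (fun x => M x i j)).

Definition L2Symnorm A M : R :=
  Num.sqrt (\int[mu2]_(x in A) frob (M x) (M x)).

Definition is_wpd A (i : 'I_2) v w : Prop :=
  L2 A w /\
  (forall phi, test_fun A phi ->
     \int[mu2]_(x in A) (v x * pd i phi x)
     = - \int[mu2]_(x in A) (w x * phi x)).

Definition wpd A (i : 'I_2) v : R * R -> R := xget (cst 0) (is_wpd A i v).

Definition is_hess A v H : Prop :=
  L2Sym A H /\
  (forall phi, test_fun A phi -> forall i j,
     \int[mu2]_(x in A) (v x * pd i (pd j phi) x)
     = \int[mu2]_(x in A) (H x i j * phi x)).

Definition hess A v : R * R -> 'M[R]_2 := xget (cst 0) (is_hess A v).

Definition H1 A v : Prop := L2 A v /\ (forall i, exists w, is_wpd A i v w).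

Definition H2 A v : Prop := H1 A v /\ (exists H, is_hess A v H).

(* The norm ||.||_{2,A}; it has no first-order term. *)
Definition norm2 A v : R :=
  Num.sqrt (L2norm A v ^+ 2 + L2Symnorm A (hess A v) ^+ 2).

(* The distribution div div M, with the row-wise inner divergence, acts on a
   test function phi as (M, D^2 phi); g is its L_2 representative. *)
Definition is_divdiv A M g : Prop :=
  L2 A g /\
  (forall phi, test_fun A phi ->
     \int[mu2]_(x in A) (g x * phi x)
     = \int[mu2]_(x in A) frob (M x) (\matrix_(i, j) pd i (pd j phi) x)).

Definition divdiv A M : R * R -> R := xget (cst 0) (is_divdiv A M).

Definition HdDiv A M : Prop := L2Sym A M /\ (exists g, is_divdiv A M g).

Definition dDivnorm A M : R :=
  Num.sqrt (L2Symnorm A M ^+ 2 + L2norm A (divdiv A M) ^+ 2).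

End Sobolev.

Section Polygon.
Variable R : realType.
Implicit Types (A : set (R * R)) (e : (R * R) * (R * R)).

Definition edge_pt e (t : R) : R * R := (1 - t) *: e.1 + t *: e.2.

Definition seg e : set (R * R) := [set edge_pt e t | t in `[0, 1]].

Definition open_seg e : set (R * R) := [set edge_pt e t | t in `]0, 1[].

Definition edge_len e : R := enorm (e.2 - e.1).

(* Unit normal pointing to the right of the oriented edge e. *)
Definition edge_normal e : R * R := (edge_len e)^-1 *: rotcw (e.2 - e.1).

Definition simply_connected A : Prop :=
  forall c : R -> R * R,
    {within `[0, 1], continuous c} -> (forall t, t \in `[0, 1] -> A (c t)) ->
    c 0 = c 1 ->
  exists h : R * R -> R * R,
    [/\ {within `[0, 1] `*` `[0, 1], continuous h},
        forall s t, s \in `[0, 1] -> t \in `[0, 1] -> A (h (s, t)),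
        forall t, t \in `[0, 1] -> h (0, t) = c t,
        forall s, s \in `[0, 1] -> h (s, 0) = h (s, 1)
      & exists y, forall t, t \in `[0, 1] -> h (1, t) = y].

(* Near each boundary point z, and in suitable orthonormal coordinates
   centred at z, A is the strict hypograph of a Lipschitz function. *)
Definition lipschitz_boundary A : Prop :=
  forall z, boundary A z ->
  exists (nu : R * R) (r L : R) (g : R -> R),
    [/\ dotp nu nu = 1, 0 < r, L.-lipschitz g
      & forall y, `|dotp (y - z) (rotcw nu)| < r -> `|dotp (y - z) nu| < r ->
          (A y <-> dotp (y - z) nu < g (dotp (y - z) (rotcw nu)))].

(* Bounded, simply connected Lipschitz polygon.  The edges are oriented with
   the domain on their left, so that [edge_normal] is the exterior normal. *)
Record lipschitzPolygon := LipschitzPolygon {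
  dom :> set (R * R) ;
  edges : seq ((R * R) * (R * R)) ;
  dom_open : open dom ;
  dom_neq0 : dom !=set0 ;
  dom_bounded : bounded_set dom ;
  dom_connected : connected dom ;
  dom_simply_connected : simply_connected dom ;
  dom_lipschitz : lipschitz_boundary dom ;
  edges_uniq : uniq edges ;
  edges_neq : forall e, e \in edges -> e.1 <> e.2 ;
  edges_boundary : boundary dom = \bigcup_(e in [set` edges]) seg e ;
  edges_disjoint : forall e e', e \in edges -> e' \in edges -> e <> e' ->
    open_seg e `&` open_seg e' = set0 ;
  edges_exterior : forall e, e \in edges -> forall t, t \in `]0, 1[ ->
    exists2 s0 : R, 0 < s0 & forall s, 0 < s < s0 ->
      dom (edge_pt e t - s *: edge_normal e) /\
      ~ closure dom (edge_pt e t + s *: edge_normal e)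
}.

End Polygon.

Section Traces.
Variables (R : realType) (P : lipschitzPolygon R).
Implicit Types (v g h : R * R -> R).

Definition L2G g : Prop :=
  forall e, e \in edges P ->
    measurable_fun (`[0, 1] : set R) (fun t => g (edge_pt e t)) /\
    lebesgue_measure.-integrable `[0, 1] (fun t => (g (edge_pt e t) ^+ 2)%:E).

Definition L2Gsqnorm g : R :=
  \sum_(e <- edges P)
    edge_len e * \int[lebesgue_measure]_(t in `[0, 1]) (g (edge_pt e t) ^+ 2).

(* The trace operator is the continuous extension to H^1 of the restriction
   to the boundary of functions that are smooth up to the boundary; this is its
   graph.  The second and third conditions are convergence to v in H^1. *)
Definition is_trace v g : Prop :=
  [/\ H1 P v, L2G g
    & exists phi : nat -> R * R -> R,
      [/\ forall k, smooth (phi k),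
          \int[mu2]_(x in P) ((phi k x - v x) ^+ 2) @[k --> \oo] --> 0,
          forall i,
            \int[mu2]_(x in P) ((pd i (phi k) x - wpd P i v x) ^+ 2)
              @[k --> \oo] --> 0
        & L2Gsqnorm (fun x => phi k x - g x) @[k --> \oo] --> 0]].

(* h = n . tr(grad v) *)
Definition is_normal_trace v h : Prop :=
  exists2 g : 'I_2 -> R * R -> R,
    forall i, is_trace (wpd P i v) (g i)
  & forall e, e \in edges P ->
    {ae lebesgue_measure, forall t, t \in `[0, 1] ->
       h (edge_pt e t)
       = \sum_i crd i (edge_normal e) * g i (edge_pt e t)}.

Definition H1_0 v : Prop := H1 P v /\ is_trace v (cst 0).

Definition H2_0 v : Prop :=
  [/\ H2 P v, is_trace v (cst 0) & is_normal_trace v (cst 0)].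

End Traces.

Section Mesh.
Variable R : realType.

Definition triangle := {ffun 'I_3 -> R * R}.

Implicit Types (T : triangle) (Th : seq triangle) (Omega : set (R * R)).

Definition tdet T : R := dotp (T 1 - T 0) (rotcw (T 2 - T 0)).

Definition convex_weights (l : 'I_3 -> R) : Prop :=
  (forall k, 0 <= l k) /\ \sum_k l k = 1.

Definition thull T : set (R * R) :=
  [set x | exists2 l, convex_weights l & x = \sum_k l k *: T k].

(* Convex hull of the vertices that T shares with T'. *)
Definition common_face T T' : set (R * R) :=
  [set x | exists l, [/\ convex_weights l, x = \sum_k l k *: T k
                       & forall k, l k != 0 -> exists m, T k = T' m]].

Definition tint T : set (R * R) := interior (thull T).

Definition regular_mesh Omega Th : Prop :=
  [/\ uniq Th,
      forall T, T \in Th -> tdet T != 0,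
      closure Omega = \bigcup_(T in [set` Th]) thull T
    & forall T T', T \in Th -> T' \in Th -> T <> T' ->
        tint T `&` tint T' = set0 /\ thull T `&` thull T' = common_face T T'].

(* diam(T)^2 <= kappa |T|, up to the factor 2 = |tdet T| / |T| *)
Definition shape_regular (kappa : R) Th : Prop :=
  forall T, T \in Th ->
    forall k l, enorm (T k - T l) ^+ 2 <= kappa * `|tdet T|.

End Mesh.

Section TensorField.
Variable R : realType.

(* Symmetric, uniformly positive definite L_oo field of linear maps Sym -> Sym;
   the values of C x outside Sym are irrelevant. *)
Record tensor_field (Omega : set (R * R)) (C : R * R -> 'M[R]_2 -> 'M[R]_2)
    : Prop := {
  tensor_Sym : forall x, Omega x -> forall A, Sym A -> Sym (C x A) ;
  tensor_linear : forall x, Omega x -> forall (a : R) A B, Sym A -> Sym B ->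
    C x (a *: A + B) = a *: C x A + C x B ;
  tensor_measurable : forall A, Sym A -> forall i j,
    measurable_fun Omega (fun x => C x A i j) ;
  tensor_bounded : exists K : R, {ae mu2, forall x, Omega x ->
    forall A, Sym A -> frob (C x A) (C x A) <= K * frob A A} ;
  tensor_symmetric : {ae mu2, forall x, Omega x ->
    forall A B, Sym A -> Sym B -> frob (C x A) B = frob A (C x B)} ;
  tensor_posdef : exists2 c0 : R, 0 < c0 & {ae mu2, forall x, Omega x ->
    forall A, Sym A -> c0 * frob A A <= frob (C x A) A}
}.

End TensorField.

Section Hybrid.
Variables (R : realType) (P : lipschitzPolygon R) (Th : seq (triangle R)).
Implicit Types (v u f : R * R -> R) (M : R * R -> 'M[R]_2)
  (eta : (R * R -> R) -> R).

Definition H21_0 v : Prop :=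
  H1_0 P v /\ (forall T, T \in Th -> H2 (tint T) v).

Definition norm2T v : R := Num.sqrt (\sum_(T <- Th) norm2 (tint T) v ^+ 2).

Definition gamma_dDivnn M v : R :=
  \int[mu2]_(x in P) (divdiv P M x * v x)
  - \sum_(T <- Th) \int[mu2]_(x in tint T) frob (M x) (hess (tint T) v x).

(* Functionals on H21_0 are compared by their values on H21_0. *)
Definition has_trace M eta : Prop := forall v, H21_0 v -> eta v = gamma_dDivnn M v.

Definition Hmhalf eta : Prop := exists2 M, HdDiv P M & has_trace M eta.

Definition mhalfnorm eta : R :=
  inf [set dDivnorm P M | M in [set M | HdDiv P M /\ has_trace M eta]].

Definition hybrid_solution (C : R * R -> 'M[R]_2 -> 'M[R]_2) f u eta : Prop :=
  [/\ H21_0 u, Hmhalf eta,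
      forall du, H21_0 du ->
        \sum_(T <- Th) \int[mu2]_(x in tint T)
           frob (C x (hess (tint T) u x)) (hess (tint T) du x)
        + eta du
        = \int[mu2]_(x in P) (f x * du x)
    & forall deta, Hmhalf deta -> deta u = 0].

End Hybrid.

(* Main.v *)
(* The solution is the Kirchhoff-Love deflection: minimising the bending energy
   over test functions gives a sequence whose values, gradients and Hessians
   are Cauchy in L_2 by the Poincare inequality, and its limit u satisfies
   div div (C D^2 u) = f.  The traces of u and of its gradient vanish because
   those of test functions do, so no trace theory is needed; in particular the
   pairing of gamma(M) with such a u is zero, which is the second equation of
   the hybrid problem, and the first is the definition of gamma (C D^2 u).
   Conversely, let u and u' be components of two hybrid solutions.  Testing the
   first equations with u and u' removes eta and eta', and positivity of C shows
   that the elementwise Hessians agree.  To get u = u', test the second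
   equations with gamma(M) for M = C D^2 w and div div M = u' - u; since the
   Hessians agree this leaves (u' - u, u' - u) = 0.  Hence every hybrid solution
   is the Kirchhoff-Love one, and its bound does not see the mesh. *)
Require Import Defs.
From HB Require Import structures.
From mathcomp Require Import all_boot all_order all_algebra.
From mathcomp Require Import all_classical all_reals all_analysis.
From mathcomp Require Import measurable_realfun ring lra.
Set Implicit Arguments.
Unset Strict Implicit.
Unset Printing Implicit Defensive.
Import Order.TTheory GRing.Theory Num.Theory.
Import numFieldNormedType.Exports.
Local Open Scope classical_set_scope.
Local Open Scope ring_scope.

(** * Square integrable functions *)

(** Two features of the setting shape the work. A description of [H2_0] by traces gives no direct
    access to test functions, whereas the distributional div div can only be tested with them. The
    predicate [H2lim] therefore carries an approximating sequence of test functions along with its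
    limit, and a hybrid solution, of which only elementwise regularity and a vanishing trace are
    known, acquires such a sequence by agreeing almost everywhere with the constructed deflection.
    Moreover, weak derivatives are arbitrary choices up to null sets, so norms and pairings must be
    compared with those of a known representative; this rests on the fundamental lemma of the
    calculus of variations. Of the mesh, the proof extracts that the open triangles are disjoint,
    lie inside the domain and fill it up to a null set, so that sums over triangles collapse to
    integrals over the domain. The constant combines the Poincare constant of a rectangle around the
    domain with the bounds of the tensor field. *)

Section SquareIntegrable.
Context d (T : measurableType d) (R : realType) (mu : {measure set T -> \bar R}).
Variables (D : set T) (mD : measurable D).
Implicit Types f g h : T -> R.

(** For [mu2] on the plane this unfolds to [L2], so the lemmas below apply to [L2] by conversion. *)
Definition sqint f : Prop :=
  measurable_fun D f /\ mu.-integrable D (fun x => (f x ^+ 2)%:E).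

Lemma sqint_integrableM f g : sqint f -> sqint g ->
  mu.-integrable D (fun x => (f x * g x)%:E).
Proof.
move=> [mf if_] [mg ig].
apply: (le_integrable mD _ _ (integrableD mD if_ ig)).
  by apply/measurable_EFinP; exact: measurable_funM.
move=> x Dx /=; rewrite -?EFinD lee_fin.
rewrite [leRHS]ger0_norm ?addr_ge0 ?sqr_ge0//.
by rewrite ler_norml; apply/andP; split; nra.
Qed.

Lemma sqintD f g : sqint f -> sqint g -> sqint (fun x => f x + g x).
Proof.
move=> hf hg; have [[mf if_] [mg ig]] := (hf, hg).
split; first exact: measurable_funD.
have := integrableD mD (integrableD mD if_ ig)
  (integrableD mD (sqint_integrableM hf hg) (sqint_integrableM hf hg)).
apply: eq_integrable => // x _ /=.
by rewrite -!EFinD; congr (_%:E); ring.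
Qed.

Lemma sqintZ (a : R) f : sqint f -> sqint (fun x => a * f x).
Proof.
move=> [mf if_]; split; first exact: measurable_funM.
have := integrableZl mD (a ^+ 2) if_.
by apply: eq_integrable => // x _ /=; rewrite -EFinM exprMn.
Qed.

Lemma sqintB f g : sqint f -> sqint g -> sqint (fun x => f x - g x).
Proof.
move=> hf hg; have := sqintD hf (sqintZ (-1) hg).
by under eq_fun do rewrite mulN1r.
Qed.

Definition ip f g : R := \int[mu]_(x in D) (f x * g x).

(** The squared norm serves throughout in place of the norm: estimates stay polynomial, at the price
    of a factor 2 in the triangle inequality. *)
Definition nsq f : R := \int[mu]_(x in D) (f x ^+ 2).

Lemma ipC f g : ip f g = ip g f.
Proof. by apply: eq_Rintegral => x _; rewrite mulrC. Qed.

Lemma ipff f : ip f f = nsq f.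
Proof. by apply: eq_Rintegral => x _; rewrite expr2. Qed.

Lemma nsq_ge0 f : 0 <= nsq f.
Proof. by apply: Rintegral_ge0 => x _; exact: sqr_ge0. Qed.

Lemma ipDl f g h : sqint f -> sqint g -> sqint h ->
  ip (fun x => f x + g x) h = ip f h + ip g h.
Proof.
move=> hf hg hh; rewrite /ip -RintegralD//.
- by apply: eq_Rintegral => x _; rewrite mulrDl.
- exact: sqint_integrableM.
- exact: sqint_integrableM.
Qed.

Lemma ipZl (a : R) f h : sqint f -> sqint h ->
  ip (fun x => a * f x) h = a * ip f h.
Proof.
move=> hf hh; rewrite /ip -RintegralZl//.
  by apply: eq_Rintegral => x _; rewrite mulrA.
exact: sqint_integrableM.
Qed.

Lemma ipBl f g h : sqint f -> sqint g -> sqint h ->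
  ip (fun x => f x - g x) h = ip f h - ip g h.
Proof.
move=> hf hg hh; rewrite -[in RHS]mulN1r -ipZl// -ipDl//; last exact: sqintZ.
by apply: eq_Rintegral => x _; rewrite mulN1r.
Qed.

Lemma ipDr f g h : sqint f -> sqint g -> sqint h ->
  ip h (fun x => f x + g x) = ip h f + ip h g.
Proof. by move=> *; rewrite !(ipC h) ipDl. Qed.

Lemma ipZr (a : R) f h : sqint f -> sqint h ->
  ip h (fun x => a * f x) = a * ip h f.
Proof. by move=> *; rewrite !(ipC h) ipZl. Qed.

Lemma ipBr f g h : sqint f -> sqint g -> sqint h ->
  ip h (fun x => f x - g x) = ip h f - ip h g.
Proof. by move=> *; rewrite !(ipC h) ipBl. Qed.

Lemma nsqZ (a : R) f : sqint f -> nsq (fun x => a * f x) = a ^+ 2 * nsq f.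
Proof.
move=> hf; rewrite -!ipff ipZl ?ipZr ?mulrA -?expr2//; exact: sqintZ.
Qed.

Lemma nsqB f g : sqint f -> sqint g ->
  nsq (fun x => f x - g x) = nsq f - 2 * ip f g + nsq g.
Proof.
move=> hf hg; rewrite -!ipff ipBl ?ipBr//; last exact: sqintB.
by rewrite (ipC g f); ring.
Qed.

Lemma nsqBC f g : nsq (fun x => f x - g x) = nsq (fun x => g x - f x).
Proof. by apply: eq_Rintegral => x _; rewrite -sqrrN opprB. Qed.

Lemma sqint_integrableZ (a : R) f : sqint f ->
  mu.-integrable D (EFin \o (fun x => a * f x ^+ 2)).
Proof.
by move=> [_ /(integrableZl mD a)]; apply: eq_integrable.
Qed.

Lemma nsqD_le f g : sqint f -> sqint g ->
  nsq (fun x => f x + g x) <= 2 * nsq f + 2 * nsq g.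
Proof.
move=> hf hg; rewrite /nsq -!RintegralZl//; [|exact: hg.2|exact: hf.2].
rewrite -RintegralD//; [|exact: sqint_integrableZ|exact: sqint_integrableZ].
apply: le_Rintegral => //; first exact: (sqintD hf hg).2.
  apply: eq_integrable
    (integrableD mD (sqint_integrableZ 2 hf) (sqint_integrableZ 2 hg)) => //.
move=> x _ /=; have := sqr_ge0 (f x - g x); lra.
Qed.

Lemma nsq_triangle f g h : sqint f -> sqint g -> sqint h ->
  nsq (fun x => f x - h x) <=
    2 * nsq (fun x => f x - g x) + 2 * nsq (fun x => g x - h x).
Proof.
move=> hf hg hh; have := nsqD_le (sqintB hf hg) (sqintB hg hh).
by under [nsq _ in X in X -> _]eq_Rintegral do rewrite addrA subrK.
Qed.

(** The polynomial [nsq (f - t g)] in [t] is nonnegative; its value at the minimiser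
    [ip f g / nsq g] gives the inequality. If [nsq g] vanishes, the polynomial is affine in [t],
    which forces [ip f g] to vanish. *)
Lemma cauchy_schwarz_ip f g : sqint f -> sqint g ->
  ip f g ^+ 2 <= nsq f * nsq g.
Proof.
move=> hf hg.
have key (t : R) : 0 <= nsq f - 2 * (t * ip f g) + t ^+ 2 * nsq g.
  rewrite -ipZr// -nsqZ// -nsqB//; last exact: sqintZ.
  exact: nsq_ge0.
have := nsq_ge0 g; rewrite le_eqVlt => /predU1P[g0|g0].
  have h (t : R) : 2 * (t * ip f g) <= nsq f.
    by have := key t; rewrite -g0; lra.
  have : ip f g = 0.
    apply/eqP; apply: contraT => i0.
    (* This [t] would turn the bound into [nsq f + 1 <= nsq f]. *)
    have := h ((nsq f + 1) / (2 * ip f g)).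
    have -> : 2 * ((nsq f + 1) / (2 * ip f g) * ip f g) = nsq f + 1 by field.
    lra.
  by move=> ->; rewrite -g0 expr2 !mulr0.
have := key (ip f g / nsq g).
have -> : nsq f - 2 * (ip f g / nsq g * ip f g) + (ip f g / nsq g) ^+ 2 * nsq g
  = (nsq f * nsq g - ip f g ^+ 2) / nsq g by field; rewrite gt_eqF.
by rewrite pmulr_lge0 ?invr_gt0// subr_ge0.
Qed.

Lemma ae_eq_Rintegral f g : measurable_fun D f -> measurable_fun D g ->
  ae_eq mu D f g -> \int[mu]_(x in D) f x = \int[mu]_(x in D) g x.
Proof.
move=> mf mg fg; congr fine; apply: ae_eq_integral => //.
- exact/measurable_EFinP.
- exact/measurable_EFinP.
- by apply: filterS fg => x h Dx; rewrite h.
Qed.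

Lemma nsq_eq0 f : sqint f -> nsq f = 0 -> ae_eq mu D f (fun=> 0).
Proof.
move=> [mf if_] f0.
have : (\int[mu]_(x in D) `|(f x ^+ 2)%:E| = 0)%E.
  under eq_integral => x _ do rewrite gee0_abs ?lee_fin ?sqr_ge0//.
  by rewrite -[LHS]fineK ?integrable_fin_num// -/(Rintegral _ _ _) -/(nsq f) f0.
move/(ae_eq_integral_abs mu mD (measurable_int _ if_)).
apply: filterS => x h /h [] /eqP; rewrite sqrf_eq0 => /eqP //.
Qed.

Definition cvg2 (u : nat -> T -> R) f :=
  nsq (fun x => u n x - f x) @[n --> \oo] --> (0 : R).

Lemma cvg2P (u : nat -> T -> R) f :
  cvg2 u f <-> forall e, 0 < e -> exists N, forall n, (N <= n)%N ->
    nsq (fun x => u n x - f x) <= e.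
Proof.
split.
  move=> /cvgrPdist_le h e /h [N _ hN]; exists N => n /hN /=.
  by rewrite sub0r normrN ger0_norm// nsq_ge0.
move=> h; apply/cvgrPdist_le => e /h [N hN]; exists N => // n /hN /=.
by rewrite sub0r normrN ger0_norm// nsq_ge0.
Qed.

Lemma cvg2_ip (u : nat -> T -> R) f g : (forall n, sqint (u n)) ->
  sqint f -> sqint g -> cvg2 u f -> ip (u n) g @[n --> \oo] --> ip f g.
Proof.
move=> hu hf hg /cvg2P uf; apply/cvgrPdist_le => e e0.
(* The summand 1 keeps the denominator positive when [nsq g] vanishes. *)
have G0 : 0 < nsq g + 1 by rewrite ltr_wpDl ?nsq_ge0.
have [|N hN] := uf (e ^+ 2 / (nsq g + 1)); first by rewrite divr_gt0 ?exprn_gt0.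
exists N => // n /hN hn; rewrite /= -ipBl//.
rewrite -ler_sqr ?nnegrE ?normr_ge0 ?(ltW e0)// real_normK ?num_real//.
apply: (le_trans (cauchy_schwarz_ip (sqintB hf (hu n)) hg)).
rewrite nsqBC; apply: (@le_trans _ _ (e ^+ 2 / (nsq g + 1) * (nsq g + 1))).
  apply: ler_pM; rewrite ?nsq_ge0//; lra.
by rewrite mulfVK ?gt_eqF.
Qed.

Lemma cvg2_nsq (u : nat -> T -> R) f : (forall n, sqint (u n)) -> sqint f ->
  cvg2 u f -> nsq (u n) @[n --> \oo] --> nsq f.
Proof.
move=> hu hf uf.
have E n : nsq (u n) = nsq (fun x => u n x - f x) + (2 * ip (u n) f - nsq f).
  by rewrite nsqB//; ring.
under eq_fun do rewrite E.
have F : 0 + (2 * ip f f - nsq f) = nsq f by rewrite ipff; ring.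
rewrite -[X in nbhs X]F; apply: cvgD => //; apply: cvgB; last exact: cvg_cst.
by apply: cvgM; [exact: cvg_cst|exact: cvg2_ip].
Qed.

Lemma cvg2B (u v : nat -> T -> R) f g : (forall n, sqint (u n)) ->
  (forall n, sqint (v n)) -> sqint f -> sqint g -> cvg2 u f -> cvg2 v g ->
  cvg2 (fun n x => u n x - v n x) (fun x => f x - g x).
Proof.
move=> hu hv hf hg /cvg2P uf /cvg2P vg; apply/cvg2P => e e0.
have e4 : 0 < e / 4 by rewrite divr_gt0.
have [N1 h1] := uf _ e4; have [N2 h2] := vg _ e4.
exists (maxn N1 N2) => n; rewrite geq_max => /andP[/h1 {}h1 /h2 {}h2].
have := nsqD_le (sqintB (hu n) hf) (sqintB hg (hv n)).
rewrite (_ : nsq (fun x => _ + _) = nsq (fun x => u n x - v n x - (f x - g x))).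
  by rewrite (nsqBC g) => h; apply: le_trans h _; lra.
by apply: eq_Rintegral => x _; congr (_ ^+ 2); ring.
Qed.

(* Riesz-Fischer: the squares of the increments of a fast subsequence, weighted
   by 2^k, have an integrable sum, hence the subsequence converges a.e., and
   Fatou identifies its limit in L_2. *)
Lemma cvg2_cauchy (u : nat -> T -> R) : (forall n, sqint (u n)) ->
  (forall e, 0 < e -> exists N, forall m n, (N <= m)%N -> (N <= n)%N ->
    nsq (fun x => u m x - u n x) <= e) ->
  exists2 f, sqint f & cvg2 u f.
Proof.
move=> hu hC.
(* Squared increments of size [8^-k], weighted by [2^k], are still summable:
   [2^k * 8^-k = 4^-k <= 2^-k]. *)
have e8 k : 0 < (8^-1 : R) ^+ k by rewrite exprn_gt0.
pose N k := sval (cid (hC _ (e8 k))).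
have hN k m n : (N k <= m)%N -> (N k <= n)%N ->
    nsq (fun x => u m x - u n x) <= 8^-1 ^+ k.
  by rewrite /N; case: cid => ? /= h; exact: h.
have geo n : \sum_(k < n) (2^-1 : R) ^+ k <= 2.
  suff -> : \sum_(k < n) (2^-1 : R) ^+ k = 2 - 2 * 2^-1 ^+ n.
    by rewrite gerBl mulr_ge0// exprn_ge0.
  elim: n => [|n IH]; first by rewrite big_ord0 expr0; ring.
  by rewrite big_ord_recr /= IH exprS; field.
(* Summing the thresholds makes [M l] dominate every [N k] with [k <= l]. *)
pose M k := (\sum_(j < k.+1) N j)%N.
have NM k l : (k <= l)%N -> (N k <= M l)%N.
  move=> kl; have kl' : (k < l.+1)%N by rewrite ltnS.
  by rewrite /M (bigD1 (Ordinal kl')) //= leq_addr.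
pose v k := u (M k).
have hv k : sqint (v k) by exact: hu.
have mv k : measurable_fun D (v k) by case: (hv k).
pose dv k x := v k.+1 x - v k x.
have mdv k : measurable_fun D (dv k) by exact: measurable_funB.
have hdv k : nsq (dv k) <= 8^-1 ^+ k by apply: hN; exact: NM.
pose t k x := (2 ^+ k * dv k x ^+ 2)%:E.
have t0 k x : (0 <= t k x)%E by rewrite lee_fin mulr_ge0// ?sqr_ge0// exprn_ge0.
have mt k : measurable_fun D (t k).
  by apply/measurable_EFinP; apply: measurable_funM => //; exact: measurable_funX.
have it k : (\int[mu]_(x in D) t k x <= ((2^-1 : R) ^+ k)%:E)%E.
  have idv : mu.-integrable D (fun x => (dv k x ^+ 2)%:E).
    exact: (sqintB (hv k.+1) (hv k)).2.
  rewrite [leLHS](_ : _ = (2 ^+ k * nsq (dv k))%:E); last first.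
    rewrite /nsq /Rintegral EFinM fineK ?integrable_fin_num//.
    by rewrite -integralZl.
  rewrite lee_fin; apply: (@le_trans _ _ (2 ^+ k * 8^-1 ^+ k)).
    by rewrite ler_wpM2l// exprn_ge0.
  by rewrite -exprMn lerXn2r ?nnegrE//; lra.
pose S x := (\sum_(k <oo) t k x)%E.
have S0 x : (0 <= S x)%E by exact: nneseries_ge0.
have mS : measurable_fun D S by exact: ge0_emeasurable_sum.
have iS : mu.-integrable D S.
  apply/integrableP; split => //.
  under eq_integral do rewrite gee0_abs//.
  rewrite integral_nneseries//.
  apply: (@le_lt_trans _ _ (\sum_(k <oo) ((2^-1 : R) ^+ k)%:E)%E).
    by apply: lee_nneseries => // k _ *; exact: integral_ge0.
  apply: (@le_lt_trans _ _ 2%:E); last exact: ltry.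
  apply: lime_le; first by apply: is_cvg_nneseries => k _ _; rewrite lee_fin exprn_ge0.
  by apply: nearW => n; rewrite sumEFin lee_fin big_mkord.
have Sfin := integrable_ae mD iS.
have vcvg : {ae mu, forall x, D x -> cvgn (fun k => v k x)}.
  apply: filterS Sfin => x /[apply] Sx.
  have [B hB] : exists B, forall n, \sum_(k < n) (2 ^+ k * dv k x ^+ 2) <= B.
    exists (fine (S x)) => n; rewrite -lee_fin fineK// -sumEFin.
    rewrite -(big_mkord xpredT (t^~ x)) /S.
    by apply: nneseries_lim_ge.
  have : cvgn (series (dv ^~ x)).
    apply: normed_cvg; apply: nondecreasing_is_cvgn.
      by apply: nondecreasing_series => *; exact: normr_ge0.
    exists (2 + B) => _ [n _ <-] /=; rewrite /series /= big_mkord.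
    (* Termwise [a <= 1/p + p a^2] with [p = 2^k]; multiplied by [p], this is
       [0 <= (p a - 1)^2 + p a]. *)
    have : \sum_(k < n) `|dv k x| <= \sum_(k < n) ((2^-1) ^+ k + 2 ^+ k * dv k x ^+ 2).
      apply: ler_sum => k _.
      have p0 : 0 < (2 : R) ^+ k by rewrite exprn_gt0.
      rewrite exprVn -real_normK ?num_real//; set a := `|_|; set p := 2 ^+ k in p0 *.
      have : 0 <= (p * a - 1) ^+ 2 + p * a
        by rewrite addr_ge0 ?sqr_ge0 ?mulr_ge0 ?(ltW p0) ?normr_ge0.
      have -> : p^-1 + p * a ^+ 2 = ((p * a - 1) ^+ 2 + p * a) / p + a.
        by field; rewrite gt_eqF.
      by move=> h; rewrite lerDr divr_ge0// ltW.
    move/le_trans; apply; rewrite big_split /=; apply: lerD; [exact: geo|exact: hB].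
  move=> dvc; have -> : (fun k => v k x) = (fun k => series (dv^~ x) k + v 0 x).
    apply/funext => k; rewrite /series /= /dv.
    by rewrite telescope_sumr ?leq0n // subrK.
  apply: is_cvgD => //; exact: is_cvg_cst.
(* The upper limit is measurable whether or not the sequence converges; its values on the null set
   of divergence are irrelevant. *)
pose f x := fine (limn_esup (fun k => (v k x)%:E)).
have mf : measurable_fun D f.
  apply: (measurableT_comp (fine_measurable measurableT)).
  by apply: measurable_fun_limn_esup => k; exact/measurable_EFinP.
have vf : {ae mu, forall x, D x -> v k x @[k --> \oo] --> f x}.
  apply: filterS vcvg => x /[apply] vx.
  have vx' : (v k x)%:E @[k --> \oo] --> (limn (fun k => v k x))%:E.
    by apply: cvg_EFin => //; exact: nearW.
  by rewrite /f (cvg_limn_einf_sup vx').2.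
have mdf k : measurable_fun D (fun x => (f x - v k x) ^+ 2).
  by apply: measurable_funX; exact: measurable_funB.
have mdv2 k l : measurable_fun D (fun x => ((v l x - v k x) ^+ 2)%:E).
  by apply/measurable_EFinP; apply: measurable_funX; exact: measurable_funB.
have key k : (\int[mu]_(x in D) ((f x - v k x) ^+ 2)%:E <= ((8^-1 : R) ^+ k)%:E)%E.
  have -> : (\int[mu]_(x in D) ((f x - v k x) ^+ 2)%:E =
    \int[mu]_(x in D) limn_einf (fun l => ((v l x - v k x) ^+ 2)%:E))%E.
    apply: ae_eq_integral => //.
    - exact/measurable_EFinP.
    - apply: (measurableT_comp (@oppe_measurable R setT)).
      by apply: measurable_fun_limn_esup => l; exact: measurableT_comp.
    - apply: filterS vf => x h Dx.
      have hc : ((v l x - v k x) ^+ 2)%:E @[l --> \oo] --> ((f x - v k x) ^+ 2)%:E.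
        apply: cvg_EFin; first exact: nearW.
        rewrite /comp /=; under eq_fun do rewrite expr2.
        by rewrite expr2; apply: cvgM; apply: cvgB; rewrite ?h//;
          first [exact: h | exact: cvg_cst].
      by rewrite (cvg_limn_einf_sup hc).1.
  (* Fatou bounds the integral by a lower limit of integrals; the index [maxn n k] is beyond both
     [n] and [k], so the Cauchy bound applies to it. *)
  apply: (le_trans (fatou mu mD (fun l => mdv2 k l) _)) => //.
  - by move=> l x _; rewrite lee_fin sqr_ge0.
  rewrite limn_einf_lim; apply: lime_le; first exact: is_cvg_einfs.
  apply: nearW => n; apply: (@le_trans _ _
      (\int[mu]_(x in D) ((v (maxn n k) x - v k x) ^+ 2)%:E)%E).
    by apply: ereal_inf_lbound; exists (maxn n k) => //=; exact: leq_maxl.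
  have iv := (sqintB (hv (maxn n k)) (hv k)).2.
  rewrite -[leLHS]fineK ?integrable_fin_num// lee_fin.
  by apply: hN; apply: NM => //; exact: leq_maxr.
have sfv k : sqint (fun x => f x - v k x).
  split; first exact: measurable_funB.
  apply/integrableP; split; first exact/measurable_EFinP.
  under eq_integral do rewrite gee0_abs ?lee_fin ?sqr_ge0//.
  exact: (le_lt_trans (key k) (ltry _)).
have sf : sqint f.
  by have := sqintD (sfv 0%N) (hv 0%N); under eq_fun do rewrite subrK.
have nfv k : nsq (fun x => f x - v k x) <= 8^-1 ^+ k.
  by rewrite -lee_fin fineK ?integrable_fin_num//; exact: (sfv k).2.
exists f => //; apply/cvg2P => e e0.
have [k hk] : exists k, (8^-1 : R) ^+ k <= e / 4.
  have e40 : 0 < e / 4 by rewrite divr_gt0.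
  have := @cvg_geometric R 1 8^-1.
  rewrite ger0_norm// invf_lt1// => /(_ _)/cvgrPdist_le/(_ _ e40) [].
    by rewrite ltr1n.
  move=> n _ /(_ n (leqnn n)) /=; rewrite sub0r normrN mul1r ger0_norm ?exprn_ge0//.
  by exists n.
exists (N k) => n hn.
apply: (le_trans (nsq_triangle (hu n) (hv k) sf)).
rewrite (nsqBC (v k)).
have h1 := nfv k.
have h2 : nsq (fun x => u n x - v k x) <= 8^-1 ^+ k by apply: hN => //; exact: NM.
by apply: (@le_trans _ _ (2 * (e/4) + 2 * (e/4))); lra.
Qed.

End SquareIntegrable.

(** * Smooth functions with compact support *)

Section Smooth.
Variable R : realType.
Implicit Types (phi psi : R * R -> R) (i j : 'I_2) (A : set (R * R)).

Lemma Ck_continuous k phi : Ck k phi -> continuous phi.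
Proof. by case: k => [//|k [+ _]]. Qed.

Lemma Ck_derivable k phi i x : Ck k.+1 phi -> derivable phi x (unit_vec R i).
Proof. by case=> _ /(_ i) []. Qed.

Lemma Ck_pd k phi i : Ck k.+1 phi -> Ck k (pd i phi).
Proof. by case=> _ /(_ i) []. Qed.

Lemma CkW k phi : Ck k.+1 phi -> Ck k phi.
Proof.
elim: k phi => [|k IH] phi; first by case.
by case=> ? h; split=> // i; have [? ?] := h i; split=> //; exact: IH.
Qed.

Lemma smooth_pd phi i : smooth phi -> smooth (pd i phi).
Proof. by move=> h k; exact: Ck_pd (h k.+1). Qed.

Lemma smooth_continuous phi : smooth phi -> continuous phi.
Proof. by move=> /(_ 0%N). Qed.

Lemma smooth_derivable phi i x : smooth phi -> derivable phi x (unit_vec R i).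
Proof. by move=> /(_ 1%N) /Ck_derivable. Qed.

Lemma pd_cst i (c : R) : pd i (fun=> c) = fun=> 0.
Proof. by apply/funext => x; exact: derive_cst. Qed.

Lemma Ck_cst k (c : R) : Ck k (fun=> c).
Proof.
elim: k c => [|k IH] c; first exact: cst_continuous.
split; first exact: cst_continuous.
by move=> i; split=> [x|]; [exact: derivable_cst|rewrite pd_cst].
Qed.

Lemma pdD i phi psi : (forall x, derivable phi x (unit_vec R i)) ->
  (forall x, derivable psi x (unit_vec R i)) ->
  pd i (fun x => phi x + psi x) = fun x => pd i phi x + pd i psi x.
Proof. by move=> h1 h2; apply/funext => x; exact: deriveD. Qed.

Lemma pdM i phi psi : (forall x, derivable phi x (unit_vec R i)) ->
  (forall x, derivable psi x (unit_vec R i)) ->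
  pd i (fun x => phi x * psi x) = fun x => phi x * pd i psi x + psi x * pd i phi x.
Proof. by move=> h1 h2; apply/funext => x; exact: deriveM. Qed.

Lemma CkD k phi psi : Ck k phi -> Ck k psi -> Ck k (fun x => phi x + psi x).
Proof.
elim: k phi psi => [|k IH] phi psi.
  by move=> h1 h2 x; apply: continuousD; [exact: h1|exact: h2].
move=> [c1 h1] [c2 h2]; split=> [x|i].
  by apply: continuousD; [exact: c1|exact: c2].
have [d1 p1] := h1 i; have [d2 p2] := h2 i; split=> [x|].
  exact: derivableD.
by rewrite pdD//; exact: IH.
Qed.

Lemma CkM k phi psi : Ck k phi -> Ck k psi -> Ck k (fun x => phi x * psi x).
Proof.
elim: k phi psi => [|k IH] phi psi.
  by move=> h1 h2 x; apply: continuousM; [exact: h1|exact: h2].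
move=> h1 h2; split=> [x|i].
  by apply: continuousM; [exact: (Ck_continuous h1)|exact: (Ck_continuous h2)].
have d1 x : derivable phi x (unit_vec R i) by exact: Ck_derivable h1.
have d2 x : derivable psi x (unit_vec R i) by exact: Ck_derivable h2.
split=> [x|]; first exact: derivableM.
rewrite pdM//.
by apply: CkD; apply: IH; [exact: CkW|exact: Ck_pd|exact: CkW|exact: Ck_pd].
Qed.

Lemma smooth_cst (c : R) : smooth (fun=> c).
Proof. by move=> k; exact: Ck_cst. Qed.

Lemma smoothD phi psi : smooth phi -> smooth psi -> smooth (fun x => phi x + psi x).
Proof. by move=> h1 h2 k; exact: CkD. Qed.

Lemma smoothM phi psi : smooth phi -> smooth psi -> smooth (fun x => phi x * psi x).
Proof. by move=> h1 h2 k; exact: CkM. Qed.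

Lemma crd_continuous i : continuous (@crd R i).
Proof. by rewrite /crd; case: (i == 0) => x; [exact: cvg_fst|exact: cvg_snd]. Qed.

Lemma crd_shift i j (h : R) x :
  crd i (h *: unit_vec R j + x) = h * (i == j)%:R + crd i x.
Proof.
rewrite /crd /unit_vec; case: i => [[|[|i]] hi]; case: j => [[|[|j]] hj] //;
  by rewrite /GRing.scale /= ?mulr1 ?mulr0.
Qed.

(** Directional derivatives in the plane are reduced to derivatives on the real line, where
    one-variable calculus applies. *)
Lemma is_derive_line (g : R -> R) phi x i (l : R) :
  (forall h : R, phi (h *: unit_vec R i + x) = g h) ->
  is_derive (0 : R) (1 : R) g l -> is_derive x (unit_vec R i) phi l.
Proof.
move=> E [dg <-].
have E2 : (fun h : R => h^-1 *: ((phi \o shift x) (h *: unit_vec R i) - phi x)) =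
  (fun h : R => h^-1 *: ((g \o shift 0) (h *: (1 : R)) - g 0)).
  apply/funext => h /=; rewrite E addr0 /GRing.scale /= mulr1.
  by rewrite -(E 0) scale0r add0r.
by apply: DeriveDef; rewrite /derivable /derive E2.
Qed.

End Smooth.

(** * A function that is flat at the origin, the source of all cut-offs *)

Section Flat.
Variable R : realType.

(* The powers of 1/t make this family stable under differentiation. *)
Definition flat (n : nat) (t : R) : R :=
  if 0 < t then t^-1 ^+ n * expR (- t^-1) else 0.

Lemma flat_ge0 n t : 0 <= flat n t.
Proof.
rewrite /flat; case: ifP => // t0.
by rewrite mulr_ge0 ?expR_ge0// exprn_ge0// invr_ge0 ltW.
Qed.

(** The exponential series gives [s^(n+2) <= (n+2)! exp s] with [s = 1/t]. A bound quadratic in [t]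
    is what makes the difference quotient at 0 tend to 0. *)
Lemma flat_le n t : `|flat n t| <= (n.+2)`!%:R * t ^+ 2.
Proof.
rewrite ger0_norm ?flat_ge0// /flat; case: ifP => [t0|_]; last first.
  by rewrite mulr_ge0// sqr_ge0.
have s0 : 0 < t^-1 by rewrite invr_gt0.
have := expR_ge1Dxn n.+1 (ltW s0) => h.
have {}h : t^-1 ^+ n.+2 <= (n.+2)`!%:R * expR t^-1.
  rewrite mulrC -ler_pdivrMr ?ltr0n ?fact_gt0//.
  by apply: le_trans h; rewrite lerDr.
rewrite expRN ler_pdivrMr ?expR_gt0//.
have -> : t^-1 ^+ n = t^-1 ^+ n.+2 * t ^+ 2.
  by rewrite -addn2 exprD -mulrA -exprMn mulVf ?gt_eqF// expr1n mulr1.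
by rewrite [leRHS]mulrAC ler_wpM2r// sqr_ge0.
Qed.

Lemma is_derive_flat n (t : R) :
  is_derive t 1 (flat n) (flat n.+2 t - n%:R * flat n.+1 t).
Proof.
have [t0|t0|->] := ltgtP t 0.
- rewrite /flat ltNge (ltW t0) /= mulr0 subr0.
  apply: near_eq_is_derive (is_derive_cst (0 : R) t 1).
  by near=> s; rewrite ltNge ifF//; apply/negbF/ltW; near: s; exact: lt_nbhsl.
- apply: (@near_eq_is_derive R R R (fun s : R => s^-1 ^+ n * expR (- s^-1))).
    by near=> s; rewrite /flat ifT//; near: s; exact: lt_nbhsr.
  have tn0 : t != 0 by rewrite gt_eqF.
  have h1 : is_derive t 1 (fun s : R => s^-1) (- t ^- 2).
    by apply: is_derive_eq (is_deriveV tn0 (is_derive_id t 1)) _; rewrite /GRing.scale /= mulr1.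
  have h2 : is_derive t 1 (fun s : R => s^-1 ^+ n) (n%:R * t^-1 ^+ n.-1 * - t ^- 2).
    have -> : (fun s : R => s^-1 ^+ n) = (fun s : R => s^-1) ^+ n.
      by apply/funext => s; rewrite exprfctE.
    apply: is_derive_eq (is_deriveX n h1) _.
    by rewrite /GRing.scale /=.
  have h3 : is_derive t 1 (fun s : R => expR (- s^-1)) (expR (- t^-1) * t ^- 2).
    have h1' : is_derive t 1 (fun s : R => - s^-1) (t ^- 2).
      by rewrite -[t ^- 2]opprK; exact: is_deriveN.
    exact: (@is_derive1_comp R expR (fun s => - s^-1) t _ _ (is_derive_expR _) h1').
  apply: is_derive_eq (is_deriveM h2 h3) _.
  (* The truncated exponent [n.-1] is harmless for [n = 0], where its term has the factor [n]. *)
  rewrite /flat t0 /GRing.scale /=; case: n {h2} => [|n] /=.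
    by rewrite !mul0r mulr0 addr0 subr0 expr0 mul1r exprVn mulrC.
  rewrite !exprS; field; exact: tn0.
- rewrite /flat ltxx /= mulr0 subr0.
  have E : (fun h : R => h^-1 *: ((flat n \o shift 0) (h *: (1 : R)) - flat n 0)) @ 0^' --> (0 : R).
    pose c : R := (n.+2)`!%:R.
    have c0 : 0 < c by rewrite ltr0n fact_gt0.
    apply/cvgrPdist_le => e e0; near=> h.
    rewrite sub0r normrN /= addr0 /GRing.scale /= mulr1 [flat n 0]/flat ltxx subr0.
    have h0 : h != 0 by near: h; rewrite /dnbhs near_withinE; exact: nearW.
    rewrite normrM normfV mulrC ler_pdivrMr ?normr_gt0//.
    apply: le_trans (flat_le n h) _.
    rewrite -real_normK ?num_real// expr2 mulrA ler_wpM2r//.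
    rewrite -ler_pdivlMl//; near: h.
    have : 0 < c^-1 * e by rewrite mulr_gt0// invr_gt0.
    move=> ce; apply: dnbhs0_le; exact: ce.
  apply: DeriveDef; first by apply/cvg_ex; exists 0.
  exact/cvg_lim.
Unshelve. all: by end_near. Qed.

End Flat.

(** * Test functions and smooth approximations of indicators of rectangles *)

Section TestFunctions.
Variable R : realType.
Implicit Types (phi psi : R * R -> R) (i j : 'I_2) (A : set (R * R)).

Definition flat_aff n (a b : R) i : R * R -> R := fun x => flat n (a * crd i x + b).

Lemma is_derive_flat_aff n a b i j x :
  is_derive x (unit_vec R j) (flat_aff n a b i)
    (a * (i == j)%:R * (flat_aff n.+2 a b i x - n%:R * flat_aff n.+1 a b i x)).
Proof.
pose al : R := a * (i == j)%:R.
apply: (@is_derive_line _ (flat n \o (fun h => al * h + (a * crd i x + b)))).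
  move=> h; rewrite /flat_aff crd_shift /=; congr flat.
  by rewrite /al; ring.
have h1 : is_derive (0 : R) 1 (fun h : R => al * h + (a * crd i x + b)) al.
  have := is_deriveD (is_deriveZ al (is_derive_id (0 : R) (1 : R)))
    (is_derive_cst (a * crd i x + b) (0 : R) (1 : R)).
  by rewrite addr0 /GRing.scale /= mulr1.
have h2 := is_derive_flat n (al * 0 + (a * crd i x + b)).
apply: is_derive_eq (@is_derive1_comp R (flat n)
  (fun h => al * h + (a * crd i x + b)) 0 _ _ h2 h1) _.
by rewrite mulr0 add0r mulrC.
Qed.

(** Each partial derivative is a combination of two members of the same family with larger
    exponents, so the induction on [k] leaves [n] free. *)
Lemma Ck_flat_aff k n a b i : Ck k (flat_aff n a b i).
Proof.
have cont m : continuous (flat_aff m a b i).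
  move=> x; apply: (@continuous_comp _ _ _ (fun x => a * crd i x + b) (flat m)).
    apply: continuousD; last exact: cst_continuous.
    by apply: continuousM; [exact: cst_continuous|exact: crd_continuous].
  apply: differentiable_continuous; apply/derivable1_diffP.
  by have [] := is_derive_flat m (a * crd i x + b).
elim: k n => [|k IH] n; first exact: cont.
split=> // j; split=> [x|]; first by have [] := is_derive_flat_aff n a b i j x.
have -> : pd j (flat_aff n a b i) = fun x => (a * (i == j)%:R) *
    (flat_aff n.+2 a b i x + (- n%:R) * flat_aff n.+1 a b i x).
  apply/funext => x; rewrite mulNr /pd.
  by have [_ ->] := is_derive_flat_aff n a b i j x.
apply: CkM; first exact: Ck_cst.
by apply: CkD => //; apply: CkM => //; exact: Ck_cst.
Qed.

Lemma test_fun_out A phi : test_fun A phi -> forall x, ~ A x -> phi x = 0.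
Proof. by move=> [_ [K [_ KA h]]] x nA; apply: h => /KA. Qed.

(** The complement of [K] is open, so [phi] vanishes near each of its points. *)
Lemma pd_out (K : set (R * R)) phi i : closed K ->
  (forall x, ~ K x -> phi x = 0) -> forall x, ~ K x -> pd i phi x = 0.
Proof.
move=> cK h x nK; rewrite /pd -(derive_cst (0 : R) x (unit_vec R i)).
apply: near_eq_derive.
have : open_nbhs x (~` K) by split=> //; exact: closed_openC.
by move=> /open_nbhs_nbhs; apply: filterS => y /h ->.
Qed.

Lemma compact_closed_plane (K : set (R * R)) : compact K -> closed K.
Proof. by apply: compact_closed; exact: norm_hausdorff. Qed.

Lemma test_fun_pd A phi i : test_fun A phi -> test_fun A (pd i phi).
Proof.
move=> [s [K [cK KA h]]]; split; first exact: smooth_pd.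
exists K; split=> //; apply: pd_out h; exact: compact_closed_plane.
Qed.

Lemma test_fun_smooth A phi : test_fun A phi -> smooth phi.
Proof. by case. Qed.

Lemma test_fun_sub A B phi : A `<=` B -> test_fun A phi -> test_fun B phi.
Proof.
move=> AB [s [K [cK KA h]]]; split=> //; exists K; split=> //.
exact: subset_trans AB.
Qed.

Lemma test_fun0 A : test_fun A (fun=> 0).
Proof.
split; first exact: smooth_cst.
by exists set0; split=> //; exact: compact0.
Qed.

Lemma test_funM A phi psi : smooth phi -> test_fun A psi ->
  test_fun A (fun x => phi x * psi x).
Proof.
move=> s1 [s [K [cK KA h]]]; split; first exact: smoothM.
by exists K; split=> // x /h ->; rewrite mulr0.
Qed.

Lemma test_funD A phi psi : test_fun A phi -> test_fun A psi ->
  test_fun A (fun x => phi x + psi x).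
Proof.
move=> [s1 [K1 [cK1 KA1 h1]]] [s2 [K2 [cK2 KA2 h2]]]; split; first exact: smoothD.
exists (K1 `|` K2); split.
- exact: compactU.
- by move=> x [/KA1|/KA2].
- by move=> x /not_orP [/h1 -> /h2 ->]; rewrite addr0.
Qed.

Lemma test_funZ A (c : R) phi : test_fun A phi -> test_fun A (fun x => c * phi x).
Proof. by move=> h; apply: test_funM h; exact: smooth_cst. Qed.

Lemma test_funB A phi psi : test_fun A phi -> test_fun A psi ->
  test_fun A (fun x => phi x - psi x).
Proof.
move=> h1 /(test_funZ (-1)) h2; have := test_funD h1 h2.
by under eq_fun do rewrite mulN1r.
Qed.

Lemma pdZ i (c : R) phi : (forall x, derivable phi x (unit_vec R i)) ->
  pd i (fun x => c * phi x) = fun x => c * pd i phi x.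
Proof. by move=> h; apply/funext => x; exact: deriveZ. Qed.

Lemma test_pdD A i phi psi : test_fun A phi -> test_fun A psi ->
  pd i (fun x => phi x + psi x) = fun x => pd i phi x + pd i psi x.
Proof. by move=> [h1 _] [h2 _]; apply: pdD => x; exact: smooth_derivable. Qed.

Lemma test_pdZ A i (c : R) phi : test_fun A phi ->
  pd i (fun x => c * phi x) = fun x => c * pd i phi x.
Proof. by move=> [h _]; apply: pdZ => x; exact: smooth_derivable. Qed.

Lemma test_pdB A i phi psi : test_fun A phi -> test_fun A psi ->
  pd i (fun x => phi x - psi x) = fun x => pd i phi x - pd i psi x.
Proof.
move=> h1 h2; have := test_pdD i h1 (test_funZ (-1) h2).
rewrite (test_pdZ i _ h2); under eq_fun do rewrite mulN1r.
by move=> ->; apply/funext => x; rewrite mulN1r.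
Qed.

(** One factor per side of the rectangle []a, b[ x ]c, d[]. Since [flat 0 s = exp (- 1 / s)] for
    [s > 0], these functions stay between 0 and 1 and tend to the indicator of the open rectangle as
    [k] grows. *)
Definition rbump (a b c d : R) (k : nat) : R * R -> R := fun x =>
  flat_aff 0 k%:R (- k%:R * a) 0 x * flat_aff 0 (- k%:R) (k%:R * b) 0 x *
  (flat_aff 0 k%:R (- k%:R * c) 1 x * flat_aff 0 (- k%:R) (k%:R * d) 1 x).

Lemma rbumpE a b c d k x : rbump a b c d k x =
  flat 0 (k%:R * (x.1 - a)) * flat 0 (k%:R * (b - x.1)) *
  (flat 0 (k%:R * (x.2 - c)) * flat 0 (k%:R * (d - x.2))).
Proof.
by rewrite /rbump /flat_aff /crd /=; congr (_ * _ * (_ * _)); congr flat; ring.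
Qed.

Lemma flat0_le1 (t : R) : flat 0 t <= 1.
Proof.
rewrite /flat; case: ifP => // t0.
by rewrite expr0 mul1r expR_le1 oppr_le0 invr_ge0 ltW.
Qed.

Lemma rbump_ge0 a b c d k x : 0 <= rbump a b c d k x.
Proof. by rewrite rbumpE !mulr_ge0 ?flat_ge0. Qed.

Lemma rbump_le1 a b c d k x : rbump a b c d k x <= 1.
Proof. by rewrite rbumpE !mulr_ile1 ?mulr_ge0 ?flat_ge0 ?flat0_le1. Qed.

Lemma flat_le0 n (t : R) : t <= 0 -> flat n t = 0.
Proof. by rewrite /flat leNgt => /negbTE ->. Qed.

Lemma rbump_out a b c d k x : ~ (`]a, b[ `*` `]c, d[) x -> rbump a b c d k x = 0.
Proof.
rewrite rbumpE /= !in_itv /= => h.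
have k0 : 0 <= k%:R :> R by [].
have [x1|x1] := leP x.1 a.
  by rewrite (@flat_le0 _ (_ * (x.1 - a))) ?mul0r// mulr_ge0_le0// subr_le0.
have [x2|x2] := leP b x.1.
  by rewrite (@flat_le0 _ (_ * (b - x.1))) ?mul0r ?mulr0 ?mul0r// mulr_ge0_le0// subr_le0.
have [x3|x3] := leP x.2 c.
  by rewrite (@flat_le0 _ (_ * (x.2 - c))) ?mul0r ?mulr0// mulr_ge0_le0// subr_le0.
have [x4|x4] := leP d x.2.
  by rewrite (@flat_le0 _ (_ * (d - x.2))) ?mul0r ?mulr0// mulr_ge0_le0// subr_le0.
by exfalso; apply: h; rewrite x1 x2 x3 x4.
Qed.

Lemma test_fun_rbump A a b c d k : `[a, b] `*` `[c, d] `<=` A ->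
  test_fun A (rbump a b c d k).
Proof.
move=> h; split.
  by move=> m; do 2 apply: CkM; exact: Ck_flat_aff.
exists (`[a, b] `*` `[c, d]); split=> //.
  by apply: compact_setX; exact: segment_compact.
move=> x nx; apply: rbump_out => -[] /= /subset_itv_oo_cc x1 /subset_itv_oo_cc x2.
exact: nx.
Qed.

Lemma cvg_flat0 (t : R) : 0 < t -> flat 0 (k%:R * t) @[k --> \oo] --> (1 : R).
Proof.
move=> t0; apply/cvgrPdist_le => e e0.
have te0 : 0 < t * e by rewrite mulr_gt0.
near=> k.
have k0 : 0 < k%:R :> R by rewrite ltr0n; near: k; exact: nbhs_infty_gt.
rewrite /flat mulr_gt0// expr0 mul1r.
set s := _^-1.
have s0 : 0 < s by rewrite invr_gt0 mulr_gt0.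
rewrite ger0_norm; last by rewrite subr_ge0 expR_le1 oppr_le0 ltW.
(* [1 - exp (- s) <= s], and [s = 1 / (k t)] falls below [e] for large [k]. *)
have h := expR_ge1Dx (- s).
apply: (@le_trans _ _ s); first by lra.
rewrite /s -[e]invrK lef_pV2 ?posrE ?invr_gt0 ?mulr_gt0//.
rewrite -ler_pdivrMr// -invfM [e * t]mulrC.
near: k; exact: nbhs_infty_ger.
Unshelve. all: by end_near. Qed.

Lemma cvg_rbump a b c d x : (`]a, b[ `*` `]c, d[) x ->
  rbump a b c d k x @[k --> \oo] --> (1 : R).
Proof.
rewrite /= !in_itv /= => -[/andP[x1 x2] /andP[x3 x4]].
under eq_fun do rewrite rbumpE.
rewrite -[X in nbhs X](_ : 1 * 1 * (1 * 1) = 1 :> R); last by rewrite !mulr1.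
by apply: cvgM; apply: cvgM; apply: cvg_flat0; rewrite subr_gt0.
Qed.

End TestFunctions.

(** * The fundamental lemma of the calculus of variations *)

Notation plane R := (measurableTypeR R * measurableTypeR R)%type.

Section PlaneMeasure.
Variable R : realType.
Implicit Types (A B Q : set (R * R)) (g : R * R -> R).

Local Notation measurable2 := (@measurable _ (plane R)).

Definition orect (q : (R * R) * (R * R)) : set (R * R) :=
  `]q.1.1, q.1.2[ `*` `]q.2.1, q.2.2[.

Definition crect (q : (R * R) * (R * R)) : set (R * R) :=
  `[q.1.1, q.1.2] `*` `[q.2.1, q.2.2].

Lemma measurable_orect q : measurable2 (orect q).
Proof. by apply: measurableX; exact: measurable_itv. Qed.

Lemma orectI p q : orect p `&` orect q =
  orect ((Num.max p.1.1 q.1.1, Num.min p.1.2 q.1.2),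
         (Num.max p.2.1 q.2.1, Num.min p.2.2 q.2.2)).
Proof.
apply/seteqP; split=> -[x y] /=; rewrite /orect /= !in_itv /= !gt_max !lt_min.
  by move=> [[/andP[-> ->] /andP[-> ->]] [/andP[-> ->] /andP[-> ->]]].
by move=> [/andP[/andP[-> ->] /andP[-> ->]] /andP[/andP[-> ->] /andP[-> ->]]].
Qed.

(** Cylinders over open intervals are countable unions of open rectangles. The latter, being stable
    under intersection, can thus feed the Dynkin argument of the fundamental lemma. *)
Lemma measurable_plane_orect : measurable2 = <<s range orect >>.
Proof.
have sG : sigma_algebra setT <<s range orect >> by exact: smallest_sigma_algebra.
have [_ _ sU] := sG.
rewrite eqEsubset; split; last first.
  apply: smallest_sub; first exact: sigma_algebra_measurable.
  by move=> _ [q _ <-]; exact: measurable_orect.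
rewrite measurable_prod_measurableType; apply: smallest_sub => // _ [A mA [B mB <-]].
have n_big (x : R) : exists n : nat, - n%:R < x < n%:R.
  exists (Num.truncn `|x|).+1; rewrite -ltr_norml.
  by rewrite truncnS_gt.
have h1 : <<s range orect >> (fst @^-1` A).
  pose S : set (set R) := [set X : set R | <<s range orect >> (fst @^-1` X)].
  suff : S A by [].
  have sS : sigma_algebra setT S.
    have := sigma_algebra_image (fst : R * R -> R) sG; congr sigma_algebra.
    by apply/seteqP; split => X /=; rewrite /S /= /image_set_system /= setTI.
  move: mA; rewrite [X in X -> _](_ : _ = <<s (@RGenOpens.G R) >> A); last first.
    by rewrite -[RHS](congr1 (fun F => F A) (RGenOpens.measurableE R)).
  apply: smallest_sub => // _ [a [b ->]].
  rewrite /S /= (_ : _ @^-1` _ = \bigcup_n orect ((a, b), (- n%:R, n%:R))).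
    by apply: sU => n; apply: sub_sigma_algebra; eexists.
  apply/seteqP; split=> [[x y] /= xab|[x y] [n _] [] //].
  by have [n hn] := n_big y; exists n => //; rewrite /orect /=; split=> //; rewrite in_itv.
have h2 : <<s range orect >> (snd @^-1` B).
  pose S : set (set R) := [set X : set R | <<s range orect >> (snd @^-1` X)].
  suff : S B by [].
  have sS : sigma_algebra setT S.
    have := sigma_algebra_image (snd : R * R -> R) sG; congr sigma_algebra.
    by apply/seteqP; split => X /=; rewrite /S /= /image_set_system /= setTI.
  move: mB; rewrite [X in X -> _](_ : _ = <<s (@RGenOpens.G R) >> B); last first.
    by rewrite -[RHS](congr1 (fun F => F B) (RGenOpens.measurableE R)).
  apply: smallest_sub => // _ [a [b ->]].
  rewrite /S /= (_ : _ @^-1` _ = \bigcup_n orect ((- n%:R, n%:R), (a, b))).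
    by apply: sU => n; apply: sub_sigma_algebra; eexists.
  apply/seteqP; split=> [[x y] /= xab|[x y] [n _] [] //].
  by have [n hn] := n_big x; exists n => //; rewrite /orect /=; split=> //; rewrite in_itv.
exact: (@measurableI _ (g_sigma_algebraType (range orect)) _ _ h1 h2).
Qed.

Definition ratq (q : (rat * rat) * (rat * rat)) : (R * R) * (R * R) :=
  ((ratr q.1.1, ratr q.1.2), (ratr q.2.1, ratr q.2.2)).

(** Rational corners make the union countable, and closed rectangles inside [A] are what [rbump]
    needs to be a test function on [A]. *)
Lemma open_bigcup_orect A : open A ->
  A = \bigcup_(q in [set q | crect (ratq q) `<=` A]) orect (ratq q).
Proof.
move=> oA; apply/seteqP; split=> [[x1 x2] Ax|x [q /= qA] [h1 h2]]; last first.
  by apply: qA; split; exact: subset_itv_oo_cc.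
have /nbhs_ballP[e /= e0 he] : nbhs (x1, x2) A by exact: open_nbhs_nbhs.
have rq (y : R) : exists q : rat * rat,
    [/\ y - e < ratr q.1, ratr q.1 < y, y < ratr q.2 & ratr q.2 < y + e].
  have [|a] := @rat_in_itvoo R (y - e) y; first by rewrite gtrBl.
  rewrite in_itv /= => /andP[a1 a2].
  have [|b] := @rat_in_itvoo R y (y + e); first by rewrite ltrDl.
  by rewrite in_itv /= => /andP[b1 b2]; exists (a, b).
have [[a b] [a1 a2 b1 b2]] := rq x1; have [[c d] [c1 c2 d1 d2]] := rq x2.
exists ((a, b), (c, d)); last by rewrite /orect /ratq /= !in_itv /= a2 b1 c2 d1.
move=> [y1 y2]; rewrite /crect /ratq /= !in_itv /= => -[/andP[u1 u2] /andP[u3 u4]].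
by apply: he; split; rewrite /ball /= ltr_norml; apply/andP; split; simpl in *; lra.
Qed.

Lemma open_measurable_plane A : open A -> measurable2 A.
Proof.
move=> /open_bigcup_orect ->; rewrite bigcup_mkcond.
apply: countable_bigcupT_measurable => // q.
by case: ifP => _; [exact: measurable_orect|exact: measurable0].
Qed.

Lemma continuous_measurable_plane A g : measurable2 A -> continuous g ->
  @measurable_fun _ _ (plane R) R A g.
Proof.
move=> mA cg; apply: (@measurable_funS _ _ (plane R) _ setT) => //.
apply: (@measurability _ _ (plane R) R _ _ (@RGenOpens.G R)).
  exact: RGenOpens.measurableE.
move=> _ [_ [a [b ->]] <-]; rewrite setTI; apply: open_measurable_plane.
by move/continuousP : cg; apply; exact: interval_open.
Qed.

End PlaneMeasure.

Section Fundamental.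
Variable R : realType.
Implicit Types (A B : set (R * R)) (g v : R * R -> R).
Local Notation measurable2 := (@measurable _ (plane R)).

Lemma ae_mp (P Q : R * R -> Prop) : (forall x, P x -> Q x) ->
  {ae mu2, forall x, P x} -> {ae mu2, forall x, Q x}.
Proof.
by move=> h; apply: (@filterS _ _ (@ae_filter_ringOfSetsType _ (plane R) R mu2)).
Qed.

Lemma ae_mp2 (P Q S : R * R -> Prop) : (forall x, P x -> Q x -> S x) ->
  {ae mu2, forall x, P x} -> {ae mu2, forall x, Q x} -> {ae mu2, forall x, S x}.
Proof.
by move=> h; apply: (@filterS2 _ _ (@ae_filter_ringOfSetsType _ (plane R) R mu2)).
Qed.

Lemma Rintegral_support A B v : B `<=` A -> (forall x, A x -> ~ B x -> v x = 0) ->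
  \int[mu2]_(x in A) v x = \int[mu2]_(x in B) v x.
Proof.
move=> BA v0; rewrite Rintegral_mkcond [RHS]Rintegral_mkcond.
apply: eq_Rintegral => x _; rewrite !patchE.
case: ifPn => [/set_mem Ax|nA]; case: ifPn => [/set_mem Bx|nB] //.
  by apply: v0 => // Bx; move/negP : nB; apply; exact/mem_set.
by move/negP : nA; case; exact/mem_set/BA.
Qed.

Lemma mu2_orect_lty q : (@mu2 R (orect q) < +oo)%E.
Proof.
have -> : (mu2 (orect q) = @lebesgue_measure R `]q.1.1, q.1.2[ *
    @lebesgue_measure R `]q.2.1, q.2.2[)%E.
  by apply: product_measure1E; exact: measurable_itv.
rewrite !lebesgue_measure_itv.
by case: ifP => _; case: ifP => _; rewrite ?mule0 ?mul0e// -!EFinD -EFinM ltry.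
Qed.

Lemma sqint_bounded A v M : measurable2 A -> (@mu2 R A < +oo)%E ->
  @measurable_fun _ _ (plane R) R A v -> (forall x, A x -> `|v x| <= M) ->
  @sqint _ (plane R) R mu2 A v.
Proof.
move=> mA fA mv vM; split=> //.
have mv2 : @measurable_fun _ _ (plane R) R A (fun x => v x ^+ 2).
  exact: measurable_funX.
apply: (measurable_bounded_integrable mA fA mv2).
exists (M ^+ 2); split=> [|y My x Ax /=]; first exact: num_real.
apply: le_trans (ltW My); rewrite normrX lerXn2r ?nnegrE//.
  by apply: le_trans (vM x Ax).
exact: vM.
Qed.

Lemma sqint_cst A (c : R) : measurable2 A -> (@mu2 R A < +oo)%E ->
  @sqint _ (plane R) R mu2 A (fun=> c).
Proof.
move=> mA fA; apply: (@sqint_bounded _ _ `|c|) => //; exact: measurable_cst.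
Qed.

Lemma sqint_subset A B v : measurable2 A -> measurable2 B -> B `<=` A ->
  @sqint _ (plane R) R mu2 A v -> @sqint _ (plane R) R mu2 B v.
Proof.
move=> mA mB BA [mv iv]; split.
  exact: (@measurable_funS _ _ (plane R) _ _ _ _ mA).
exact: (@integrableS _ (plane R) _ _ A).
Qed.

Lemma bounded_sub_orect (K : set (R * R)) : bounded_set K -> exists q, K `<=` orect q.
Proof.
move=> [M [_ hM]].
have h x : K x -> `|x| <= M + 1 by apply: hM; rewrite ltrDl.
exists ((- (M + 2), M + 2), (- (M + 2), M + 2)) => x /h.
rewrite /orect /= !in_itv /= -!ltr_norml [`|x|]/(Num.max _ _) ge_max => /andP[h1 h2].
by split; apply: le_lt_trans; [exact: h1| |exact: h2|]; rewrite ltrD2l ltr1n.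
Qed.

Lemma compact_sub_orect (K : set (R * R)) : compact K -> exists q, K `<=` orect q.
Proof. by move=> /compact_bounded; exact: bounded_sub_orect. Qed.

Lemma test_fun_bounded A v : test_fun A v -> exists M, forall x, `|v x| <= M.
Proof.
move=> [s [K [cK KA h]]].
have /compact_bounded [M [_ hM]] : compact (v @` K).
  apply: continuous_compact => //; apply: continuous_subspaceT.
  exact: smooth_continuous.
exists (Num.max 0 (M + 1)) => x.
have [Kx|/h ->] := pselect (K x); last by rewrite normr0 le_max lexx.
by rewrite le_max; apply/orP; right; apply: hM; [rewrite ltrDl|exists x].
Qed.

(** [B] may be unbounded and unrelated to [A]: the function is bounded on a rectangle around its
    support and zero elsewhere. *)
Lemma test_fun_L2 A B v : measurable2 B -> test_fun A v ->
  @sqint _ (plane R) R mu2 B v.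
Proof.
move=> mB tv; have [M hM] := test_fun_bounded tv.
have [s [K [cK KA h]]] := tv.
have [q Kq] := compact_sub_orect cK.
have mq := measurable_orect q.
have sq : @sqint _ (plane R) R mu2 (orect q) v.
  apply: (@sqint_bounded _ _ M) => //; first exact: mu2_orect_lty.
  by apply: continuous_measurable_plane => //; exact: smooth_continuous.
apply: (@sqint_subset setT) => //; split.
  by apply: continuous_measurable_plane => //; exact: smooth_continuous.
have := sq.2; rewrite (@integrable_mkcond _ (plane R))//.
apply: (@eq_integrable _ (plane R)) => // x _.
rewrite patchE; case: ifPn => // /negP nx.
by rewrite h ?expr0n//= => /Kq xq; apply: nx; exact/mem_set.
Qed.

(** The integral of [g] over an open rectangle with closure in [A] is the limit of its integrals
    against [rbump]. A Dynkin argument extends its vanishing to all measurable subsets of the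
    rectangle, which forces [g = 0] almost everywhere there, and countably many rational rectangles
    exhaust [A]. *)
Lemma fundamental_lemma A g : open A -> @sqint _ (plane R) R mu2 A g ->
  (forall phi, test_fun A phi -> \int[mu2]_(x in A) (g x * phi x) = 0) ->
  {ae mu2, forall x, A x -> g x = 0}.
Proof.
move=> oA hg h0; have mA := open_measurable_plane oA.
have key q : crect q `<=` A -> {ae mu2, forall x, orect q x -> g x = 0}.
  move=> qA.
  have sub (r : (R * R) * (R * R)) : orect r `<=` crect r.
    by move=> x [h1 h2]; split; exact: subset_itv_oo_cc.
  have QA : orect q `<=` A := subset_trans (@sub q) qA.
  have mQ := measurable_orect q.
  have hgr r : orect r `<=` A -> @sqint _ (plane R) R mu2 (orect r) g.
    by move=> rA; apply: sqint_subset hg => //; exact: measurable_orect.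
  have igr r : orect r `<=` A ->
      (@mu2 R).-integrable (orect r : set (plane R)) (EFin \o g).
    move=> rA; have := @sqint_integrableM _ (plane R) R mu2 (orect r)
      (measurable_orect r) _ _ (hgr r rA)
      (sqint_cst 1 (measurable_orect r) (mu2_orect_lty r)).
    by apply: eq_integrable => [|x _]; [exact: measurable_orect|rewrite mulr1].
  have int0 r : crect r `<=` A -> (\int[mu2]_(x in orect r) (g x)%:E = 0)%E.
    move=> rA; have rA' := subset_trans (@sub r) rA.
    have mr := measurable_orect r.
    have mg := (hgr r rA').1.
    have H : (\int[mu2]_(x in orect r) (g x * rbump r.1.1 r.1.2 r.2.1 r.2.2 k x)%:E)%E
        @[k --> \oo] --> (\int[mu2]_(x in orect r) (g x)%:E)%E.
      apply: (@dominated_cvg _ (plane R) R mu2 (orect r) mr _ _ (fun x => `|g x|%:E)).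
      - move=> k; apply/measurable_EFinP; apply: measurable_funM => //.
        apply: continuous_measurable_plane => //.
        apply: smooth_continuous; apply: test_fun_smooth.
        exact: (@test_fun_rbump R setT).
      - move=> x rx; apply: cvg_EFin; first exact: nearW.
        have := cvgM (cvg_cst (g x)) (cvg_rbump rx).
        by rewrite mulr1; apply.
      - by [].
      - have := integrable_norm (igr r rA'); apply: eq_integrable => //.
      - move=> k x _ /=; rewrite lee_fin normrM ler_piMr//.
        by rewrite ger0_norm ?rbump_ge0// rbump_le1.
    have E k : (\int[mu2]_(x in orect r)
        (g x * rbump r.1.1 r.1.2 r.2.1 r.2.2 k x)%:E)%E = 0%E.
      have tb : test_fun A (rbump r.1.1 r.1.2 r.2.1 r.2.2 k) by exact: test_fun_rbump.
      rewrite -[LHS]fineK; last first.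
        apply: (@integrable_fin_num _ (plane R)) => //.
        apply: sqint_integrableM => //; first exact: hgr.
        exact: test_fun_L2 tb.
      have := h0 _ tb; rewrite (Rintegral_support rA').
        by rewrite /Rintegral => ->.
      by move=> x _ nx; rewrite rbump_out ?mulr0.
    have := cvg_lim (@ereal_hausdorff R) H.
    by under eq_fun do rewrite E; rewrite lim_cst => // <-.
  have all0 E : measurable2 E -> (\int[mu2]_(x in orect q `&` E) (g x)%:E = 0)%E.
    move=> mE; move: (mE); rewrite measurable_plane_orect; move: E {mE}.
    have igE E : measurable2 E ->
        (@mu2 R).-integrable (orect q `&` E : set (plane R)) (EFin \o g).
      move=> mE; apply: integrableS (igr q QA) => //; exact: measurableI.
    apply: (@dynkin_induction _ (plane R)).
    - exact: measurable_plane_orect.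
    - by move=> _ _ [p _ <-] [r _ <-]; rewrite orectI; eexists.
    - by rewrite setIT; exact: int0.
    - move=> _ [p _ <-]; rewrite orectI; apply: int0.
      apply: subset_trans qA => -[x y] [] /=; rewrite !in_itv /= !ge_max !le_min.
      by move=> /andP[/andP[h1 _] /andP[h2 _]] /andP[/andP[h3 _] /andP[h4 _]];
        split; rewrite /= in_itv /= ?h1 ?h3.
    - move=> E mE E0.
      have := @integral_setU _ (plane R) R mu2 (orect q `&` E) (orect q `&` ~` E)
        (EFin \o g).
      rewrite -setIUr setUv setIT int0// [X in (_ = X + _)%E]E0 add0e => -> //.
      + exact: measurableI.
      + by apply: measurableI => //; exact: measurableC.
      + exact: measurable_int (igr q QA).
      + by apply/disj_setPS => x [[_ ?] [_]].
    - move=> F mF tF F0; rewrite setI_bigcupr integral_bigcup.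
      + by rewrite eseries0.
      + by move=> i j _ _ /=; rewrite setIACA setIid => -[x [_ ?]]; apply: tF => //; exists x.
      + by move=> k; exact: measurableI.
      + by rewrite -setI_bigcupr; apply: igE; exact: bigcupT_measurable.
  have := @integral_ae_eq _ (plane R) R mu2 (orect q) mQ (cst 0%E) (EFin \o g)
    (igr q QA) (measurable_cst _).
  move=> H; have {}H := H _; apply: filterS (H _).
    by move=> x /= hx /hx [].
  move=> E EQ mE; rewrite integral0 -(setIidr EQ); exact: all0.
(* The rational rectangles are enumerated through [pickle], so that their null sets can be
   united. *)
have : {ae mu2, forall x, forall (n : nat) (q : (rat * rat) * (rat * rat)), unpickle n = Some q ->
    crect (@ratq R q) `<=` A -> orect (ratq R q) x -> g x = 0}.
  apply/(@ae_foralln _ (plane R)) => n; case: (unpickle n) => [q|].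
    have [/key|nq] := pselect (crect (@ratq R q) `<=` A).
      by apply: ae_mp => x h _ [<-] _; exact: h.
    by apply: (@aeW _ (plane R)) => x _ [<-].
  by apply: (@aeW _ (plane R)).
apply: ae_mp => x h; rewrite {1}(open_bigcup_orect oA) => -[q qA xq].
exact: (h (pickle q) q (pickleK q) qA xq).
Qed.

End Fundamental.

(** * Integration by parts and the Poincare inequality *)

Section Parts.
Variable R : realType.
Implicit Types (A B : set (R * R)) (phi psi g v : R * R -> R) (i j : 'I_2).
Local Notation measurable2 := (@measurable _ (plane R)).

Lemma rev_ord2_neq i : (i == rev_ord i) = false.
Proof. by case: i => [[|[|//]] hi]. Qed.

(** [rev_ord i] is the other of the two indices, so that lines in direction [i] are parametrised by
    the coordinate across. *)
Lemma crd_unit_vec i x :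
  x = crd i x *: unit_vec R i + crd (rev_ord i) x *: unit_vec R (rev_ord i).
Proof.
have h (a b : R) : a *: ((1, 0) : R * R) + b *: ((0, 1) : R * R) = (a, b).
  rewrite [LHS](_ : _ = (a * 1 + b * 0, a * 0 + b * 1))//.
  by rewrite !mulr1 !mulr0 addr0 add0r.
case: x => a b; case: i => [[|[|//]] hi]; rewrite /crd /unit_vec /= ?h//.
by rewrite addrC h.
Qed.

Lemma is_derive_along phi i x (s : R) :
  derivable phi (s *: unit_vec R i + x) (unit_vec R i) ->
  is_derive s (1 : R) (fun s : R => phi (s *: unit_vec R i + x))
    (pd i phi (s *: unit_vec R i + x)).
Proof.
set F := fun s : R => _.
have E : (fun h : R => h^-1 *: ((F \o shift s) (h *: (1 : R)) - F s)) =
  (fun h : R => h^-1 *: ((phi \o shift (s *: unit_vec R i + x))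
     (h *: unit_vec R i) - phi (s *: unit_vec R i + x))).
  apply/funext => h /=; congr (_ *: (phi _ - _)).
  by rewrite scalerDl addrA /GRing.scale /= mulr1.
by move=> d; apply: DeriveDef; rewrite /derivable /pd /derive E.
Qed.

Lemma test_fun_integrable A B v : measurable2 B -> test_fun A v ->
  (@mu2 R).-integrable (B : set (plane R)) (EFin \o v).
Proof.
move=> mB tv.
have [s [K [cK KA h]]] := tv.
have [q Kq] := compact_sub_orect cK.
have mq := measurable_orect q.
apply: (@integrableS _ (plane R) _ _ setT) => //.
have := @sqint_integrableM _ (plane R) R mu2 _ mq _ _ (test_fun_L2 mq tv)
  (sqint_cst 1 mq (mu2_orect_lty q)).
rewrite (@integrable_mkcond _ (plane R))//.
apply: (@eq_integrable _ (plane R)) => // x _.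
rewrite patchE mulr1; case: ifPn => // /negP nx.
by rewrite /= h// => /Kq xq; apply: nx; exact/mem_set.
Qed.

Lemma FTC_line (F dF : R -> R) (M : R) : 0 < M -> continuous dF ->
  (forall t : R, is_derive t 1 F (dF t)) ->
  (forall t, ~ (`]- M, M[%classic t) -> F t = 0) ->
  (forall t, ~ (`]- M, M[%classic t) -> dF t = 0) ->
  (\int[lebesgue_measure]_t (dF t)%:E = 0)%E.
Proof.
move=> M0 cdF hF F0 dF0.
have cF : continuous F.
  move=> t; apply: differentiable_continuous; apply/derivable1_diffP.
  by have [] := hF t.
have -> : (\int[lebesgue_measure]_t (dF t)%:E =
    \int[lebesgue_measure]_(t in `[(- M)%R, M]) (dF t)%:E)%E.
  rewrite [RHS]integral_mkcond; apply: eq_integral => t _.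
  rewrite patchE; case: ifPn => // /negP nt.
  rewrite dF0// => ht; apply: nt; apply/mem_set; exact: subset_itv_oo_cc.
rewrite (@continuous_FTC2 _ dF F)//.
- by rewrite !F0 ?subee//= in_itv /= ltxx ?andbF.
- lra.
- exact: continuous_subspaceT.
- split.
  + by move=> t _; have [] := hF t.
  + by apply: cvg_at_right_filter; exact: cF.
  + by apply: cvg_at_left_filter; exact: cF.
- by move=> t _; rewrite derive1E; have [_ ->] := hF t.
Qed.

Lemma test_fun_orect A v : test_fun A v -> exists2 M : R, 0 < M &
  forall x, ~ orect ((- M, M), (- M, M)) x -> v x = 0.
Proof.
move=> [s [K [cK KA h]]].
have [M [_ hM]] := compact_bounded cK.
have M1 : M < Num.max M 0 + 1 by rewrite (@le_lt_trans _ _ (Num.max M 0)) ?le_max ?lexx ?ltrDl.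
exists (Num.max M 0 + 2); first by rewrite ltr_wpDl// le_max lexx orbT.
move=> x nx; apply: h => /(hM _ M1) hx; apply: nx.
have {hx} : `|x| <= Num.max M 0 + 1 by exact: hx.
rewrite [`|x|]/(Num.max _ _) /orect /= ge_max !in_itv /= -!ltr_norml.
by move=> /andP[h1 h2]; split; apply: le_lt_trans; [exact: h1| |exact: h2|]; rewrite ltrD2l ltr1n.
Qed.

(** Fubini with the inner integral along direction [i]: on each line the integrand is the derivative
    of a function with bounded support. *)
Lemma integral_pd A phi i : test_fun A phi -> \int[mu2]_x pd i phi x = 0.
Proof.
move=> tphi; have tp := test_fun_pd i tphi.
have ip := test_fun_integrable measurableT tp.
have [s _] := tphi.
have [M1 M10 h1] := test_fun_orect tphi; have [M2 M20 h2] := test_fun_orect tp.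
pose M := Num.max M1 M2.
have M0 : 0 < M by rewrite lt_max M10.
have out (t : R) N : (N <= M) -> ~ `]- M, M[%classic t -> ~~ (- N < t < N).
  move=> NM; rewrite /= in_itv /= -!ltr_norml => /negP; apply: contra.
  by move=> /lt_le_trans; apply.
have M1M : M1 <= M by rewrite le_max lexx.
have M2M : M2 <= M by rewrite le_max lexx orbT.
have line0 x : (\int[lebesgue_measure]_t
    (pd i phi (t *: unit_vec R i + (crd (rev_ord i) x *: unit_vec R (rev_ord i))))%:E = 0)%E.
  set y := _ *: _.
  have crdE (t : R) : crd i (t *: unit_vec R i + y) = t.
    rewrite crd_shift eqxx mulr1 -[y]addr0 crd_shift rev_ord2_neq.
    have -> : crd i (0 : R * R) = 0 by rewrite /crd; case: (i == 0).
    by rewrite mulr0 !addr0.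
  have outr (t : R) N : (N <= M) -> ~ `]- M, M[%classic t ->
      ~ orect ((- N, N), (- N, N)) (t *: unit_vec R i + y).
    move=> NM /(out _ _ NM) nt [/= ]; rewrite !in_itv /= => a1 a2.
    move/negP: nt; apply; rewrite -(crdE t) /crd; by case: (i == 0).
  apply: (@FTC_line (fun t => phi (t *: unit_vec R i + y)) _ M) => //.
  - move=> t; apply: (@continuous_comp _ _ _ (fun t : R => t *: unit_vec R i + y) (pd i phi)).
      apply: continuousD; last exact: cst_continuous.
      exact: scalel_continuous.
    exact: smooth_continuous (smooth_pd i s) _.
  - by move=> t; apply: is_derive_along; exact: smooth_derivable.
  - by move=> t /(outr _ _ M1M)/h1.
  - by move=> t /(outr _ _ M2M)/h2.
rewrite /Rintegral.
case: i tp ip h2 line0 => [[|[|//]] hi] tp ip h2 line0.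
- have -> : (\int[mu2]_x (pd (Ordinal hi) phi x)%:E =
    \int[@lebesgue_measure R]_y \int[@lebesgue_measure R]_x (pd (Ordinal hi) phi (x, y))%:E)%E.
    exact/esym/(@integral21_prod_meas1 _ _ _ _ R lebesgue_measure lebesgue_measure _ ip).
  rewrite (eq_integral (fun=> 0%E)) ?integral0// => y _.
  rewrite -(line0 (0, y)); apply: eq_integral => x _; congr (pd _ _ _)%:E.
  exact: (crd_unit_vec (Ordinal hi) (x, y)).
- have -> : (\int[mu2]_x (pd (Ordinal hi) phi x)%:E =
    \int[@lebesgue_measure R]_x \int[@lebesgue_measure R]_y (pd (Ordinal hi) phi (x, y))%:E)%E.
    exact/esym/(@integral12_prod_meas1 _ _ _ _ R lebesgue_measure lebesgue_measure _ ip).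
  rewrite (eq_integral (fun=> 0%E)) ?integral0// => x _.
  rewrite -(line0 (x, 0)); apply: eq_integral => y _; congr (pd _ _ _)%:E.
  exact: (crd_unit_vec (Ordinal hi) (x, y)).
Qed.

End Parts.

(** * Symmetry of second derivatives and the Poincare inequality *)

Section Schwarz.
Variable R : realType.
Implicit Types (A B : set (R * R)) (phi psi g v : R * R -> R) (i j : 'I_2).
Local Notation measurable2 := (@measurable _ (plane R)).

Lemma MVT_line (F dF : R -> R) (h : R) : 0 < h ->
  (forall t : R, is_derive t (1 : R) F (dF t)) ->
  exists2 s : R, 0 < s < h & F h - F 0 = dF s * h.
Proof.
move=> h0 hF; have [|s] := @MVT R F dF 0 h h0 (fun t _ => hF t).
- apply: continuous_subspaceT => t; apply: differentiable_continuous.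
  by apply/derivable1_diffP; have [] := hF t.
- by rewrite in_itv /= subr0 => s0 E; exists s.
Qed.

Lemma subACA (a b c d : R) : a - b - (c - d) = a - c - (b - d).
Proof. by ring. Qed.

Lemma dist_mid (a b p e : R) : `|a - p| < e -> `|b - p| < e -> `|a - b| < e + e.
Proof. by rewrite !ltr_norml => /andP[? ?] /andP[? ?]; apply/andP; split; lra. Qed.

(** The mean value theorem in direction [i] for the difference taken in direction [j], and then in
    direction [j] for [pd i phi]. *)
Lemma double_difference phi i j x (h : R) : smooth phi -> 0 < h ->
  exists s t : R, [/\ 0 < s < h, 0 < t < h &
    phi (h *: unit_vec R i + (h *: unit_vec R j + x)) - phi (h *: unit_vec R i + x)
      - (phi (h *: unit_vec R j + x) - phi x)
    = pd j (pd i phi) (t *: unit_vec R j + (s *: unit_vec R i + x)) * h * h].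
Proof.
move=> sphi h0.
pose dF (s : R) := pd i phi (s *: unit_vec R i + (h *: unit_vec R j + x))
  - pd i phi (s *: unit_vec R i + x).
have [|s sh] := @MVT_line (fun s => phi (s *: unit_vec R i + (h *: unit_vec R j + x))
  - phi (s *: unit_vec R i + x)) dF h h0.
  by move=> t; apply: is_deriveB; apply: is_derive_along; exact: smooth_derivable.
rewrite !scale0r !add0r => ->.
have [|t th] := @MVT_line (fun t => pd i phi (t *: unit_vec R j + (s *: unit_vec R i + x)))
  (fun t => pd j (pd i phi) (t *: unit_vec R j + (s *: unit_vec R i + x))) h h0.
  by move=> t; apply: is_derive_along; apply: smooth_derivable; exact: smooth_pd.
rewrite !scale0r !add0r => E; exists s, t; split => //.
by rewrite /dF (addrCA (s *: _)) E.
Qed.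

Lemma norm_unit_vec i : `|unit_vec R i| <= 1.
Proof.
by rewrite /unit_vec; case: ifP => _; rewrite [`|_|]/(Num.max _ _) /= normr1 normr0 ge_max lexx ler01.
Qed.

(** The double difference is symmetric in the two directions and equals [h^2] times either mixed
    derivative at some point near [x]; continuity does the rest. *)
Lemma pdC i j phi : smooth phi -> pd i (pd j phi) = pd j (pd i phi).
Proof.
move=> sphi; apply/funext => x; apply/eqP/negPn/negP => ne.
(* Half of the supposed gap: no value can be closer than [e] to both derivatives. *)
pose e := `|pd i (pd j phi) x - pd j (pd i phi) x| / 2.
have e0 : 0 < e by rewrite divr_gt0// normr_gt0 subr_eq0.
have near_pd k l : exists2 d : R, 0 < d & forall y, `|y - x| < d ->
    `|pd k (pd l phi) x - pd k (pd l phi) y| < e.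
  have c := smooth_continuous (smooth_pd k (smooth_pd l sphi)).
  have /cvgrPdist_lt/(_ e e0) := c x.
  move=> /nbhs_ballP[d /= d0 hd]; exists d => // y yx; apply: hd.
  by rewrite -ball_normE /= distrC.
have [d1 d10 h1] := near_pd i j; have [d2 d20 h2] := near_pd j i.
pose h := Num.min d1 d2 / 2.
have m0 : 0 < Num.min d1 d2 by rewrite lt_min d10.
have h0 : 0 < h by rewrite divr_gt0.
have close k l (s t : R) : 0 < s < h -> 0 < t < h ->
    `|t *: unit_vec R k + (s *: unit_vec R l + x) - x| < Num.min d1 d2.
  move=> /andP[s0 sh] /andP[t0 th]; rewrite addrA addrK.
  apply: le_lt_trans (ler_normD _ _) _.
  have a (r : R) m : 0 < r -> `|r *: unit_vec R m| <= r.
    by move=> r0; rewrite normrZ gtr0_norm// ler_piMr ?norm_unit_vec// ltW.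
  apply: (@le_lt_trans _ _ (t + s)); first by rewrite lerD ?a.
  by rewrite (splitr (Num.min d1 d2)) ltrD.
have [s [t [sh th E1]]] := double_difference i j x sphi h0.
have [s' [t' [sh' th' E2]]] := double_difference j i x sphi h0.
have E : pd j (pd i phi) (t *: unit_vec R j + (s *: unit_vec R i + x)) =
         pd i (pd j phi) (t' *: unit_vec R i + (s' *: unit_vec R j + x)).
  apply: (mulIf (lt0r_neq0 h0)); apply: (mulIf (lt0r_neq0 h0)).
  apply: etrans (esym E1) (etrans _ E2).
  rewrite (addrCA (h *: _)); exact: subACA.
have := h2 _ (lt_le_trans (close j i _ _ sh th) _).
have := h1 _ (lt_le_trans (close i j _ _ sh' th') _).
rewrite !ge_min !lexx orbT E => /(_ isT) l1 /(_ isT) l2.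
by have := dist_mid l1 l2; rewrite /e -splitr ltxx.
Qed.

Lemma smooth_crd i : smooth (@crd R i).
Proof.
have d j x : is_derive x (unit_vec R j) (@crd R i) (i == j)%:R.
  apply: (@is_derive_line _ (fun h : R => (i == j)%:R * h + crd i x)).
    by move=> h; rewrite crd_shift mulrC.
  have := is_deriveD (is_deriveZ (i == j)%:R (is_derive_id (0 : R) (1 : R)))
    (is_derive_cst (crd i x) (0 : R) (1 : R)).
  by rewrite addr0 /GRing.scale /= mulr1.
case=> [|k]; first exact: crd_continuous.
split; first exact: crd_continuous.
move=> j; split=> [x|]; first by have [] := d j x.
rewrite (_ : pd j _ = fun=> (i == j)%:R); first exact: Ck_cst.
by apply/funext => x; have [_ <-] := d j x.
Qed.

Lemma pd_crd i : pd i (@crd R i) = fun=> 1.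
Proof.
apply/funext => x.
have D : is_derive x (unit_vec R i) (@crd R i) 1.
  apply: (@is_derive_line R (fun h : R => h + crd i x)).
    by move=> h; rewrite crd_shift eqxx mulr1.
  have := is_deriveD (is_derive_id (0 : R) (1 : R))
    (is_derive_cst (crd i x) (0 : R) (1 : R)).
  by rewrite addr0.
by have [_ <-] := D.
Qed.

Lemma integral_parts A i phi psi : measurable2 A -> smooth psi -> test_fun A phi ->
  \int[mu2]_(x in A) (psi x * pd i phi x) = - \int[mu2]_(x in A) (phi x * pd i psi x).
Proof.
move=> mA spsi tphi.
have t1 := test_funM spsi tphi.
have := integral_pd i t1.
rewrite (pdM (i := i)); last 2 first.
- by move=> x; exact: smooth_derivable.
- by move=> x; exact: smooth_derivable (test_fun_smooth tphi).
rewrite (@Rintegral_support _ _ A)//; last first.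
  move=> x _ nA; rewrite (test_fun_out tphi)// mul0r addr0.
  by rewrite (test_fun_out (test_fun_pd i tphi))// mulr0.
rewrite (@RintegralD _ (plane R))//; first by move/eqP; rewrite addr_eq0 => /eqP.
- exact: test_fun_integrable (test_funM spsi (test_fun_pd i tphi)).
- have := test_funM (smooth_pd i spsi) tphi.
  under eq_fun do rewrite mulrC.
  exact: test_fun_integrable.
Qed.

(** The derivative of [x_i phi^2] in direction [i] is [phi^2 + 2 x_i phi psi] with [psi = pd i phi],
    and its integral is 0. Young's inequality [2 x_i phi psi >= - phi^2 / 2 - 2 x_i^2 psi^2] absorbs
    half of [phi^2], whence the factor 4. *)
Lemma poincare A i phi (L : R) : measurable2 A ->
  (forall x, A x -> `|crd i x| <= L) -> test_fun A phi ->
  @nsq _ (plane R) R mu2 A phi <= 4 * L ^+ 2 * @nsq _ (plane R) R mu2 A (pd i phi).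
Proof.
move=> mA AL tphi.
have sphi := test_fun_smooth tphi.
have tp := test_fun_pd i tphi.
have t2 := test_funM (smooth_crd i) (test_funM sphi tphi).
have d1 x : derivable phi x (unit_vec R i) by exact: smooth_derivable.
have E : pd i (fun x => crd i x * (phi x * phi x)) =
    fun x => phi x ^+ 2 + 2 * crd i x * phi x * pd i phi x.
  rewrite pdM ?pdM// ?pd_crd.
  - by apply/funext => x; ring.
  - by move=> x; exact: smooth_derivable (smooth_crd i).
  - by move=> x; exact: derivableM.
have := integral_pd i t2.
rewrite E (@Rintegral_support _ _ A)//; last first.
  by move=> x _ nA; rewrite (test_fun_out tphi)// expr2 !(mul0r, mulr0) addr0.
have h1 := test_fun_L2 mA tphi; have h2 := test_fun_L2 mA tp.
have i1 := @sqint_integrableZ _ (plane R) R mu2 A mA 2^-1 _ h1.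
have i2 := @sqint_integrableZ _ (plane R) R mu2 A mA (- (2 * L ^+ 2)) _ h2.
move=> I0.
have : \int[mu2]_(x in A) (2^-1 * phi x ^+ 2 + (- (2 * L ^+ 2)) * pd i phi x ^+ 2) <= 0.
  rewrite -[leRHS]I0; apply: (@le_Rintegral _ (plane R)) => //.
  - by apply: eq_integrable (integrableD mA i1 i2).
  - by rewrite -E; exact: test_fun_integrable (test_fun_pd i t2).
  move=> x /AL; rewrite ler_norml => /andP[l1 l2].
  have : 0 <= (L - crd i x) * (L + crd i x) by apply: mulr_ge0; lra.
  move=> l3; have : crd i x ^+ 2 <= L ^+ 2 by lra.
  move=> l4; have l5 : 0 <= (L ^+ 2 - crd i x ^+ 2) * pd i phi x ^+ 2.
    by rewrite mulr_ge0 ?sqr_ge0// subr_ge0.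
  have := sqr_ge0 (phi x + 2 * crd i x * pd i phi x); lra.
rewrite (@RintegralD _ (plane R))// !(@RintegralZl _ (plane R))//; [|exact: h2.2|exact: h1.2].
rewrite -/(@nsq _ (plane R) R mu2 A phi) -/(@nsq _ (plane R) R mu2 A (pd i phi)).
lra.
Qed.

End Schwarz.

(** * Approximate minimisers of quadratic functionals *)

Section AlmostEverywhere.
Context d (T : measurableType d) (R : realType) (mu : {measure set T -> \bar R}).
Variables (D : set T) (mD : measurable D).
Implicit Types f g h : T -> R.

Lemma integrable_ae_eq f g : measurable_fun D g -> ae_eq mu D f g ->
  mu.-integrable D (EFin \o f) -> mu.-integrable D (EFin \o g).
Proof.
move=> mg fg if_.
have mf := measurable_int _ if_.
have mg' : measurable_fun D (EFin \o g) by exact/measurable_EFinP.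
apply/integrableP; split=> //.
move/integrableP: if_ => [_].
rewrite (_ : (\int[mu]_(x in D) `|(EFin \o f) x| =
  \int[mu]_(x in D) `|(EFin \o g) x|)%E)//.
apply: ae_eq_integral => //; try exact: measurableT_comp.
by apply: filterS fg => x h Dx; rewrite /= h.
Qed.

(** Replacing [f] by the minimum of [f] and [g], which is [f] almost everywhere, turns the
    inequality into one that holds everywhere on [D]. *)
Lemma le_Rintegral_ae f g : mu.-integrable D (EFin \o f) ->
  mu.-integrable D (EFin \o g) -> {ae mu, forall x, D x -> f x <= g x} ->
  \int[mu]_(x in D) f x <= \int[mu]_(x in D) g x.
Proof.
move=> if_ ig fg.
have /measurable_EFinP mf := measurable_int _ if_.
have /measurable_EFinP mg := measurable_int _ ig.
have mfg : measurable_fun D (fun x => Num.min (f x) (g x)) by exact: measurable_minr.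
have fgE : ae_eq mu D f (fun x => Num.min (f x) (g x)).
  by apply: filterS fg => x h Dx; rewrite min_l// h.
rewrite (ae_eq_Rintegral mD mf mfg fgE).
apply: le_Rintegral => //; first exact: integrable_ae_eq fgE if_.
by move=> x _; rewrite ge_min lexx orbT.
Qed.

Lemma sqint_le_ae f g : measurable_fun D f -> sqint mu D g ->
  {ae mu, forall x, D x -> f x ^+ 2 <= g x ^+ 2} -> sqint mu D f.
Proof.
move=> mf [mg ig] fg; split=> //.
have mf2 : measurable_fun D (fun x => f x ^+ 2) by exact: measurable_funX.
have mg2 : measurable_fun D (fun x => g x ^+ 2) by exact: measurable_funX.
have mfg : measurable_fun D (fun x => Num.min (f x ^+ 2) (g x ^+ 2)).
  exact: measurable_minr.
apply: (@integrable_ae_eq (fun x => Num.min (f x ^+ 2) (g x ^+ 2)) _ mf2).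
  by apply: filterS fg => x h Dx; rewrite min_l// h.
apply: (le_integrable mD _ _ ig); first exact/measurable_EFinP.
move=> x Dx /=; rewrite lee_fin !ger0_norm ?sqr_ge0 ?le_min ?sqr_ge0//.
by rewrite ge_min lexx orbT.
Qed.

End AlmostEverywhere.

(* Minimising the quadratic functional a(v,v)/2 - l(v) over a linear space S
   that need not be complete: perturbing an almost minimiser shows that it
   almost satisfies the Euler equation. *)
Lemma ritz (R : realType) (T : Type) (S : (T -> R) -> Prop)
    (a : (T -> R) -> (T -> R) -> R) (l : (T -> R) -> R) (M : R) :
  S (fun=> 0) ->
  (forall (t : R) p q, S p -> S q -> S (fun x => p x + t * q x)) ->
  (forall (t : R) p q, S p -> S q ->
    a (fun x => p x + t * q x) (fun x => p x + t * q x)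
    = a p p + 2 * t * a p q + t ^+ 2 * a q q) ->
  (forall (t : R) p q, S p -> S q -> l (fun x => p x + t * q x) = l p + t * l q) ->
  (forall p, S p -> 0 <= a p p) -> (forall p, S p -> l p ^+ 2 <= M * a p p) ->
  exists p : nat -> T -> R, forall n, S (p n) /\
    (forall q, S q -> (a (p n) q - l q) ^+ 2 <= 2 * a q q / n.+1%:R).
Proof.
move=> S0 SD aD lD a0 lM.
pose J p := a p p / 2 - l p.
(* The arithmetic-geometric mean inequality gives [|l p| <= (|M| + a p p) / 2], so [J] is bounded
   below. *)
have Jge p : S p -> - (`|M| / 2) <= J p.
  move=> Sp; rewrite /J.
  have h1 := lM _ Sp; have h2 := a0 _ Sp.
  have h3 : M * a p p <= `|M| * a p p by rewrite ler_wpM2r// ler_norm.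
  have h4 : l p ^+ 2 <= ((`|M| + a p p) / 2) ^+ 2.
    have := sqr_ge0 (`|M| - a p p); lra.
  have h5 : 0 <= (`|M| + a p p) / 2 by rewrite divr_ge0// addr_ge0.
  have : `|l p| <= (`|M| + a p p) / 2.
    by rewrite -ler_sqr ?nnegrE// real_normK ?num_real.
  by rewrite ler_norml => /andP[_ ?]; lra.
pose E := [set J p | p in [set p | S p]].
have hE : has_inf E.
  split; first by exists (J (fun=> 0)), (fun=> 0).
  by exists (- (`|M| / 2)) => _ [p Sp <-]; exact: Jge.
have ex n : exists p, S p /\ J p < inf E + n.+1%:R^-1.
  have e0 : 0 < n.+1%:R^-1 :> R by rewrite invr_gt0.
  by have [_ [p Sp <-] lt] := inf_adherent e0 hE; exists p.
have [p hp] := choice ex.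
exists p => n; have [Sp Jp] := hp n; split=> // q Sq.
set b := a (p n) q - l q; set A := a q q.
have A0 : 0 <= A by exact: a0.
have e0 : 0 < n.+1%:R^-1 :> R by rewrite invr_gt0.
set e : R := n.+1%:R^-1 in e0 Jp *.
(* Along any line through the almost minimiser, [J] drops by at most [e]; its increment is this
   polynomial in [t]. *)
have key (t : R) : - e <= t * b + t ^+ 2 / 2 * A.
  have Spt := SD t _ _ Sp Sq.
  have : inf E <= J (fun x => p n x + t * q x).
    by apply: ge_inf; [exact: hE.2|exists (fun x => p n x + t * q x)].
  rewrite /J aD// lD//; rewrite /J in Jp; rewrite /b /A.
  move=> h; lra.
rewrite -/A -/e; move: A0; rewrite le_eqVlt => /predU1P[A0|A0].
  suff -> : b = 0 by rewrite -A0; lra.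
  apply/eqP; apply: contraT => b0.
  have := key (- (e + 1) / b).
  by rewrite mulfVK// -A0; lra.
(* At the minimiser of the polynomial the bound reads [b^2 <= 2 A e]. *)
have := key (- b / A).
have -> : - b / A * b + (- b / A) ^+ 2 / 2 * A = - (b ^+ 2 / (2 * A)).
  by field; rewrite gt_eqF.
rewrite lerN2 ler_pdivrMr ?mulr_gt0//; lra.
Qed.

(** * Matrix fields *)

Section MatrixFields.
Variable R : realType.
Implicit Types (M N : 'M[R]_2).

Lemma frobE M N : frob M N =
  M 0 0 * N 0 0 + M 0 1 * N 0 1 + M 1 0 * N 1 0 + M 1 1 * N 1 1.
Proof.
rewrite /frob !big_ord_recl !big_ord0 !addr0 addrA.
by rewrite (_ : lift ord0 ord0 = 1)//; apply/val_inj.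
Qed.

Lemma frobC M N : frob M N = frob N M.
Proof. by rewrite !frobE; ring. Qed.

Lemma frob_ge0 M : 0 <= frob M M.
Proof. by rewrite frobE !addr_ge0// -expr2 sqr_ge0. Qed.

Lemma ord2P (m : 'I_2) : m = 0 \/ m = 1.
Proof. by case: m => -[|[|//]] hm; [left|right]; exact/val_inj. Qed.

Lemma frob_ge_entry M i j : M i j ^+ 2 <= frob M M.
Proof.
rewrite frobE -!expr2.
have := sqr_ge0 (M 0 0); have := sqr_ge0 (M 0 1); have := sqr_ge0 (M 1 0).
have := sqr_ge0 (M 1 1).
by case: (ord2P i) => ->; case: (ord2P j) => ->; lra.
Qed.

Lemma frobDl M M' N : frob (M + M') N = frob M N + frob M' N.
Proof. by rewrite !frobE !mxE; ring. Qed.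

Lemma frobZl (t : R) M N : frob (t *: M) N = t * frob M N.
Proof. by rewrite !frobE !mxE; ring. Qed.

Lemma frobBl M M' N : frob (M - M') N = frob M N - frob M' N.
Proof. by rewrite !frobE !mxE; ring. Qed.

Lemma SymD M N : Sym M -> Sym N -> Sym (M + N).
Proof. by rewrite /Sym /= linearD /= => -> ->. Qed.

Lemma SymZ (t : R) M : Sym M -> Sym (t *: M).
Proof. by rewrite /Sym /= linearZ /= => ->. Qed.

Lemma SymB M N : Sym M -> Sym N -> Sym (M - N).
Proof. by move=> hM /(SymZ (-1)) hN; rewrite -scaleN1r; exact: SymD. Qed.

Lemma Sym0 : Sym (0 : 'M[R]_2).
Proof. by rewrite /Sym /= trmx0. Qed.

Implicit Types (H K : R * R -> 'M[R]_2).
Variables (A : set (R * R)) (mA : @measurable _ (plane R) A).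

Local Notation sq := (@sqint _ (plane R) R mu2 A).
Local Notation ipA := (@ip _ (plane R) R mu2 A).
Local Notation nsqA := (@nsq _ (plane R) R mu2 A).

Definition msq H := forall i j, sq (fun x => H x i j).

Definition ipm H K : R := \int[mu2]_(x in A) frob (H x) (K x).

Lemma ipmE H K : msq H -> msq K -> ipm H K = \sum_i \sum_j
  ipA (fun x => H x i j) (fun x => K x i j).
Proof.
move=> hH hK.
have hi i j : (@mu2 R).-integrable (A : set (plane R)) (EFin \o (fun x => H x i j * K x i j)).
  exact: sqint_integrableM.
rewrite !big_ord_recl !big_ord0 !addr0 addrA.
rewrite (_ : lift ord0 ord0 = 1); last exact/val_inj.
rewrite /ipm; under eq_Rintegral do rewrite frobE.
rewrite (@RintegralD _ (plane R))//; last first.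
  by apply: eq_integrable (integrableD mA (integrableD mA (hi 0 0) (hi 0 1)) (hi 1 0)).
rewrite (@RintegralD _ (plane R))//; last first.
  by apply: eq_integrable (integrableD mA (hi 0 0) (hi 0 1)).
by rewrite (@RintegralD _ (plane R)).
Qed.

Lemma ipm_integrable H K : msq H -> msq K ->
  (@mu2 R).-integrable (A : set (plane R)) (EFin \o (fun x => frob (H x) (K x))).
Proof.
move=> hH hK.
have hi i j : (@mu2 R).-integrable (A : set (plane R)) (EFin \o (fun x => H x i j * K x i j)).
  exact: sqint_integrableM.
apply: eq_integrable (integrableD mA (integrableD mA (integrableD mA (hi 0 0) (hi 0 1)) (hi 1 0)) (hi 1 1)) => //.
by move=> x _ /=; rewrite frobE.
Qed.

Lemma msqZ (t : R) H : msq H -> msq (fun x => t *: H x).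
Proof. by move=> hH i j; under eq_fun do rewrite mxE; exact: sqintZ. Qed.

Lemma msqB H K : msq H -> msq K -> msq (fun x => H x - K x).
Proof.
move=> hH hK i j; under eq_fun do rewrite mxE [X in _ + X]mxE; exact: sqintB.
Qed.

Lemma ipmDl H H' K : msq H -> msq H' -> msq K ->
  ipm (fun x => H x + H' x) K = ipm H K + ipm H' K.
Proof.
move=> h1 h2 h3; rewrite /ipm -(@RintegralD _ (plane R))//; try exact: ipm_integrable.
by apply: eq_Rintegral => x _; rewrite frobDl.
Qed.

Lemma ipmC H K : ipm H K = ipm K H.
Proof. by apply: eq_Rintegral => x _; rewrite frobC. Qed.

Lemma ipmZl (t : R) H K : msq H -> msq K ->
  ipm (fun x => t *: H x) K = t * ipm H K.
Proof.
move=> h1 h3; rewrite /ipm -(@RintegralZl _ (plane R))//; try exact: ipm_integrable.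
by apply: eq_Rintegral => x _; rewrite frobZl.
Qed.

Lemma ipmBl H H' K : msq H -> msq H' -> msq K ->
  ipm (fun x => H x - H' x) K = ipm H K - ipm H' K.
Proof.
move=> h1 h2 h3; rewrite /ipm -(@RintegralB _ (plane R))//; try exact: ipm_integrable.
by apply: eq_Rintegral => x _; rewrite frobBl.
Qed.

Lemma ipmBr H H' K : msq H -> msq H' -> msq K ->
  ipm K (fun x => H x - H' x) = ipm K H - ipm K H'.
Proof.
move=> h1 h2 h3; rewrite (ipmC K H) (ipmC K H') -(ipmBl h1 h2 h3); exact: ipmC.
Qed.

Lemma ipm_ge0 H : 0 <= ipm H H.
Proof. by apply: Rintegral_ge0 => x _; exact: frob_ge0. Qed.

Lemma nsq_le_ipm H i j : msq H -> nsqA (fun x => H x i j) <= ipm H H.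
Proof.
move=> hH; apply: (@le_Rintegral _ (plane R)) => //; first exact: (hH i j).2.
  exact: ipm_integrable.
by move=> x _; exact: frob_ge_entry.
Qed.

Lemma ipm_eq0 H : msq H -> ipm H H = 0 -> {ae mu2, forall x, A x -> H x = 0}.
Proof.
move=> hH h0.
have e i j : {ae mu2, forall x, A x -> H x i j = 0}.
  apply: (nsq_eq0 mA (hH i j)); apply/eqP; rewrite eq_le nsq_ge0 andbT -h0.
  exact: nsq_le_ipm.
(* Null sets are united over natural numbers, so the matrix indices are reached through [inord]. *)
have : {ae mu2, forall x, forall n m : nat, A x -> H x (inord n) (inord m) = 0}.
  apply: (@ae_foralln _ (plane R)) => n; apply: (@ae_foralln _ (plane R)) => m.
  exact: e.
apply: ae_mp => x h Ax; apply/matrixP => i j; rewrite mxE.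
by have := h i j Ax; rewrite !inord_val.
Qed.

Lemma ipm_ae H H' K : msq H -> msq H' -> msq K ->
  {ae mu2, forall x, A x -> H x = H' x} -> ipm H K = ipm H' K.
Proof.
move=> h1 h2 h3 e; apply: (@ae_eq_Rintegral _ (plane R)) => //.
- by apply/measurable_EFinP; exact: measurable_int (ipm_integrable h1 h3).
- by apply/measurable_EFinP; exact: measurable_int (ipm_integrable h2 h3).
- by apply: ae_mp e => x h Ax; rewrite h.
Qed.

Lemma ipm_aer H H' K : msq H -> msq H' -> msq K ->
  {ae mu2, forall x, A x -> H x = H' x} -> ipm K H = ipm K H'.
Proof. by move=> h1 h2 h3 e; rewrite ipmC (ipm_ae h1 h2 h3 e) ipmC. Qed.

End MatrixFields.

(** * The action of the tensor field on square integrable symmetric matrix fields *)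

Section Tensor.
Variables (R : realType) (A : set (R * R)) (mA : @measurable _ (plane R) A).
Variables (C : R * R -> 'M[R]_2 -> 'M[R]_2) (hC : tensor_field A C).
Implicit Types (H K : R * R -> 'M[R]_2).

Lemma tensorD x M N : A x -> Sym M -> Sym N -> C x (M + N) = C x M + C x N.
Proof. by move=> Ax hM hN; have := tensor_linear hC Ax 1 hM hN; rewrite !scale1r. Qed.

Lemma tensor0 x : A x -> C x 0 = 0.
Proof.
move=> Ax; have := tensorD Ax (Sym0 R) (Sym0 R); rewrite addr0.
by move/(congr1 (fun M => M - C x 0)); rewrite subrr addrK.
Qed.

Lemma tensorZ x (t : R) M : A x -> Sym M -> C x (t *: M) = t *: C x M.
Proof.
move=> Ax hM; have := tensor_linear hC Ax t hM (Sym0 R).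
by rewrite addr0 tensor0// addr0.
Qed.

Lemma tensorB x M N : A x -> Sym M -> Sym N -> C x (M - N) = C x M - C x N.
Proof.
move=> Ax hM hN; rewrite -scaleN1r tensorD ?tensorZ ?scaleN1r//.
by rewrite -scaleN1r; exact: SymZ.
Qed.

Definition Cap H : R * R -> 'M[R]_2 := fun x => C x (H x).

Lemma tensor_L2Sym H : L2Sym A H -> L2Sym A (Cap H).
Proof.
move=> [sH hH]; split=> [x Ax|i j].
  by apply: (tensor_Sym hC) => //; exact: sH.
(* Measurability of [C x M] is given for constant [M]; expanding [H x] in a basis of the symmetric
   matrices reduces to that case. *)
pose E00 : 'M[R]_2 := delta_mx 0 0.
pose E11 : 'M[R]_2 := delta_mx 1 1.
pose E01 : 'M[R]_2 := delta_mx 0 1 + delta_mx 1 0.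
have s00 : Sym E00 by rewrite /Sym /= trmx_delta.
have s11 : Sym E11 by rewrite /Sym /= trmx_delta.
have s01 : Sym E01 by rewrite /Sym /= linearD /= !trmx_delta addrC.
have dec x : A x -> H x = H x 0 0 *: E00 + (H x 0 1 *: E01 + H x 1 1 *: E11).
  move=> Ax; have := sH x Ax; rewrite /Sym /= => /matrixP/(_ 0 1); rewrite mxE => h01.
  apply/matrixP => k l; rewrite !mxE.
  by case: (ord2P k) => ->; case: (ord2P l) => ->; rewrite /= ?h01; ring.
have CE x : A x -> C x (H x) = H x 0 0 *: C x E00 + (H x 0 1 *: C x E01 + H x 1 1 *: C x E11).
  move=> Ax; rewrite {1}dec// tensorD ?tensorZ//; [|exact: SymZ|by apply: SymD; exact: SymZ].
  by congr (_ + _); rewrite tensorD ?tensorZ//; exact: SymZ.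
have mCH k l : @measurable_fun _ _ (plane R) R A (fun x => C x (H x) k l).
  apply: (@eq_measurable_fun _ _ (plane R) _ _ (fun x => H x 0 0 * C x E00 k l +
    (H x 0 1 * C x E01 k l + H x 1 1 * C x E11 k l))).
    by move=> x /set_mem Ax; rewrite CE// !mxE.
  apply: measurable_funD; [|apply: measurable_funD]; apply: measurable_funM;
    by [exact: (hH _ _).1|exact: (tensor_measurable hC)].
have [K hK] := tensor_bounded hC.
(* A square integrable majorant of the entries of [C x (H x)]; the sign of the bound [K] is unknown,
   hence the absolute value. *)
have sqH : @sqint _ (plane R) R mu2 A (fun x => Num.sqrt (`|K| * frob (H x) (H x))).
  have iH := @ipm_integrable R A mA H H hH hH.
  have ik := integrableZl mA `|K| iH.
  have mi : @measurable_fun _ _ (plane R) R A (fun x => `|K| * frob (H x) (H x)).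
    by apply/measurable_EFinP; exact: measurable_int ik.
  split; first by apply: (measurableT_comp _ mi); exact: continuous_measurable_fun (@sqrt_continuous R).
  apply: eq_integrable ik => // x _.
  by rewrite /= sqr_sqrtr// mulr_ge0// frob_ge0.
apply: (@sqint_le_ae _ (plane R) _ _ _ mA _ _ (mCH i j) sqH).
apply: ae_mp hK => x h Ax; apply: le_trans (frob_ge_entry _ _ _) _.
rewrite sqr_sqrtr ?mulr_ge0 ?frob_ge0//.
apply: le_trans (h Ax _ (sH _ Ax)) _.
by rewrite ler_wpM2r ?frob_ge0// ler_norm.
Qed.

Lemma tensor_ipm_bound : exists2 K : R, 0 <= K & forall H, L2Sym A H ->
  ipm A (Cap H) (Cap H) <= K * ipm A H H.
Proof.
have [K hK] := tensor_bounded hC; exists `|K| => // H hH.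
have [sCH hCH] := tensor_L2Sym hH; have [sH H2] := hH.
rewrite /ipm -(@RintegralZl _ (plane R))//; last exact: ipm_integrable.
apply: (@le_Rintegral_ae _ (plane R)) => //.
- exact: ipm_integrable.
- by apply: eq_integrable (integrableZl mA `|K| (ipm_integrable mA H2 H2)).
- apply: ae_mp hK => x h Ax; apply: le_trans (h Ax _ (sH _ Ax)) _.
  by rewrite ler_wpM2r ?frob_ge0// ler_norm.
Qed.

Lemma tensor_ipm_sym H K : L2Sym A H -> L2Sym A K ->
  ipm A (Cap H) K = ipm A H (Cap K).
Proof.
move=> hH hK; have [sCH hCH] := tensor_L2Sym hH; have [sH H2] := hH.
have [sCK hCK] := tensor_L2Sym hK; have [sK K2] := hK.
apply: (@ae_eq_Rintegral _ (plane R)) => //.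
- by apply/measurable_EFinP; exact: measurable_int (ipm_integrable mA hCH K2).
- by apply/measurable_EFinP; exact: measurable_int (ipm_integrable mA H2 hCK).
- apply: ae_mp (tensor_symmetric hC) => x h Ax.
  by apply: h => //; [exact: sH|exact: sK].
Qed.

Lemma tensor_ipm_pos : exists2 c : R, 0 < c & forall H, L2Sym A H ->
  c * ipm A H H <= ipm A (Cap H) H.
Proof.
have [c c0 hc] := tensor_posdef hC; exists c => // H hH.
have [sCH hCH] := tensor_L2Sym hH; have [sH H2] := hH.
rewrite /ipm -(@RintegralZl _ (plane R))//; last exact: ipm_integrable.
apply: (@le_Rintegral_ae _ (plane R)) => //.
- by apply: eq_integrable (integrableZl mA c (ipm_integrable mA H2 H2)).
- exact: ipm_integrable.
- by apply: ae_mp hc => x h Ax; apply: h => //; exact: sH.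
Qed.

End Tensor.

(** * Limits of test functions in H^2 *)

(* Locked, since failing attempts to unify the Hessians of different functions
   would otherwise unfold the limits defining the derivatives. *)
HB.lock Definition D2 (R : realType) (phi : R * R -> R) : R * R -> 'M[R]_2 :=
  fun x => \matrix_(i, j) pd i (pd j phi) x.

Section Hessian.
Variable R : realType.
Implicit Types (A : set (R * R)) (phi psi u v f g : R * R -> R) (i j : 'I_2).
Implicit Types (H K N : R * R -> 'M[R]_2).

Lemma D2E phi x : D2 phi x = \matrix_(i, j) pd i (pd j phi) x.
Proof. by rewrite unlock. Qed.

Lemma D2_entry phi i j : (fun x => D2 phi x i j) = pd i (pd j phi).
Proof. by apply/funext => x; rewrite D2E mxE. Qed.

Lemma Sym_D2 phi x : smooth phi -> Sym (D2 phi x).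
Proof.
by move=> s; apply/matrixP => i j; rewrite D2E !mxE (pdC _ _ s).
Qed.

Lemma D2_L2Sym A phi B : @measurable _ (plane R) B -> test_fun A phi ->
  L2Sym B (D2 phi).
Proof.
move=> mB t; split=> [x _|i j]; first exact/Sym_D2/(test_fun_smooth t).
by rewrite D2_entry; exact: test_fun_L2 (test_fun_pd i (test_fun_pd j t)).
Qed.

Lemma D2D A (t : R) phi psi : test_fun A phi -> test_fun A psi ->
  D2 (fun x => phi x + t * psi x) = fun x => D2 phi x + t *: D2 psi x.
Proof.
move=> h1 h2; apply/funext => x; apply/matrixP => i j; rewrite !D2E !mxE.
have p1 := test_fun_pd j h1; have p2 := test_fun_pd j h2.
rewrite (test_pdD j h1 (test_funZ t h2)) (test_pdZ j t h2).
by rewrite (test_pdD i p1 (test_funZ t p2)) (test_pdZ i t p2).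
Qed.

Lemma is_divdivP A N g : is_divdiv A N g <-> L2 A g /\
  forall phi, test_fun A phi -> @ip _ (plane R) R mu2 A g phi = ipm A N (D2 phi).
Proof.
have E phi : ipm A N (D2 phi) =
    \int[mu2]_(x in A) frob (N x) (\matrix_(i, j) pd i (pd j phi) x).
  by apply: eq_Rintegral => x _; rewrite D2E.
by split=> -[g2 h]; split=> // phi /h; rewrite E.
Qed.

Section Domain.
Variables (P : set (R * R)) (oP : open P) (q : (R * R) * (R * R)).
Hypothesis Pq : P `<=` orect q.

Let mP : @measurable _ (plane R) P := open_measurable_plane oP.

Local Notation sq := (@sqint _ (plane R) R mu2 P).
Local Notation ipP := (@ip _ (plane R) R mu2 P).
Local Notation nsqP := (@nsq _ (plane R) R mu2 P).
Local Notation cvgP := (@cvg2 _ (plane R) R mu2 P).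
Local Notation testP := (test_fun P).

Let ipCP f g : ipP f g = ipP g f. Proof. exact: ipC. Qed.

Lemma poincare_const : exists2 k : R, 0 <= k & forall i phi, testP phi ->
  nsqP phi <= k * nsqP (pd i phi).
Proof.
pose L : R := `|q.1.1| + `|q.1.2| + (`|q.2.1| + `|q.2.2|).
exists (4 * L ^+ 2); first by rewrite mulr_ge0// sqr_ge0.
move=> i phi t; apply: poincare t => // x /Pq [/=]; rewrite !in_itv /=.
move=> /andP[h1 h2] /andP[h3 h4]; rewrite /L /crd; case: (i == 0);
  rewrite ler_norml; apply/andP; split;
  have := ler_norm q.1.2; have := ler_norm q.2.2;
  have := ler_norm (- q.1.1); have := ler_norm (- q.2.1); rewrite !normrN;
  have := normr_ge0 q.1.1; have := normr_ge0 q.1.2;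
  have := normr_ge0 q.2.1; have := normr_ge0 q.2.2; lra.
Qed.

Lemma poincare2 : exists2 k : R, 0 <= k & forall phi, testP phi ->
  nsqP phi <= k * ipm P (D2 phi) (D2 phi) /\
  (forall i, nsqP (pd i phi) <= k * ipm P (D2 phi) (D2 phi)).
Proof.
have [k k0 hk] := poincare_const.
(* [k * k] serves the function, by two applications of Poincare, and [k] its gradient. *)
exists (k * k + k); first by rewrite addr_ge0// mulr_ge0.
move=> phi t; have I0 := ipm_ge0 P (D2 phi).
have h1 i : nsqP (pd i phi) <= k * ipm P (D2 phi) (D2 phi).
  apply: le_trans (hk i _ (test_fun_pd i t)) _; rewrite ler_wpM2l// -D2_entry.
  exact: nsq_le_ipm (D2_L2Sym mP t).2.
split=> [|i].
  apply: le_trans (hk 0 _ t) _; have := h1 0; nra.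
by apply: le_trans (h1 i) _; nra.
Qed.

(** The closure of the test functions in H^2, with the sequence exposed. [G] and [H] are mere L_2
    limits here; that they are weak derivatives of [u] follows by passing to the limit in
    integrations by parts. *)
Definition H2lim (phi : nat -> R * R -> R) u (G : 'I_2 -> R * R -> R) H :=
  [/\ forall k, testP (phi k),
      L2 P u /\ cvgP phi u,
      forall i, L2 P (G i) /\ cvgP (fun k => pd i (phi k)) (G i)
    & L2Sym P H /\ forall i j, cvgP (fun k => pd i (pd j (phi k))) (fun x => H x i j)].

Lemma H2lim_wpd (phi : nat -> R * R -> R) u G H i : H2lim phi u G H -> is_wpd P i u (G i).
Proof.
move=> [t [u2 cu] /(_ i) [G2 cG] _]; split=> // psi tpsi.
have s1 k : sq (phi k) by exact: test_fun_L2 (t k).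
have s2 k : sq (pd i (phi k)) by exact: test_fun_L2 (test_fun_pd i (t k)).
have s3 : sq psi by exact: test_fun_L2 tpsi.
have s4 : sq (pd i psi) by exact: test_fun_L2 (test_fun_pd i tpsi).
have c1 : ipP (phi k) (pd i psi) @[k --> \oo] --> ipP u (pd i psi) by exact: cvg2_ip.
have c2 : - ipP (pd i (phi k)) psi @[k --> \oo] --> - ipP (G i) psi.
  by apply: cvgN; exact: cvg2_ip.
have E k : ipP (phi k) (pd i psi) = - ipP (pd i (phi k)) psi.
  rewrite (ipCP (pd i (phi k))); apply: integral_parts => //.
  exact: test_fun_smooth (t k).
by rewrite (funext E) in c1; exact: (cvg_unique (@Rhausdorff R) c1 c2).
Qed.

Lemma H2lim_hess (phi : nat -> R * R -> R) u G H : H2lim phi u G H -> is_hess P u H.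
Proof.
move=> [t [u2 cu] _ [H2 cH]]; split=> // psi tpsi i j.
have s1 k : sq (phi k) by exact: test_fun_L2 (t k).
have s2 k : sq (pd i (pd j (phi k))).
  exact: test_fun_L2 (test_fun_pd i (test_fun_pd j (t k))).
have s3 : sq psi by exact: test_fun_L2 tpsi.
have s4 : sq (pd i (pd j psi)) by exact: test_fun_L2 (test_fun_pd i (test_fun_pd j tpsi)).
have c1 : ipP (phi k) (pd i (pd j psi)) @[k --> \oo] --> ipP u (pd i (pd j psi)).
  exact: cvg2_ip.
have c2 : ipP (pd i (pd j (phi k))) psi @[k --> \oo] --> ipP (fun x => H x i j) psi.
  by apply: cvg2_ip => //; exact: H2.2.
(* Two integrations by parts yield the mixed derivative in the opposite order, which [pdC]
   repairs. *)
have E k : ipP (phi k) (pd i (pd j psi)) = ipP (pd i (pd j (phi k))) psi.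
  have sk := test_fun_smooth (t k).
  rewrite [LHS](@integral_parts _ _ _ (pd j psi))//; last exact: test_fun_pd.
  under eq_Rintegral do rewrite mulrC.
  rewrite (@integral_parts _ _ _ psi (pd i (phi k)))//; last exact: smooth_pd.
  by rewrite opprK (pdC _ _ sk); apply: eq_Rintegral => x _; rewrite mulrC.
by rewrite (funext E) in c1; exact: (cvg_unique (@Rhausdorff R) c1 c2).
Qed.

Lemma H2lim_ipm (phi : nat -> R * R -> R) u G H N : H2lim phi u G H -> msq P N ->
  ipm P N (D2 (phi k)) @[k --> \oo] --> ipm P N H.
Proof.
move=> [t _ _ [H2 cH]] hN.
have s2 k i j : sq (pd i (pd j (phi k))).
  exact: test_fun_L2 (test_fun_pd i (test_fun_pd j (t k))).
under eq_fun do rewrite (ipmE mP hN (D2_L2Sym mP (t _)).2).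
rewrite (ipmE mP hN H2.2).
apply: cvg_big => [|i _]; first exact: add_continuous.
apply: cvg_big => [|j _]; first exact: add_continuous.
rewrite ipC; under eq_fun do rewrite ipC D2_entry.
by apply: cvg2_ip => //; exact: H2.2.
Qed.

(** The definition of div div tested with [phi k], in the limit. This identity yields both the
    second hybrid equation for [u] and, with [N] the moment tensor, the energy identity behind
    [KL_bound]. *)
Lemma H2lim_divdiv (phi : nat -> R * R -> R) u G H N g : H2lim phi u G H -> L2Sym P N ->
  is_divdiv P N g -> ipP g u = ipm P N H.
Proof.
move=> hl hN /is_divdivP[g2 dN]; have c1 := H2lim_ipm hl hN.2.
have [t [u2 cu] _ _] := hl.
have c2 : ipP g (phi k) @[k --> \oo] --> ipP g u.
  rewrite ipCP; under eq_fun do rewrite ipCP.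
  by apply: cvg2_ip => // k; exact: test_fun_L2 (t k).
have E k : ipP g (phi k) = ipm P N (D2 (phi k)) by exact: dN.
by rewrite (funext E) in c2; exact: (cvg_unique (@Rhausdorff R) c2 c1).
Qed.

(** Poincare twice in the same direction, for [phi n] and for [pd 0 (phi n)], then the limit; a
    single entry of [H] is dominated by the full Frobenius norm. *)
Lemma H2lim_poincare : exists2 k : R, 0 <= k & forall (phi : nat -> R * R -> R) u G H,
  H2lim phi u G H -> nsqP u <= k * ipm P H H.
Proof.
have [k k0 hk] := poincare_const; exists (k * k); first by rewrite mulr_ge0.
move=> phi u G H [t [u2 cu] _ [H2 cH]].
have s1 n : sq (phi n) by exact: test_fun_L2 (t n).
have s2 n : sq (pd 0 (pd 0 (phi n))).
  exact: test_fun_L2 (test_fun_pd _ (test_fun_pd _ (t n))).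
have c1 : nsqP (phi n) @[n --> \oo] --> nsqP u by exact: cvg2_nsq.
have c2 : k * k * nsqP (pd 0 (pd 0 (phi n))) @[n --> \oo] -->
    k * k * nsqP (fun x => H x 0 0).
  by apply: cvgM; [exact: cvg_cst|apply: cvg2_nsq => //; exact: H2.2].
apply: (@le_trans _ _ (k * k * nsqP (fun x => H x 0 0))).
  apply: (ler_cvg_to c1 c2); apply: nearW => n.
  apply: le_trans (hk 0 _ (t n)) _; rewrite -mulrA ler_wpM2l//.
  exact: hk (test_fun_pd _ (t n)).
by rewrite ler_wpM2l ?mulr_ge0//; exact: nsq_le_ipm H2.2.
Qed.

Lemma H2limB (phi phi' : nat -> R * R -> R) u G H u' G' H' :
  H2lim phi u G H -> H2lim phi' u' G' H' ->
  H2lim (fun k x => phi k x - phi' k x) (fun x => u x - u' x)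
    (fun i x => G i x - G' i x) (fun x => H x - H' x).
Proof.
move=> [t [u2 cu] hG [[sH H2] cH]] [t' [u2' cu'] hG' [[sH' H2'] cH']].
have s1 k : sq (phi k) by exact: test_fun_L2 (t k).
have s1' k : sq (phi' k) by exact: test_fun_L2 (t' k).
split.
- by move=> k; exact: test_funB.
- by split; [exact: (sqintB mP u2 u2')|exact: (cvg2B mP s1 s1' u2 u2' cu cu')].
- move=> i; have [g2 cg] := hG i; have [g2' cg'] := hG' i; split; first exact: (sqintB mP g2 g2').
  have -> : (fun k => pd i (fun x => phi k x - phi' k x)) =
      fun k x => pd i (phi k) x - pd i (phi' k) x.
    by apply/funext => k; rewrite (test_pdB i (t k) (t' k)).
  have s2 k : sq (pd i (phi k)) by exact: test_fun_L2 (test_fun_pd i (t k)).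
  have s2' k : sq (pd i (phi' k)) by exact: test_fun_L2 (test_fun_pd i (t' k)).
  exact: (cvg2B mP s2 s2' g2 g2' cg cg').
- split.
    by split; [move=> x Px; apply: SymB; [exact: sH|exact: sH']|exact: msqB].
  move=> i j.
  have -> : (fun k => pd i (pd j (fun x => phi k x - phi' k x))) =
      fun k x => pd i (pd j (phi k)) x - pd i (pd j (phi' k)) x.
    apply/funext => k; rewrite (test_pdB j (t k) (t' k)).
    by rewrite (test_pdB i (test_fun_pd j (t k)) (test_fun_pd j (t' k))).
  have -> : (fun x => (H x - H' x) i j) = fun x => H x i j - H' x i j.
    by apply/funext => x; rewrite !mxE.
  have s2 k : sq (pd i (pd j (phi k))).
    exact: test_fun_L2 (test_fun_pd i (test_fun_pd j (t k))).
  have s2' k : sq (pd i (pd j (phi' k))).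
    exact: test_fun_L2 (test_fun_pd i (test_fun_pd j (t' k))).
  exact: (cvg2B mP s2 s2' (H2 i j) (H2' i j) (cH i j) (cH' i j)).
Qed.

End Domain.
End Hessian.

(** * The Kirchhoff-Love problem *)

Section KirchhoffLove.
Variable R : realType.
Implicit Types (u v f g : R * R -> R) (i j : 'I_2) (H K N : R * R -> 'M[R]_2).
Variables (P : set (R * R)) (oP : open P) (q : (R * R) * (R * R)).
Hypothesis Pq : P `<=` orect q.
Variables (C : R * R -> 'M[R]_2 -> 'M[R]_2) (hC : tensor_field P C).

Let mP : @measurable _ (plane R) P := open_measurable_plane oP.

Local Notation sq := (@sqint _ (plane R) R mu2 P).
Local Notation ipP := (@ip _ (plane R) R mu2 P).
Local Notation nsqP := (@nsq _ (plane R) R mu2 P).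
Local Notation cvgP := (@cvg2 _ (plane R) R mu2 P).
Local Notation testP := (test_fun P).

(* u is the weak solution, as a limit of test functions with gradient G and
   Hessian H. *)
Definition KL f u (G : 'I_2 -> R * R -> R) H :=
  (exists phi, H2lim P phi u G H) /\ is_divdiv P (Cap C H) f.

Lemma is_divdivB N N' g g' : msq P N -> msq P N' -> is_divdiv P N g ->
  is_divdiv P N' g' -> is_divdiv P (fun x => N x - N' x) (fun x => g x - g' x).
Proof.
move=> n n' /is_divdivP[g2 h] /is_divdivP[g2' h'].
apply/is_divdivP; split=> [|psi tpsi]; first exact: (sqintB mP g2 g2').
rewrite (ipBl mP g2 g2' (test_fun_L2 mP tpsi)) h// h'//.
exact/esym/(ipmBl mP n n' (D2_L2Sym mP tpsi).2).
Qed.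

Lemma KL_B f u G H f' u' G' H' : KL f u G H -> KL f' u' G' H' ->
  KL (fun x => f x - f' x) (fun x => u x - u' x)
    (fun i x => G i x - G' i x) (fun x => H x - H' x).
Proof.
move=> [[phi h] d] [[phi' h'] d']; split.
  by exists (fun k x => phi k x - phi' k x); exact: H2limB.
have [_ _ _ [HS _]] := h; have [_ _ _ [HS' _]] := h'.
have [f2 e] := is_divdivB (tensor_L2Sym mP hC HS).2 (tensor_L2Sym mP hC HS').2 d d'.
split=> // psi tpsi; rewrite e//.
apply: eq_Rintegral => x /set_mem Px; congr frob.
by rewrite /Cap (tensorB hC Px)//; [exact: HS.1|exact: HS'.1].
Qed.

(** With [I = ipm P H H], ellipticity, the energy identity, Cauchy-Schwarz and Poincare give [(c
    I)^2 <= nsqP f * nsqP u <= nsqP f * (k I)], hence [I <= (k / c^2) nsqP f]; the other two bounds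
    follow from this one. *)
Lemma KL_bound : exists2 k : R, 0 <= k & forall f u G H, KL f u G H ->
  [/\ nsqP u <= k * nsqP f, ipm P H H <= k * nsqP f &
      ipm P (Cap C H) (Cap C H) <= k * nsqP f].
Proof.
have [k k0 hk] := H2lim_poincare oP Pq.
have [c c0 hc] := tensor_ipm_pos mP hC.
have [b b0 hb] := tensor_ipm_bound mP hC.
pose m : R := k / c ^+ 2.
have m0 : 0 <= m by rewrite divr_ge0// sqr_ge0.
(* The summands belong to [H], [u] and [Cap C H], in this order. *)
exists (m + k * m + b * m); first by rewrite !addr_ge0// mulr_ge0.
move=> f u G H [[phi h] d].
have [_ [u2 _] _ [HS _]] := h; have [f2 _] := d.
have CHS := tensor_L2Sym mP hC HS.
have E : ipP f u = ipm P (Cap C H) H by exact: (H2lim_divdiv oP h CHS d).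
have h1 := hk _ _ _ _ h; have h2 := hc _ HS; have h3 := hb _ HS.
have I0 := ipm_ge0 P H; have F0 : 0 <= nsqP f by exact: nsq_ge0.
have CS := cauchy_schwarz_ip mP f2 u2; rewrite E in CS.
set I := ipm P H H in h1 h2 h3 I0 *.
have c20 : 0 < c ^+ 2 by rewrite exprn_gt0.
have hI : I <= m * nsqP f.
  move: I0; rewrite le_eqVlt => /predU1P[<-|I0]; first by rewrite mulr_ge0.
  have h4 : (c * I) ^+ 2 <= nsqP f * (k * I).
    apply: (@le_trans _ _ (ipm P (Cap C H) H ^+ 2)).
      by rewrite lerXn2r ?nnegrE ?(le_trans _ h2)// mulr_ge0// ltW.
    by apply: le_trans CS _; rewrite ler_wpM2l.
  rewrite /m mulrAC ler_pdivlMr// -(ler_pM2r I0).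
  have -> : I * c ^+ 2 * I = (c * I) ^+ 2 by ring.
  by have -> : k * nsqP f * I = nsqP f * (k * I) by ring.
have kI : k * I <= k * m * nsqP f by rewrite -mulrA ler_wpM2l.
have bI : b * I <= b * m * nsqP f by rewrite -mulrA ler_wpM2l.
have p1 : 0 <= m * nsqP f by rewrite mulr_ge0.
have p2 := mulr_ge0 (mulr_ge0 k0 m0) F0.
have p3 := mulr_ge0 (mulr_ge0 b0 m0) F0.
clear -h1 h3 hI kI bI p1 p2 p3.
move: (nsqP u) (ipm P (Cap C H) (Cap C H)) (nsqP f) h1 h3 hI kI bI p1 p2 p3.
rewrite -/I; clearbody I m => U J F; rewrite !mulrDl => *; split; lra.
Qed.

(** The almost Euler equation supplied by [ritz], tested with the difference of two members of the
    sequence, is what makes the energy of that difference small. *)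
Lemma KL_exists f : L2 P f -> exists u G H, KL f u G H.
Proof.
move=> f2.
have [c c0 hc] := tensor_ipm_pos mP hC.
have [k k0 hk] := poincare2 oP Pq.
pose a (p r : R * R -> R) := ipm P (Cap C (D2 p)) (D2 r).
have DS p : testP p -> L2Sym P (D2 p) by exact: D2_L2Sym.
have CDS p : testP p -> L2Sym P (Cap C (D2 p)).
  by move=> /DS; exact: tensor_L2Sym.
have CD (t : R) p r : testP p -> testP r -> forall N, msq P N ->
    ipm P (Cap C (D2 (fun x => p x + t * r x))) N =
    ipm P (Cap C (D2 p)) N + t * ipm P (Cap C (D2 r)) N.
  move=> tp tr N hN; rewrite -(ipmZl mP t (CDS _ tr).2 hN).
  rewrite -(ipmDl mP (CDS _ tp).2 (msqZ mP t (CDS _ tr).2) hN).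
  apply: eq_Rintegral => x /set_mem Px; congr frob.
  have sp : Sym (D2 p x) by exact: (DS _ tp).1.
  have sr : Sym (D2 r x) by exact: (DS _ tr).1.
  by rewrite /Cap (D2D t tp tr) (tensorD hC Px sp (SymZ t sr)) (tensorZ hC t Px sr).
have CDr (t : R) p r : testP p -> testP r -> forall N, msq P N ->
    ipm P N (D2 (fun x => p x + t * r x)) = ipm P N (D2 p) + t * ipm P N (D2 r).
  move=> tp tr N hN.
  rewrite (D2D t tp tr).
  rewrite (ipmC P N).
  rewrite (ipmC P N (D2 p)).
  rewrite (ipmC P N (D2 r)).
  by rewrite (ipmDl mP (DS _ tp).2 (msqZ mP t (DS _ tr).2) hN) (ipmZl mP t (DS _ tr).2 hN).
have asym p r : testP p -> testP r -> a p r = a r p.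
  move=> tp tr.
  rewrite /a.
  have := tensor_ipm_sym mP hC (DS _ tp) (DS _ tr).
  move=> ->.
  rewrite ipmC.
  reflexivity.
have ca p : testP p -> c * ipm P (D2 p) (D2 p) <= a p p by move=> tp; exact/hc/DS.
have a0 p : testP p -> 0 <= a p p.
  by move=> tp; apply: le_trans (ca p tp); rewrite mulr_ge0 ?ipm_ge0// ltW.
have st p : testP p -> sq p by move=> tp; exact: test_fun_L2 tp.
(* The constant comes from Cauchy-Schwarz, Poincare with [k] and ellipticity with [c]. *)
have [p hp] : exists p : nat -> R * R -> R, forall n, testP (p n) /\
    (forall r, testP r -> (a (p n) r - ipP f r) ^+ 2 <= 2 * a r r / n.+1%:R).
  apply: (@ritz R (R * R)%type testP a (ipP f) (nsqP f * (k / c))).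
  - exact: test_fun0.
  - by move=> t p r tp tr; apply: test_funD => //; exact: test_funZ.
  - move=> t p r tp tr; rewrite /a CD//; last first.
      by apply: (DS _ _).2; apply: test_funD => //; exact: test_funZ.
    rewrite !CDr ?(CDS _ _).2//; try exact: (CDS _ _).2.
    by rewrite -![ipm _ _ _]/(a _ _) (asym r p)//; ring.
  - move=> t p r tp tr; rewrite (ipDr mP (st _ tp) (sqintZ mP t (st _ tr)) f2).
    by rewrite (ipZr mP t (st _ tr) f2).
  - exact: a0.
  - move=> p tp; apply: le_trans (cauchy_schwarz_ip mP f2 (st _ tp)) _.
    rewrite -mulrA ler_wpM2l ?nsq_ge0//; apply: le_trans (hk _ tp).1 _.
    by rewrite -mulrA ler_wpM2l// mulrC ler_pdivlMr// mulrC ca.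
have tp n : testP (p n) := (hp n).1.
have euler n r : testP r -> (a (p n) r - ipP f r) ^+ 2 <= 2 * a r r / n.+1%:R.
  exact: (hp n).2.
pose dp m n x := p m x - p n x.
have tdp m n : testP (dp m n) by exact: test_funB.
have adp m n : a (dp m n) (dp m n) <= 4 / m.+1%:R + 4 / n.+1%:R.
  have h1 := euler m _ (tdp m n); have h2 := euler n _ (tdp m n).
  set A := a (dp m n) (dp m n) in h1 h2 *.
  (* [A] is the difference of two Euler residuals [x] and [y], so [A^2 <= 2 x^2 + 2 y^2], which is
     at most [A] times the claimed bound; one factor [A] cancels. *)
  have AE : A = (a (p m) (dp m n) - ipP f (dp m n)) - (a (p n) (dp m n) - ipP f (dp m n)).
    have dpE : dp m n = fun x => p m x + (-1) * p n x.
      by apply/funext => x; rewrite mulN1r.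
    rewrite /A /a {1}dpE (CD (-1) _ _ (tp m) (tp n) _ (DS _ (tdp m n)).2); ring.
  have A0 : 0 <= A by exact: a0.
  move: A0; rewrite le_eqVlt => /predU1P[<-|A0].
    by rewrite addr_ge0// divr_ge0.
  rewrite -(ler_pM2l A0) -expr2 {1}AE.
  set x := a (p m) _ - _ in h1 *; set y := a (p n) _ - _ in h2 *.
  have := sqr_ge0 (x + y).
  have -> : A * (4 / m.+1%:R + 4 / n.+1%:R) =
    2 * (2 * A / m.+1%:R) + 2 * (2 * A / n.+1%:R) by ring.
  move: (2 * A / m.+1%:R) (2 * A / n.+1%:R) h1 h2 => U V.
  by clearbody x y => h1 h2 h3; lra.
have small (e : R) : 0 < e -> exists n0 : nat, forall m n, (n0 <= m)%N -> (n0 <= n)%N ->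
    ipm P (D2 (dp m n)) (D2 (dp m n)) <= e.
  move=> e0; have ce : 0 < c * e by rewrite mulr_gt0.
  pose n0 := (Num.truncn (8 / (c * e))).+1.
  have hn0 : 8 / (c * e) < n0%:R by rewrite truncnS_gt.
  have n00 : 0 < n0%:R :> R by rewrite ltr0n.
  have inv n : (n0 <= n)%N -> 4 / n.+1%:R <= c * e / 2.
    move=> len; apply: (@le_trans _ _ (4 / n0%:R)).
      by rewrite ler_wpM2l// lef_pV2 ?posrE// ler_nat (leq_trans len).
    rewrite ler_pdivrMr//; move: hn0; rewrite ltr_pdivrMr// => ?; lra.
  exists n0 => m n /inv h1 /inv h2.
  rewrite -(ler_pM2l c0); apply: le_trans (ca _ (tdp m n)) _.
  by apply: le_trans (adp m n) _; rewrite [leRHS]splitr lerD.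
(* Used for values, gradients and second derivatives alike: an [F] that respects differences and is
   controlled by the Hessian turns small energies into an L_2 limit. *)
have lim_of (F : (R * R -> R) -> R * R -> R) (b : R) : 0 <= b ->
    (forall r, testP r -> testP (F r)) ->
    (forall m n, F (dp m n) = fun x => F (p m) x - F (p n) x) ->
    (forall r, testP r -> nsqP (F r) <= b * ipm P (D2 r) (D2 r)) ->
    exists2 g, sq g & cvgP (fun n => F (p n)) g.
  move=> b0 tF FB hF; apply: (cvg2_cauchy mP) => [n|e e0].
    exact/st/tF.
  have [n0 hn0] := small (e / (b + 1)) (divr_gt0 e0 (ltr_wpDl b0 ltr01)).
  exists n0 => m n lem len; rewrite -FB; apply: le_trans (hF _ (tdp m n)) _.
  apply: (@le_trans _ _ (b * (e / (b + 1)))); first by rewrite ler_wpM2l// hn0.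
  by rewrite mulrA ler_pdivrMr ?ltr_wpDl// mulrC ler_wpM2l ?lerDl// ltW.
have [u u2 cu] : exists2 g, sq g & cvgP p g.
  apply: (lim_of id k) => // r tr; exact: (hk _ tr).1.
have exG i : exists g, sq g /\ cvgP (fun n => pd i (p n)) g.
  have [|||g g2 cg] := lim_of (pd i) k k0.
  - by move=> r; exact: test_fun_pd.
  - by move=> m n; exact: (test_pdB i (tp m) (tp n)).
  - by move=> r tr; exact: (hk _ tr).2.
  - by exists g.
have exH (ij : 'I_2 * 'I_2) : exists g,
    sq g /\ cvgP (fun n => pd ij.1 (pd ij.2 (p n))) g.
  case: ij => i j /=.
  have [|||g g2 cg] := lim_of (fun r => pd i (pd j r)) 1 ler01.
  - by move=> r tr; do 2 apply: test_fun_pd.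
  - move=> m n; rewrite (test_pdB j (tp m) (tp n)).
    exact: (test_pdB i (test_fun_pd j (tp m)) (test_fun_pd j (tp n))).
  - move=> r tr; rewrite mul1r -D2_entry; exact: nsq_le_ipm (DS _ tr).2.
  - by exists g.
have [G hG] := choice exG; have [H' hH'] := choice exH.
(* The limits for [(i, j)] and [(j, i)] were chosen independently and may differ on a null set, but
   [L2Sym] demands symmetry at every point; the entries below the diagonal are copied from above
   it. *)
pose H x : 'M[R]_2 := \matrix_(i, j) (if (i <= j)%N then H' (i, j) x else H' (j, i) x).
have HE i j : (fun x => H x i j) = if (i <= j)%N then H' (i, j) else H' (j, i).
  by apply/funext => x; rewrite mxE; case: ifP.
have HS : L2Sym P H.
  split=> [x _|i j]; last by rewrite HE; case: ifP => _; exact: (hH' (_, _)).1.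
  apply/matrixP => i j; rewrite !mxE.
  by case: (ltngtP i j) => // /val_inj ->.
have Hl : H2lim P p u G H.
  split=> //; split=> // i j; rewrite HE; case: ifP => _; first exact: (hH' (i, j)).2.
  have -> : (fun n => pd i (pd j (p n))) = fun n => pd j (pd i (p n)).
    by apply/funext => n; exact/pdC/test_fun_smooth.
  exact: (hH' (j, i)).2.
exists u, G, H; split; first by exists p.
apply/is_divdivP; split=> // r tr.
(* Up to the symmetry of [C], [a (p n) r] has two limits: the pairing of [Cap C H] with [D2 r],
   since the Hessians converge, and [ipP f r], since the Euler residuals vanish. *)
have c1 := H2lim_ipm oP Hl (CDS _ tr).2.
have E1 n : ipm P (Cap C (D2 r)) (D2 (p n)) = a (p n) r.
  by rewrite /a (tensor_ipm_sym mP hC (DS _ (tp n)) (DS _ tr)) ipmC.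
have c2 : a (p n) r @[n --> \oo] --> ipP f r.
  apply/cvgrPdist_le => e e0; near=> n.
  rewrite distrC -ler_sqr ?nnegrE ?(ltW e0)// real_normK ?num_real//.
  apply: le_trans (euler n r tr) _.
  rewrite ler_pdivrMr// -ler_pdivrMl ?exprn_gt0//.
  apply: (@le_trans _ _ n%:R); last by rewrite ler_nat.
  near: n; exact: nbhs_infty_ger.
rewrite (funext E1) in c1.
rewrite -(cvg_unique (@Rhausdorff R) c1 c2) ipmC.
exact/esym/(tensor_ipm_sym mP hC HS (DS _ tr)).
Unshelve. all: by end_near. Qed.

End KirchhoffLove.

(** * Uniqueness of weak derivatives *)

Section WeakUniqueness.
Variable R : realType.
Implicit Types (A B : set (R * R)) (phi u v f g w : R * R -> R) (i j : 'I_2).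
Implicit Types (H K N : R * R -> 'M[R]_2).
Local Notation measurable2 := (@measurable _ (plane R)).
Local Notation ipA A := (@ip _ (plane R) R mu2 A).

Lemma ip_ae A u v w : measurable2 A -> L2 A u -> L2 A v -> L2 A w ->
  {ae mu2, forall x, A x -> u x = v x} -> ipA A u w = ipA A v w.
Proof.
move=> mA [mu _] [mv _] [mw _] uv; apply: (@ae_eq_Rintegral _ (plane R)) => //.
- exact: measurable_funM mu mw.
- exact: measurable_funM mv mw.
- by apply: ae_mp uv => x h Ax; rewrite h.
Qed.

Lemma fundamental_lemma_eq A u v : open A -> L2 A u -> L2 A v ->
  (forall phi, test_fun A phi -> ipA A u phi = ipA A v phi) ->
  {ae mu2, forall x, A x -> u x = v x}.
Proof.
move=> oA u2 v2 h; have mA := open_measurable_plane oA.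
have := fundamental_lemma oA (sqintB mA u2 v2).
move=> F; apply: ae_mp (F _) => [x e Ax|phi tphi].
  by apply/eqP; rewrite -subr_eq0; apply/eqP; exact: e.
have := ipBl mA u2 v2 (test_fun_L2 mA tphi).
by rewrite (h _ tphi) subrr.
Qed.

Lemma is_wpd_unique A i v w w' : open A -> is_wpd A i v w -> is_wpd A i v w' ->
  {ae mu2, forall x, A x -> w x = w' x}.
Proof.
move=> oA [w2 h] [w2' h']; apply: fundamental_lemma_eq => // phi tphi.
by apply: oppr_inj; rewrite -[LHS]h// h'.
Qed.

Lemma ae_matrix_eq A H K :
  (forall i j, {ae mu2, forall x, A x -> H x i j = K x i j}) ->
  {ae mu2, forall x, A x -> H x = K x}.
Proof.
move=> e; apply: ae_mp2 (ae_mp2 _ (e 0 0) (e 0 1)) (ae_mp2 _ (e 1 0) (e 1 1)).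
2,3: by move=> x; exact: conj.
move=> x [h1 h2] [h3 h4] Ax; apply/matrixP => i j.
by case: (ord2P i) => ->; case: (ord2P j) => ->; [exact: h1|exact: h2|exact: h3|exact: h4].
Qed.

Lemma is_hess_unique A v v' H H' : open A -> L2 A v -> L2 A v' ->
  {ae mu2, forall x, A x -> v x = v' x} -> is_hess A v H -> is_hess A v' H' ->
  {ae mu2, forall x, A x -> H x = H' x}.
Proof.
move=> oA v2 v2' vv' [[_ H2] h] [[_ H2'] h']; have mA := open_measurable_plane oA.
apply: ae_matrix_eq => i j; apply: fundamental_lemma_eq => // phi tphi.
rewrite -[LHS]h// -[RHS]h'//; apply: ip_ae => //.
exact: test_fun_L2 (test_fun_pd i (test_fun_pd j tphi)).
Qed.

Lemma is_divdiv_unique A N g g' : open A -> is_divdiv A N g -> is_divdiv A N g' ->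
  {ae mu2, forall x, A x -> g x = g' x}.
Proof.
move=> oA [g2 h] [g2' h']; apply: fundamental_lemma_eq => // phi tphi.
by rewrite [LHS]h// [RHS]h'.
Qed.

Lemma hessP A v : (exists H, is_hess A v H) -> is_hess A v (hess A v).
Proof. by move=> h; exact: xgetPex h. Qed.

Lemma wpdP A i v : (exists w, is_wpd A i v w) -> is_wpd A i v (wpd A i v).
Proof. by move=> h; exact: xgetPex h. Qed.

Lemma divdivP A N : (exists g, is_divdiv A N g) -> is_divdiv A N (divdiv A N).
Proof. by move=> h; exact: xgetPex h. Qed.

Lemma hess_ae A v H : open A -> L2 A v -> is_hess A v H ->
  {ae mu2, forall x, A x -> hess A v x = H x}.
Proof.
move=> oA v2 h; apply: (is_hess_unique oA v2 v2 _ (hessP _) h); last by exists H.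
exact: (@aeW _ (plane R)).
Qed.

Lemma wpd_ae A i v w : open A -> is_wpd A i v w ->
  {ae mu2, forall x, A x -> wpd A i v x = w x}.
Proof. by move=> oA h; apply: (is_wpd_unique oA (wpdP _) h); exists w. Qed.

Lemma divdiv_ae A N g : open A -> is_divdiv A N g ->
  {ae mu2, forall x, A x -> divdiv A N x = g x}.
Proof. by move=> oA h; apply: (is_divdiv_unique oA (divdivP _) h); exists g. Qed.

Lemma L2_sub A B v : open A -> open B -> B `<=` A -> L2 A v -> L2 B v.
Proof. by move=> /open_measurable_plane mA /open_measurable_plane mB; exact: sqint_subset. Qed.

(** A test function on [B] is also one on [A], and the integrands vanish off [B]. *)
Lemma is_hess_sub A B v H : open A -> open B -> B `<=` A -> is_hess A v H ->
  is_hess B v H.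
Proof.
move=> oA oB BA [[sH H2] h]; split.
  by split=> [x /BA|i j]; [exact: sH|exact: L2_sub (H2 i j)].
move=> phi tphi i j; have tA := test_fun_sub BA tphi.
rewrite -(@Rintegral_support _ _ _ _ BA); last first.
  by move=> x _ nB; rewrite (test_fun_out (test_fun_pd i (test_fun_pd j tphi)) nB) mulr0.
rewrite -(@Rintegral_support _ _ _ (fun x => H x i j * phi x) BA); last first.
  by move=> x _ nB; rewrite (test_fun_out tphi nB) mulr0.
exact: h.
Qed.

Lemma is_wpd_sub A B i v w : open A -> open B -> B `<=` A -> is_wpd A i v w ->
  is_wpd B i v w.
Proof.
move=> oA oB BA [w2 h]; split; first exact: L2_sub w2.
move=> phi tphi; have tA := test_fun_sub BA tphi.
rewrite -(@Rintegral_support _ _ _ _ BA); last first.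
  by move=> x _ nB; rewrite (test_fun_out (test_fun_pd i tphi) nB) mulr0.
rewrite -(@Rintegral_support _ _ _ (fun x => w x * phi x) BA); last first.
  by move=> x _ nB; rewrite (test_fun_out tphi nB) mulr0.
exact: h.
Qed.

Lemma H2_sub A B v : open A -> open B -> B `<=` A -> H2 A v -> H2 B v.
Proof.
move=> oA oB BA [[v2 hw] [H hH]]; split; last first.
  by exists H; exact: is_hess_sub hH.
split; first exact: L2_sub v2.
by move=> i; have [w h] := hw i; exists w; exact: is_wpd_sub h.
Qed.

Lemma L2norm_sq A v : L2norm A v ^+ 2 = @nsq _ (plane R) R mu2 A v.
Proof. by rewrite sqr_sqrtr//; exact: nsq_ge0. Qed.

Lemma L2Symnorm_sq A H : L2Symnorm A H ^+ 2 = ipm A H H.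
Proof. by rewrite sqr_sqrtr//; exact: ipm_ge0. Qed.

Lemma nsq_ae A u v : measurable2 A -> L2 A u -> L2 A v ->
  {ae mu2, forall x, A x -> u x = v x} ->
  @nsq _ (plane R) R mu2 A u = @nsq _ (plane R) R mu2 A v.
Proof.
move=> mA u2 v2 uv; have := ip_ae mA u2 v2 u2 uv; rewrite ipff => ->.
by rewrite ipC (ip_ae mA u2 v2 v2 uv) ipff.
Qed.

Lemma norm2_sq A v H : open A -> L2 A v -> is_hess A v H ->
  norm2 A v ^+ 2 = @nsq _ (plane R) R mu2 A v + ipm A H H.
Proof.
move=> oA v2 h; have mA := open_measurable_plane oA.
rewrite /norm2 sqr_sqrtr ?addr_ge0 ?sqr_ge0// L2norm_sq L2Symnorm_sq; congr (_ + _).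
have [hS _] := hessP (ex_intro _ H h); have [HS _] := h.
rewrite (ipm_ae mA hS.2 HS.2 hS.2 (hess_ae oA v2 h)) ipmC.
by rewrite (ipm_ae mA hS.2 HS.2 HS.2 (hess_ae oA v2 h)).
Qed.

End WeakUniqueness.

(** * Polygons and meshes *)

Section PolygonGeometry.
Variables (R : realType) (P : lipschitzPolygon R).

Lemma edge_pt_continuous (e : (R * R) * (R * R)) : continuous (edge_pt e).
Proof.
move=> t; have : (1 - s) *: e.1 + s *: e.2 @[s --> t] --> edge_pt e t; last exact.
apply: cvgD; apply: cvgZ; try exact: cvg_cst; last exact: cvg_id.
by apply: cvgB; [exact: cvg_cst|exact: cvg_id].
Qed.

(* Near a point of an edge there are points of the relative interior of that
   edge, and next to these, on the exterior side, points outside the closure. *)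
Lemma interior_closure_polygon : interior (closure P) `<=` P.
Proof.
move=> x Ux; apply: contrapT => nPx.
have : boundary P x.
  split; first exact: interior_subset Ux.
  by move=> /interior_subset.
rewrite edges_boundary => -[e /= eP [t]]; rewrite /= in_itv /= => /andP[t0 t1] xE.
have oU : open (interior (closure P)) by exact: open_interior.
(* The parameter moves from [t] towards the midpoint [1/2], so it lies in []0, 1[] for small [s > 0]
   even if [x] is a vertex. *)
have h1 : \forall s \near (0 : R)^'+, interior (closure P)
    (edge_pt e ((1 - s) * t + s / 2)).
  have c : edge_pt e ((1 - s) * t + s / 2) @[s --> (0 : R)^'+] --> x.
    have -> : x = edge_pt e ((1 - 0) * t + 0 / 2).
      by rewrite subr0 mul1r mul0r addr0.
    apply: cvg_at_right_filter; apply: (@continuous_comp _ _ _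
      (fun s : R => (1 - s) * t + s / 2) (edge_pt e)); last exact: edge_pt_continuous.
    apply: cvgD.
      by apply: cvgM; [apply: cvgB; [exact: cvg_cst|exact: cvg_id]|exact: cvg_cst].
    by apply: cvgM; [exact: cvg_id|exact: cvg_cst].
  exact: (c _ (open_nbhs_nbhs (conj oU Ux))).
have [s [s0 s1 Us]] : exists s : R, [/\ 0 < s, s < 1 &
    interior (closure P) (edge_pt e ((1 - s) * t + s / 2))].
  near (0 : R)^'+ => s; exists s; split; near: s => //.
  - exact: nbhs_right_gt.
  - exact: nbhs_right_lt.
set t' := (1 - s) * t + s / 2 in Us.
have t'01 : t' \in `]0, 1[.
  rewrite in_itv /= /t'.
  have a1 : 0 <= (1 - s) * t by rewrite mulr_ge0 ?subr_ge0// ltW.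
  have a2 : 0 <= (1 - s) * (1 - t) by rewrite mulr_ge0 ?subr_ge0// ltW.
  by apply/andP; split; lra.
have [r0 r00 hr] := edges_exterior eP t'01.
have h2 : \forall r \near (0 : R)^'+, interior (closure P)
    (edge_pt e t' + r *: edge_normal e).
  have c : edge_pt e t' + r *: edge_normal e @[r --> (0 : R)^'+] --> edge_pt e t'.
    rewrite -[X in _ --> X]addr0 -(scale0r (edge_normal e)).
    apply: cvg_at_right_filter; apply: cvgD; first exact: cvg_cst.
    exact: scalel_continuous.
  exact: (c _ (open_nbhs_nbhs (conj oU Us))).
have [r [rr0 rr1 Ur]] : exists r : R, [/\ 0 < r, r < r0 &
    interior (closure P) (edge_pt e t' + r *: edge_normal e)].
  near (0 : R)^'+ => r; exists r; split; near: r => //.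
  - exact: nbhs_right_gt.
  - exact: nbhs_right_lt.
have [] := hr r; first by rewrite rr0.
by move=> _; apply; exact: interior_subset Ur.
Unshelve. all: by end_near. Qed.

Lemma tint_sub (Th : seq (triangle R)) T : regular_mesh P Th -> T \in Th ->
  tint T `<=` P.
Proof.
move=> [_ _ cov _] TTh; apply: subset_trans interior_closure_polygon.
apply: interiorS; rewrite cov => x Tx; exists T => //.
Qed.

Lemma open_tint (T : triangle R) : open (tint T).
Proof. exact: open_interior. Qed.

End PolygonGeometry.

(** * Barycentric coordinates and the negligible boundary of a triangle *)

Section Triangles.
Variable R : realType.
Local Notation measurable2 := (@measurable _ (plane R)).

Definition affine (a b c : R) (x : R * R) : R := a * x.1 + b * x.2 + c.

Lemma affine_continuous a b c : continuous (affine a b c).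
Proof.
move=> x; apply: cvgD; last exact: cvg_cst.
by apply: cvgD; apply: cvgM; try exact: cvg_cst; [exact: cvg_fst|exact: cvg_snd].
Qed.

(** The zero set is a vertical line if [b = 0], and otherwise a graph over the first axis, whose
    sections are single points. *)
Lemma affine_zero_null a b c (p q : R * R) : affine a b c p != affine a b c q ->
  (@mu2 R [set x | affine a b c x = 0%R] = 0)%E.
Proof.
move=> pq; set L := [set x | _].
have mL : measurable2 L.
  have := continuous_measurable_plane measurableT (@affine_continuous a b c).
  move=> /(_ measurableT [set 0]) /(_ (measurable_set1 _)).
  by rewrite setTI.
have [b0|b0] := eqVneq b 0.
  have a0 : a != 0.
    by apply: contra pq => /eqP a0; rewrite /affine a0 b0 !mul0r.
  have -> : L = [set (- c / a)] `*` setT.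
    apply/seteqP; split=> [[x y]|[x y]] /=; rewrite /L /affine /= b0 mul0r addr0.
      by move=> /eqP; rewrite addr_eq0 => /eqP h; split=> //; rewrite -h mulrAC mulfV// mul1r.
    by move=> [-> _]; rewrite mulrCA mulfV// mulr1 addNr.
  rewrite (_ : mu2 _ = @lebesgue_measure R [set (- c / a)%R] * @lebesgue_measure R setT)%E.
    by rewrite lebesgue_measure_set1 mul0e.
  by apply: product_measure1E; [exact: measurable_set1|exact: measurableT].
rewrite (_ : mu2 L = \int[@lebesgue_measure R]_x (@lebesgue_measure R (xsection L x)))%E//.
rewrite (eq_integral (fun=> 0%E)) ?integral0// => x _.
rewrite (_ : xsection L x = [set (- (a * x + c) / b)]) ?lebesgue_measure_set1//.
apply/seteqP; split=> y; rewrite /xsection /= inE /L /affine /=.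
  move=> h; have -> : - (a * x + c) = b * y.
    by apply/eqP; rewrite eq_sym -addr_eq0 -h; apply/eqP; ring.
  by rewrite mulrAC mulfV// mul1r.
by move=> ->; field.
Qed.

Lemma sum_ord3 (V : zmodType) (F : 'I_3 -> V) : \sum_k F k = F 0 + F 1 + F 2.
Proof.
rewrite !big_ord_recl big_ord0 addr0 addrA.
by congr (_ + F _ + F _); exact/val_inj.
Qed.

Variable T : triangle R.
Hypothesis T0 : tdet T != 0.

Let p := T 0. Let q := T 1. Let r := T 2.

(** The three functions that follow are the barycentric coordinates of a point, obtained by Cramer's
    rule with determinant [tdet T]. *)
Definition bary1 := affine ((r.2 - p.2) / tdet T) (- (r.1 - p.1) / tdet T)
  ((- p.1 * (r.2 - p.2) + p.2 * (r.1 - p.1)) / tdet T).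

Definition bary2 := affine (- (q.2 - p.2) / tdet T) ((q.1 - p.1) / tdet T)
  ((p.1 * (q.2 - p.2) - p.2 * (q.1 - p.1)) / tdet T).

Definition bary0 := affine ((q.2 - r.2) / tdet T) ((r.1 - q.1) / tdet T)
  ((q.1 * r.2 - q.2 * r.1) / tdet T).

Definition bary (k : 'I_3) := if k == 0 then bary0 else if k == 1 then bary1 else bary2.

Lemma tdetE : tdet T = (q.1 - p.1) * (r.2 - p.2) - (q.2 - p.2) * (r.1 - p.1).
Proof. by rewrite /tdet /dotp /rotcw /= -/p -/q -/r; ring. Qed.

Lemma bary_weights (l : 'I_3 -> R) k : \sum_k l k = 1 ->
  bary k (\sum_k l k *: T k) = l k.
Proof.
rewrite !sum_ord3 -/p -/q -/r => h.
have l0 : l 0 = 1 - l 1 - l 2 by rewrite -h; ring.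
have E : l 0 *: p + l 1 *: q + l 2 *: r =
  (l 0 * p.1 + l 1 * q.1 + l 2 * r.1, l 0 * p.2 + l 1 * q.2 + l 2 * r.2) by [].
have D0 := T0; rewrite tdetE in D0.
rewrite E /bary; case: k => -[|[|[|//]]] hk /=;
  rewrite /bary0 /bary1 /bary2 /affine /= tdetE l0.
- rewrite (_ : Ordinal hk = 0); last exact/val_inj.
  by rewrite l0; field.
- rewrite (_ : Ordinal hk = 1); last exact/val_inj.
  by field.
- rewrite (_ : Ordinal hk = 2); last exact/val_inj.
  by field.
Qed.

Lemma bary_sum x : \sum_k bary k x = 1.
Proof.
have D0 := T0; rewrite tdetE in D0.
by rewrite sum_ord3 /bary /= /bary0 /bary1 /bary2 /affine /= tdetE; field.
Qed.

Lemma bary_comb x : x = \sum_k bary k x *: T k.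
Proof.
have D0 := T0; rewrite tdetE in D0.
rewrite sum_ord3 -/p -/q -/r; case: x => x y.
have E (l0 l1 l2 : R) : l0 *: p + l1 *: q + l2 *: r =
  (l0 * p.1 + l1 * q.1 + l2 * r.1, l0 * p.2 + l1 * q.2 + l2 * r.2) by [].
rewrite E /bary /= /bary0 /bary1 /bary2 /affine /= tdetE.
by congr pair; field.
Qed.

(** [bary k] is 1 at the vertex [T k] and 0 at the next one, with indices modulo 3, so it is not
    constant. *)
Lemma bary_zero_null k : (@mu2 R [set x | bary k x = 0%R] = 0)%E.
Proof.
have b1 (m : 'I_3) : bary k (T m) = (m == k)%:R.
  have := @bary_weights (fun j => (m == j)%:R) k.
  rewrite (bigD1 m) //= eqxx big1 ?addr0; last by move=> j /negbTE; rewrite eq_sym => ->.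
  move=> /(_ erefl) <-; congr bary.
  rewrite (bigD1 m) //= eqxx scale1r big1 ?addr0// => j /negbTE.
  by rewrite eq_sym => ->; rewrite scale0r.
have ne : bary k (T k) != bary k (T (k + 1)).
  rewrite !b1 eqxx (_ : k + 1 == k = false) ?oner_eq0//.
  by case: k {b1} => -[|[|[|//]]].
move: ne; rewrite /bary; case: ifP => _; [|case: ifP => _]; exact: affine_zero_null.
Qed.

Lemma ae_and (A B : R * R -> Prop) : {ae mu2, forall x, A x} ->
  {ae mu2, forall x, B x} -> {ae mu2, forall x, A x /\ B x}.
Proof. by apply: ae_mp2 => x. Qed.

(** Off the lines that carry the edges, all barycentric coordinates of a point of the triangle are
    positive, and their joint positivity defines an open subset of the triangle. *)
Lemma tint_ae : {ae mu2, forall x, thull T x -> tint T x}.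
Proof.
have nz k : {ae mu2, forall x, bary k x != 0}.
  exists [set x | bary k x = 0]; split.
  - have c : continuous (bary k).
      by rewrite /bary; case: ifP => _; [|case: ifP => _]; exact: affine_continuous.
    have := continuous_measurable_plane measurableT c.
    move=> /(_ measurableT [set 0]) /(_ (measurable_set1 _)).
    by rewrite setTI.
  - exact: bary_zero_null.
  - by move=> x /= /negP; rewrite negbK => /eqP.
have nz3 := ae_and (nz 0) (ae_and (nz 1) (nz 2)).
apply: ae_mp nz3 => x [n0 [n1 n2]] [l [l0 l1] xE].
have bl k : bary k x = l k by rewrite xE bary_weights.
have pos k : 0 < bary k x.
  rewrite lt_neqAle bl l0 andbT -bl eq_sym.
  by case: k => -[|[|[|//]]] hk; [rewrite (_ : Ordinal hk = 0)|
    rewrite (_ : Ordinal hk = 1)|rewrite (_ : Ordinal hk = 2)] => //; exact/val_inj.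
pose U := [set y | 0 < bary0 y] `&` ([set y | 0 < bary1 y] `&` [set y | 0 < bary2 y]).
have opos a b c : open [set y | 0 < affine a b c y].
  have /continuousP h := @affine_continuous a b c.
  have := h _ (@open_gt R 0). by [].
have oU : open U by apply: openI; [|apply: openI]; exact: opos.
have UT : U `<=` thull T.
  move=> y [u0 [u1 u2]]; exists (fun k => bary k y); last exact: bary_comb.
  split; last exact: bary_sum.
  by move=> k; rewrite /bary; case: ifP => _; [|case: ifP => _]; exact: ltW.
apply: (filterS UT); apply: open_nbhs_nbhs; split=> //.
by split; [exact: pos 0|split; [exact: pos 1|exact: pos 2]].
Qed.

End Triangles.

(** * Sums over the mesh as integrals over the domain *)

Section MeshSum.
Variables (R : realType) (P : lipschitzPolygon R) (Th : seq (triangle R)).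
Hypothesis hTh : regular_mesh P Th.
Local Notation measurable2 := (@measurable _ (plane R)).

Definition mesh_int (s : seq (triangle R)) : set (R * R) :=
  \big[setU/set0]_(T <- s) tint T.

Lemma mesh_intP s x : mesh_int s x <-> exists2 T, T \in s & tint T x.
Proof.
rewrite /mesh_int -bigcup_seq; split=> [[T /= Ts Tx]|[T Ts Tx]]; by exists T.
Qed.

Lemma measurable_mesh_int s : measurable2 (mesh_int s).
Proof.
rewrite /mesh_int; elim: s => [|T s IH]; first by rewrite big_nil; exact: measurable0.
by rewrite big_cons; apply: measurableU => //; apply: open_measurable_plane; exact: open_tint.
Qed.

Lemma mesh_int_sub s : {subset s <= Th} -> mesh_int s `<=` P.
Proof. by move=> sTh x /mesh_intP[T /sTh TTh]; exact: (tint_sub hTh TTh). Qed.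

Lemma tints_ae (s : seq (triangle R)) : {subset s <= Th} ->
  {ae mu2, forall x, forall T, T \in s -> thull T x -> tint T x}.
Proof.
elim: s => [|T s IH] sTh; first by apply: (@aeW _ (plane R)) => x.
have [_ det _ _] := hTh.
have h1 := tint_ae (det T (sTh T (mem_head _ _))).
have h2 : {ae mu2, forall x, forall T, T \in s -> thull T x -> tint T x}.
  by apply: IH => T' T's; apply: sTh; rewrite inE T's orbT.
apply: (ae_mp2 _ h1 h2) => x a b T'; rewrite inE => /predU1P[->//|]; exact: b.
Qed.

Lemma mesh_cover_ae : {ae mu2, forall x, dom P x -> mesh_int Th x}.
Proof.
have [_ _ cov _] := hTh.
apply: ae_mp (@tints_ae Th (fun _ => id)) => x h Px.
have : closure P x by exact: subset_closure.
by rewrite cov => -[T /= TTh Tx]; apply/mesh_intP; exists T => //; exact: h.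
Qed.

(** Sublists of the mesh make induction possible; distinct triangles have disjoint interiors, so the
    integrals add up. *)
Lemma mesh_sum_sub (F : R * R -> R) s : uniq s -> {subset s <= Th} ->
  (@mu2 R).-integrable ((P : set (R * R)) : set (plane R)) (EFin \o F) ->
  \sum_(T <- s) \int[mu2]_(x in tint T) F x = \int[mu2]_(x in mesh_int s) F x.
Proof.
have mP := open_measurable_plane (@dom_open _ P).
move=> + + iF; elim: s => [|T s IH].
  by move=> _ _; rewrite /mesh_int !big_nil Rintegral_set0.
rewrite cons_uniq => /andP[Ts us] sTh.
have sTh' : {subset s <= Th} by move=> T' T's; apply: sTh; rewrite inE T's orbT.
have TTh : T \in Th by apply: sTh; rewrite mem_head.
have mT : measurable2 (tint T) := open_measurable_plane (@open_tint R T).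
have [_ _ _ disj] := hTh.
rewrite big_cons IH// {2}/mesh_int big_cons -/(mesh_int s).
apply/esym/(@Rintegral_setU _ (plane R)) => //.
- exact: measurable_mesh_int.
- apply: integrableS iF => //.
    by apply: measurableU => //; exact: measurable_mesh_int.
  by move=> x [/(tint_sub hTh TTh)//|/(mesh_int_sub sTh')].
- apply/disj_setPS => x [xT /mesh_intP[T' T's xT']].
  have TT' : T <> T' by move=> E; rewrite E T's in Ts.
  by have [<- _] := disj T T' TTh (sTh' _ T's) TT'.
Qed.

Lemma mesh_sum (F : R * R -> R) :
  (@mu2 R).-integrable ((P : set (R * R)) : set (plane R)) (EFin \o F) ->
  \sum_(T <- Th) \int[mu2]_(x in tint T) F x = \int[mu2]_(x in P) F x.
Proof.
move=> iF; have [uTh _ _ _] := hTh.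
have mP := open_measurable_plane (@dom_open _ P).
have mM := measurable_mesh_int Th.
have MP : mesh_int Th `<=` P by exact: mesh_int_sub.
rewrite mesh_sum_sub// [LHS]Rintegral_mkcond [RHS]Rintegral_mkcond.
have mF : @measurable_fun _ _ (plane R) R P F.
  by apply/measurable_EFinP; exact: measurable_int iF.
apply: (@ae_eq_Rintegral _ (plane R)) => //.
- apply: (@measurable_restrictT _ _ (plane R) _ (mesh_int Th) F mM).1.
  exact: (@measurable_funS _ _ (plane R) _ _ _ _ mP MP mF).
- exact: (@measurable_restrictT _ _ (plane R) _ P F mP).1.
- apply: ae_mp mesh_cover_ae => x h _; rewrite !patchE.
  case: ifPn => [/set_mem/MP Px|nM]; first by rewrite mem_set.
  case: ifPn => // /set_mem/h Mx.
  by move/negP: nM; case; exact/mem_set.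
Qed.

End MeshSum.

(** * Traces and the hybrid problem *)

Section Traces.
Variables (R : realType) (P : lipschitzPolygon R).
Implicit Types (u v f g w : R * R -> R) (i j : 'I_2) (H K N : R * R -> 'M[R]_2).

Let oP : open P := @dom_open _ P.
Let mP : @measurable _ (plane R) P := open_measurable_plane oP.

Lemma edge_notin e t : e \in edges P -> t \in `[0, 1] -> ~ dom P (edge_pt e t).
Proof.
move=> eP t01 Px.
have : boundary P (edge_pt e t) by rewrite edges_boundary; exists e => //; exists t.
by move=> [_]; apply; rewrite (interior_id _).1.
Qed.

Lemma L2G_cst0 : L2G P (cst 0).
Proof.
move=> e eP; split; first exact: measurable_cst.
apply: eq_integrable (integrable0 _ _) => // t _.
by rewrite /= expr0n.
Qed.

(** The test functions themselves witness the trace: they are smooth on the whole plane and vanish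
    at every edge point, since the open domain misses its boundary. *)
Lemma is_trace_lim (phi : nat -> R * R -> R) v (w : 'I_2 -> R * R -> R) :
  (forall k, test_fun P (phi k)) -> L2 P v ->
  @cvg2 _ (plane R) R mu2 P phi v ->
  (forall i, is_wpd P i v (w i)) ->
  (forall i, @cvg2 _ (plane R) R mu2 P (fun k => pd i (phi k)) (w i)) ->
  is_trace P v (cst 0).
Proof.
move=> t v2 cv hw cw.
have h1 : H1 P v by split=> // i; exists (w i).
split=> //; first exact: L2G_cst0.
exists phi; split=> //.
- by move=> k; exact: test_fun_smooth (t k).
- move=> i.
  have E k : \int[mu2]_(x in P) ((pd i (phi k) x - wpd P i v x) ^+ 2) =
      \int[mu2]_(x in P) ((pd i (phi k) x - w i x) ^+ 2).
    have s2 : L2 P (pd i (phi k)) := test_fun_L2 mP (test_fun_pd i (t k)).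
    have [g2 _] := wpdP (ex_intro _ _ (hw i)).
    apply: nsq_ae => //.
    - exact: (sqintB mP s2 g2).
    - exact: (sqintB mP s2 (hw i).1).
    - by apply: ae_mp (wpd_ae oP (hw i)) => x h Px; rewrite h.
  by rewrite (funext E); exact: cw.
- have E k : L2Gsqnorm P (fun x => phi k x - cst 0 x) = 0.
    rewrite /L2Gsqnorm big_seq big1// => e eP.
    rewrite (@eq_Rintegral _ _ _ _ _ (fun=> 0)); first by rewrite Rintegral_cst//= mul0r mulr0.
    move=> s /set_mem /= s01.
    by rewrite (test_fun_out (t k) (edge_notin eP s01)) subr0 expr0n.
  by rewrite (funext E); exact: cvg_cst.
Qed.

Lemma H2lim_trace (phi : nat -> R * R -> R) u G H : H2lim P phi u G H ->
  is_trace P u (cst 0).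
Proof.
move=> h; have [t [u2 cu] hG _] := h.
apply: (is_trace_lim t u2 cu (fun i => H2lim_wpd oP i h)) => i.
exact: (hG i).2.
Qed.

Lemma H2lim_H2 (phi : nat -> R * R -> R) u G H : H2lim P phi u G H -> H2 P u.
Proof.
move=> h; have [_ [u2 _] _ _] := h; split.
  by split=> // i; exists (G i); exact: H2lim_wpd h.
by exists H; exact: H2lim_hess h.
Qed.

Lemma H2lim_H1_0 (phi : nat -> R * R -> R) u G H : H2lim P phi u G H -> H1_0 P u.
Proof. by move=> h; split; [exact: (H2lim_H2 h).1|exact: H2lim_trace h]. Qed.

(** Each component of the gradient is again a limit of test functions, namely of [pd i (phi k)],
    with gradient the [i]-th row of [H]; so its trace vanishes as that of [u] does. *)
Lemma H2lim_normal_trace (phi : nat -> R * R -> R) u G H : H2lim P phi u G H ->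
  is_normal_trace P u (cst 0).
Proof.
move=> h; have [t _ hG [[sH H2'] cH]] := h.
exists (fun=> cst 0) => [i|e eP]; last first.
  apply: aeW => s _; rewrite big1// => i _; exact: mulr0.
have Gw := H2lim_wpd oP i h; have [g2 hg] := wpdP (ex_intro _ _ Gw).
apply: (@is_trace_lim (fun k => pd i (phi k)) _ (fun j x => H x i j)).
- by move=> k; exact: test_fun_pd.
- exact: g2.
- have E k : @nsq _ (plane R) R mu2 P (fun x => pd i (phi k) x - wpd P i u x) =
      @nsq _ (plane R) R mu2 P (fun x => pd i (phi k) x - G i x).
    have s2 : L2 P (pd i (phi k)) := test_fun_L2 mP (test_fun_pd i (t k)).
    apply: nsq_ae => //.
    - exact: (sqintB mP s2 g2).
    - exact: (sqintB mP s2 Gw.1).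
    - by apply: ae_mp (wpd_ae oP Gw) => x e Px; rewrite e.
  by rewrite /cvg2 (funext E); exact: (hG i).2.
(* Using [pd j psi] as test function for [wpd P i u] turns the Hessian identity into the one for its
   [j]-th derivative. *)
- move=> j; split=> [|psi tpsi]; first exact: H2'.
  have [_ hh] := H2lim_hess oP h.
  have := hh _ tpsi i j; rewrite hg; last exact: test_fun_pd.
  by move=> <-; rewrite opprK.
- move=> j; rewrite (_ : (fun k => _) = fun k => pd i (pd j (phi k))); first exact: cH.
  by apply/funext => k; exact/pdC/test_fun_smooth.
Qed.

Lemma H2lim_H2_0 (phi : nat -> R * R -> R) u G H : H2lim P phi u G H -> H2_0 P u.
Proof.
by move=> h; split; [exact: H2lim_H2 h|exact: H2lim_trace h|exact: H2lim_normal_trace h].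
Qed.

End Traces.

Lemma tensor_field_sub (R : realType) (A B : set (R * R))
    (C : R * R -> 'M[R]_2 -> 'M[R]_2) : open A -> open B -> B `<=` A ->
  tensor_field A C -> tensor_field B C.
Proof.
move=> oA oB BA hC; have mA := open_measurable_plane oA.
split.
- by move=> x /BA; exact: tensor_Sym hC x.
- by move=> x /BA; exact: tensor_linear hC x.
- move=> M hM i j; apply: (@measurable_funS _ _ (plane R) _ _ _ _ mA BA).
  exact: (tensor_measurable hC).
- have [K h] := tensor_bounded hC; exists K.
  by apply: ae_mp h => x e /BA.
- by apply: ae_mp (tensor_symmetric hC) => x e /BA.
- by have [c c0 h] := tensor_posdef hC; exists c => //; apply: ae_mp h => x e /BA.
Qed.

(** * The plate deflection as a hybrid solution *)

Section HybridProblem.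
Variables (R : realType) (P : lipschitzPolygon R) (Th : seq (triangle R)).
Hypothesis hTh : regular_mesh P Th.
Variables (C : R * R -> 'M[R]_2 -> 'M[R]_2) (hC : tensor_field P C).
Implicit Types (u v f g w : R * R -> R) (i j : 'I_2) (H K N : R * R -> 'M[R]_2).
Implicit Types (T : triangle R).

Let oP : open P := @dom_open _ P.
Let mP : @measurable _ (plane R) P := open_measurable_plane oP.
Let oT T : open (tint T) := @open_tint R T.
Let mT T : @measurable _ (plane R) (tint T) := open_measurable_plane (@oT T).

Local Notation ipP := (@ip _ (plane R) R mu2 P).
Local Notation nsqP := (@nsq _ (plane R) R mu2 P).

Lemma L2Sym_sub H T : T \in Th -> L2Sym P H -> L2Sym (tint T) H.
Proof.
move=> TTh [s h]; have TP := tint_sub hTh TTh; split=> [x /TP|i j]; first exact: s.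
exact: L2_sub (h i j).
Qed.

Lemma H21_0_L2 v : H21_0 P Th v -> L2 P v.
Proof. by move=> [[[]]]. Qed.

Lemma H21_0_hess v T : H21_0 P Th v -> T \in Th -> is_hess (tint T) v (hess (tint T) v).
Proof. by move=> [_ h] /h [_ e]; exact: hessP. Qed.

Lemma H21_0_hess_Sym v T : H21_0 P Th v -> T \in Th -> L2Sym (tint T) (hess (tint T) v).
Proof. by move=> h /(H21_0_hess h) []. Qed.

(** [gamma_dDivnn] refers to a chosen representative of div div; this exchanges it for any known
    one. *)
Lemma gamma_dDivnnE N g v : H21_0 P Th v -> is_divdiv P N g ->
  gamma_dDivnn P Th N v = ipP g v - \sum_(T <- Th) ipm (tint T) N (hess (tint T) v).
Proof.
move=> hv d; have [d2 _] := divdivP (ex_intro _ _ d).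
by congr (_ - _); exact: (ip_ae mP d2 d.1 (H21_0_L2 hv) (divdiv_ae oP d)).
Qed.

Lemma KL_H21_0 f u G H : KL P C f u G H -> H21_0 P Th u.
Proof.
move=> [[phi h] _]; split; first exact: H2lim_H1_0 h.
by move=> T TTh; exact: H2_sub (tint_sub hTh TTh) (H2lim_H2 h).
Qed.

Lemma KL_hess_tint f u G H T : KL P C f u G H -> T \in Th ->
  {ae mu2, forall x, tint T x -> hess (tint T) u x = H x}.
Proof.
move=> [[phi h] _] TTh; have [_ [u2 _] _ _] := h; have TP := tint_sub hTh TTh.
apply: hess_ae => //; first exact: L2_sub u2.
exact: is_hess_sub TP (H2lim_hess oP h).
Qed.

(** A hybrid solution agrees with the constructed deflection only almost everywhere; this hands the
    approximating sequence over to it. *)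
Lemma KL_ae f u G H u' H' : KL P C f u G H -> L2 P u' -> L2Sym P H' ->
  {ae mu2, forall x, dom P x -> u x = u' x} ->
  {ae mu2, forall x, dom P x -> H x = H' x} -> KL P C f u' G H'.
Proof.
move=> [[phi h] d] u2' HS' uu' HH'; have [t [u2 cu] hG [HS cH]] := h; split; last first.
  move/is_divdivP: d => [f2 e]; apply/is_divdivP; split=> // psi tpsi; rewrite e//.
  apply: ipm_ae => //.
  - exact: (tensor_L2Sym mP hC HS).2.
  - exact: (tensor_L2Sym mP hC HS').2.
  - exact: (D2_L2Sym mP tpsi).2.
  - by apply: ae_mp HH' => x E Px; rewrite /Cap E.
exists phi; split=> //.
  split=> //.
  have E k : nsqP (fun x => phi k x - u' x) = nsqP (fun x => phi k x - u x).
    have s := test_fun_L2 mP (t k).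
    apply: nsq_ae => //; [exact: (sqintB mP s u2')|exact: (sqintB mP s u2)|].
    by apply: ae_mp uu' => x E Px; rewrite E.
  by rewrite /cvg2 (funext E).
split=> // i j.
have E k : nsqP (fun x => pd i (pd j (phi k)) x - H' x i j) =
    nsqP (fun x => pd i (pd j (phi k)) x - H x i j).
  have s := test_fun_L2 mP (test_fun_pd i (test_fun_pd j (t k))).
  apply: nsq_ae => //; [exact: (sqintB mP s (HS'.2 i j))|exact: (sqintB mP s (HS.2 i j))|].
  by apply: ae_mp HH' => x E Px; rewrite E.
by rewrite /cvg2 (funext E); exact: cH.
Qed.

Lemma KL_hess f u G H : KL P C f u G H -> KL P C f u G (hess P u).
Proof.
move=> h; have [[phi hl] _] := h; have [_ [u2 _] _ _] := hl.
have hh := H2lim_hess oP hl.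
have [HS _] := hessP (ex_intro _ _ hh).
apply: (KL_ae h u2 HS); first exact: (@aeW _ (plane R)).
by apply: ae_mp (hess_ae oP u2 hh) => x E Px; rewrite E.
Qed.

Lemma KL_HdDiv f u G H : KL P C f u G H -> HdDiv P (Cap C H).
Proof.
move=> [[phi h] d]; have [_ _ _ [HS _]] := h.
by split; [exact: (tensor_L2Sym mP hC HS)|exists f].
Qed.

Lemma KL_hybrid f u G H : KL P C f u G H ->
  hybrid_solution P Th C f u (gamma_dDivnn P Th (Cap C H)).
Proof.
move=> h; have [[phi hl] d] := h; have [_ [u2 _] _ [HS _]] := hl.
have hu := KL_H21_0 h.
split=> //.
- by exists (Cap C H) => //; exact: KL_HdDiv h.
- move=> du hdu; rewrite (gamma_dDivnnE hdu d).
  rewrite [X in X + _](_ : _ = \sum_(T <- Th) ipm (tint T) (Cap C H) (hess (tint T) du)).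
    by rewrite addrC subrK.
  rewrite big_seq [RHS]big_seq; apply: eq_bigr => T TTh.
  have hCT := tensor_field_sub oP (@oT T) (tint_sub hTh TTh) hC.
  apply: (@ipm_ae _ _ (@mT T) (Cap C (hess (tint T) u))).
  + exact: (tensor_L2Sym (@mT T) hCT (H21_0_hess_Sym hu TTh)).2.
  + exact: (tensor_L2Sym (@mT T) hCT (L2Sym_sub TTh HS)).2.
  + exact: (H21_0_hess_Sym hdu TTh).2.
  + by apply: ae_mp (KL_hess_tint h TTh) => x E Tx; rewrite /Cap E.
(* By [H2lim_divdiv] the volume term of the functional is the pairing of [N] with [H], which
   [mesh_sum] splits into the very sum over triangles that is subtracted. *)
- move=> deta [N [NS [g dN]] ->//]; rewrite (gamma_dDivnnE hu dN).
  rewrite (H2lim_divdiv oP hl NS dN).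
  rewrite /ipm -(mesh_sum hTh); last exact: (ipm_integrable mP NS.2 HS.2).
  apply/eqP; rewrite subr_eq0; apply/eqP.
  rewrite big_seq [RHS]big_seq; apply: eq_bigr => T TTh.
  rewrite -![\int[mu2]_(x in _) _]/(ipm (tint T) _ _) !(ipmC _ N).
  apply: (ipm_ae (@mT T)).
  + exact: (L2Sym_sub TTh HS).2.
  + exact: (H21_0_hess_Sym hu TTh).2.
  + exact: (L2Sym_sub TTh NS).2.
  + by apply: ae_mp (KL_hess_tint h TTh) => x E Tx; rewrite E.
Qed.

End HybridProblem.

(** * Uniqueness, identification and bounds of hybrid solutions *)

Section WellPosedness.
Variables (R : realType) (P : lipschitzPolygon R) (Th : seq (triangle R)).
Hypothesis hTh : regular_mesh P Th.
Variables (C : R * R -> 'M[R]_2 -> 'M[R]_2) (hC : tensor_field P C).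
Implicit Types (u v f g w : R * R -> R) (i j : 'I_2) (H K N : R * R -> 'M[R]_2).
Implicit Types (T : triangle R) (eta : (R * R -> R) -> R).

Let oP : open P := @dom_open _ P.
Let mP : @measurable _ (plane R) P := open_measurable_plane oP.
Let oT T : open (tint T) := @open_tint R T.
Let mT T : @measurable _ (plane R) (tint T) := open_measurable_plane (@oT T).

Local Notation ipP := (@ip _ (plane R) R mu2 P).
Local Notation nsqP := (@nsq _ (plane R) R mu2 P).
Local Notation hessT T := (hess (tint T)).

Lemma hybrid_energy f u eta u' eta' : hybrid_solution P Th C f u eta ->
  hybrid_solution P Th C f u' eta' ->
  \sum_(T <- Th) ipm (tint T) (Cap C (hessT T u)) (hessT T u') = ipP f u'.
Proof.
by move=> [_ he eq1 _] [hu' _ _ eq2']; rewrite -[RHS]eq1// (eq2' _ he) addr0.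
Qed.

(** By [hybrid_energy] a mixed energy depends on its second argument alone, so the four terms in the
    energy of the difference cancel; being a sum of nonnegative terms, it then vanishes on each
    triangle. *)
Lemma hybrid_hess_unique f u eta u' eta' : hybrid_solution P Th C f u eta ->
  hybrid_solution P Th C f u' eta' -> forall T, T \in Th ->
  {ae mu2, forall x, tint T x -> hessT T u x = hessT T u' x}.
Proof.
move=> s s'; have [hu _ _ _] := s; have [hu' _ _ _] := s'.
pose d T x := hessT T u x - hessT T u' x.
have S T (TTh : T \in Th) := H21_0_hess_Sym hu TTh.
have S' T (TTh : T \in Th) := H21_0_hess_Sym hu' TTh.
have dS T : T \in Th -> L2Sym (tint T) (d T).
  move=> TTh; split; last exact: msqB (S _ TTh).2 (S' _ TTh).2.
  by move=> x Tx; exact: (SymB ((S _ TTh).1 x Tx) ((S' _ TTh).1 x Tx)).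
have hCT T : T \in Th -> tensor_field (tint T) C.
  by move=> TTh; exact: tensor_field_sub (tint_sub hTh TTh) hC.
have E T : T \in Th -> ipm (tint T) (Cap C (d T)) (d T) =
    ipm (tint T) (Cap C (hessT T u)) (hessT T u)
    - ipm (tint T) (Cap C (hessT T u)) (hessT T u')
    - (ipm (tint T) (Cap C (hessT T u')) (hessT T u)
      - ipm (tint T) (Cap C (hessT T u')) (hessT T u')).
  move=> TTh.
  have CS := (tensor_L2Sym (@mT T) (hCT _ TTh) (S _ TTh)).2.
  have CS' := (tensor_L2Sym (@mT T) (hCT _ TTh) (S' _ TTh)).2.
  have e1 : ipm (tint T) (Cap C (d T)) (d T) = ipm (tint T)
      (fun x => Cap C (hessT T u) x - Cap C (hessT T u') x) (d T).
    apply: eq_Rintegral => x /set_mem Tx; congr frob.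
    exact: (tensorB (hCT _ TTh) Tx ((S _ TTh).1 x Tx) ((S' _ TTh).1 x Tx)).
  apply: (etrans e1); apply: (etrans (ipmBl (@mT T) CS CS' (dS _ TTh).2)).
  exact: (congr2 (fun a b => a - b) (ipmBr (@mT T) (S _ TTh).2 (S' _ TTh).2 CS)
    (ipmBr (@mT T) (S _ TTh).2 (S' _ TTh).2 CS')).
have pos T : T \in Th -> exists2 c, 0 < c & c * ipm (tint T) (d T) (d T) <=
    ipm (tint T) (Cap C (d T)) (d T).
  move=> TTh; have [c c0 hc] := tensor_ipm_pos (@mT T) (hCT _ TTh).
  by exists c => //; exact/hc/dS.
have ge0 T : T \in Th -> 0 <= ipm (tint T) (Cap C (d T)) (d T).
  move=> /pos[c c0]; apply: le_trans; rewrite mulr_ge0 ?ipm_ge0//; exact: ltW.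
have sum0 : \sum_(T <- Th) ipm (tint T) (Cap C (d T)) (d T) = 0.
  transitivity (ipP f u - ipP f u' - (ipP f u - ipP f u')); last exact: subrr.
  have sB (F G : triangle R -> R) : \sum_(T <- Th) (F T - G T) =
      \sum_(T <- Th) F T - \sum_(T <- Th) G T by rewrite sumrB.
  pose sub (a b : R) := a - b.
  have Es : \sum_(T <- Th) ipm (tint T) (Cap C (d T)) (d T) = \sum_(T <- Th)
      (ipm (tint T) (Cap C (hessT T u)) (hessT T u)
       - ipm (tint T) (Cap C (hessT T u)) (hessT T u')
       - (ipm (tint T) (Cap C (hessT T u')) (hessT T u)
          - ipm (tint T) (Cap C (hessT T u')) (hessT T u'))).
    by apply: eq_big_seq => T; exact: E.
  apply: (etrans Es); apply: (etrans (sB _ _)).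
  exact: (congr2 sub
    (etrans (sB _ _) (congr2 sub (hybrid_energy s s) (hybrid_energy s s')))
    (etrans (sB _ _) (congr2 sub (hybrid_energy s' s) (hybrid_energy s' s')))).
move=> T TTh.
have aT0 : ipm (tint T) (Cap C (d T)) (d T) = 0.
  have le0 : ipm (tint T) (Cap C (d T)) (d T) <= 0.
    rewrite -sum0 (big_rem T TTh) /= lerDl big_seq sumr_ge0// => T' /mem_rem.
    exact: ge0.
  by apply/eqP; rewrite eq_le le0 ge0.
have [c c0] := pos _ TTh; rewrite aT0 pmulr_rle0// => le0.
have : ipm (tint T) (d T) (d T) = 0 by apply/eqP; rewrite eq_le le0 ipm_ge0.
move=> /(ipm_eq0 (@mT T) (dS _ TTh).2); apply: ae_mp => x h Tx.
by apply/eqP; rewrite -subr_eq0; apply/eqP; exact: h.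
Qed.

Variables (q : (R * R) * (R * R)).
Hypothesis Pq : P `<=` orect q.

Lemma hybrid_unique f u eta u' eta' : hybrid_solution P Th C f u eta ->
  hybrid_solution P Th C f u' eta' ->
  {ae mu2, forall x, dom P x -> u' x = u x} /\
  (forall v, H21_0 P Th v -> eta' v = eta v).
Proof.
move=> s s'; have [hu he eq1 eq2] := s; have [hu' he' eq1' eq2'] := s'.
have hae := hybrid_hess_unique s s'.
have S T (TTh : T \in Th) := H21_0_hess_Sym hu TTh.
have S' T (TTh : T \in Th) := H21_0_hess_Sym hu' TTh.
have u2 := H21_0_L2 hu; have u2' := H21_0_L2 hu'.
split.
  have d2 := sqintB mP u2' u2.
  have [w [G [H h]]] := KL_exists oP Pq hC d2.
  have [NS _] := KL_HdDiv hC h.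
  have hN : Hmhalf P Th (gamma_dDivnn P Th (Cap C H)).
    by exists (Cap C H) => //; exact: (KL_HdDiv hC h).
  have e1 := etrans (esym (gamma_dDivnnE hu h.2)) (eq2 _ hN).
  have e2 := etrans (esym (gamma_dDivnnE hu' h.2)) (eq2' _ hN).
  have Es : \sum_(T <- Th) ipm (tint T) (Cap C H) (hessT T u') =
      \sum_(T <- Th) ipm (tint T) (Cap C H) (hessT T u).
    apply: eq_big_seq => T TTh; apply/esym/(ipm_aer (@mT T)).
    - exact: (S _ TTh).2.
    - exact: (S' _ TTh).2.
    - exact: (L2Sym_sub hTh TTh NS).2.
    - exact: hae.
  have e : ipP (fun x => u' x - u x) u' = ipP (fun x => u' x - u x) u.
    exact: (etrans (subr0_eq e2) (etrans Es (esym (subr0_eq e1)))).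
  have : nsqP (fun x => u' x - u x) = 0.
    by rewrite -ipff (ipBr mP u2' u2 d2) e subrr.
  move=> /(nsq_eq0 mP d2); apply: ae_mp => x e0 Px.
  exact: (subr0_eq (e0 Px)).
(* The Hessians being equal, the difference of the two first equations leaves only the
   functionals. *)
move=> v hv; have e := etrans (eq1' _ hv) (esym (eq1 _ hv)).
suff Es : \sum_(T <- Th) \int[mu2]_(x in tint T)
      frob (C x (hessT T u x)) (hessT T v x) = \sum_(T <- Th) \int[mu2]_(x in tint T)
      frob (C x (hessT T u' x)) (hessT T v x).
  have aux (a a' b b' : R) : a' + b' = a + b -> a = a' -> b' = b.
    by move=> + E; rewrite E => /addrI.
  exact: (aux _ _ _ _ e Es).
apply: eq_big_seq => T TTh.
have hCT := tensor_field_sub oP (@oT T) (tint_sub hTh TTh) hC.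
apply: (@ipm_ae _ _ (@mT T) (Cap C (hessT T u)) (Cap C (hessT T u'))).
- exact: (tensor_L2Sym (@mT T) hCT (S _ TTh)).2.
- exact: (tensor_L2Sym (@mT T) hCT (S' _ TTh)).2.
- exact: (H21_0_hess_Sym hv TTh).2.
- by apply: ae_mp (hae _ TTh) => x Ex Tx; rewrite /Cap Ex.
Qed.

(** Uniqueness is used twice: to compare [u] with the constructed deflection, which makes [u] itself
    a plate solution, and then to compare [eta] with the trace built from [hess P u]. *)
Lemma hybrid_KL f u eta : L2 P f -> hybrid_solution P Th C f u eta ->
  (exists G, KL P C f u G (hess P u)) /\
  (forall v, H21_0 P Th v -> eta v = gamma_dDivnn P Th (Cap C (hess P u)) v).
Proof.
move=> f2 s; have [hu _ _ _] := s; have u2 := H21_0_L2 hu.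
have [w [G [H h]]] := KL_exists oP Pq hC f2.
have [uw _] := hybrid_unique s (KL_hybrid hTh hC h).
have [[phi hl] _] := h; have [_ _ _ [HS _]] := hl.
have hk : KL P C f u G (hess P u).
  by apply: (KL_hess hC); apply: (KL_ae hC h u2 HS uw); exact: (@aeW _ (plane R)).
split; first by exists G.
move=> v hv; have [_ e] := hybrid_unique s (KL_hybrid hTh hC hk).
by rewrite e.
Qed.

(** [u] has a Hessian on all of the domain, so the norms on the triangles add up to a quantity
    without reference to the mesh. *)
Lemma KL_norm2T f u G H : KL P C f u G H -> norm2T Th u ^+ 2 = nsqP u + ipm P H H.
Proof.
move=> h; have [[phi hl] _] := h; have [_ [u2 _] _ [HS _]] := hl.
rewrite sqr_sqrtr; last by apply: sumr_ge0 => T _; exact: sqr_ge0.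
rewrite /nsq /ipm -(mesh_sum hTh u2.2).
rewrite -(mesh_sum hTh (ipm_integrable mP HS.2 HS.2)) -big_split /=.
rewrite big_seq [RHS]big_seq; apply: eq_bigr => T TTh.
have TP := tint_sub hTh TTh.
apply: norm2_sq => //; first exact: L2_sub u2.
exact: is_hess_sub TP (H2lim_hess oP hl).
Qed.

Lemma mhalfnorm_le N eta : HdDiv P N -> has_trace P Th N eta ->
  mhalfnorm P Th eta <= dDivnorm P N.
Proof.
move=> hN te; apply: ge_inf; last by exists N.
by exists 0 => _ [K _ <-]; exact: sqrtr_ge0.
Qed.

Lemma KL_dDivnorm f u G H : KL P C f u G H ->
  dDivnorm P (Cap C H) ^+ 2 = ipm P (Cap C H) (Cap C H) + nsqP f.
Proof.
move=> [_ d]; have [d2 _] := divdivP (ex_intro _ _ d).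
rewrite sqr_sqrtr ?addr_ge0 ?sqr_ge0// L2Symnorm_sq L2norm_sq; congr (_ + _).
exact: nsq_ae mP d2 d.1 (divdiv_ae oP d).
Qed.

(** For continuous dependence: together with [KL_B] it lets the difference of two solutions be
    estimated as the solution for the difference of the loads. *)
Lemma has_traceB f u G H f' u' G' H' eta eta' :
  KL P C f u G H -> KL P C f' u' G' H' ->
  has_trace P Th (Cap C H) eta -> has_trace P Th (Cap C H') eta' ->
  has_trace P Th (Cap C (fun x => H x - H' x)) (fun v => eta v - eta' v).
Proof.
move=> h h' te te' v hv; have hB := KL_B oP hC h h'.
have [[phi hl] d] := h; have [_ _ _ [HS _]] := hl.
have [[phi' hl'] d'] := h'; have [_ _ _ [HS' _]] := hl'.
have v2 := H21_0_L2 hv.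
have aux (a a' b b' c c' : R) : a = b - b' -> c = a' - c' -> c - a = a' - b - (c' - b').
  by move=> -> ->; ring.
have e := congr2 (fun a b => a - b) (etrans (te _ hv) (gamma_dDivnnE hv d))
  (etrans (te' _ hv) (gamma_dDivnnE hv d')).
apply: (etrans e); apply: (etrans _ (esym (gamma_dDivnnE hv hB.2))).
apply/esym; apply: aux; last exact: (ipBl mP d.1 d'.1 v2).
apply: (etrans _ (sumrB _ _ _ _)); apply: eq_big_seq => T TTh.
have TP := tint_sub hTh TTh.
have hCT := tensor_field_sub oP (@oT T) TP hC.
have ST := L2Sym_sub hTh TTh HS; have ST' := L2Sym_sub hTh TTh HS'.
apply: etrans (ipmBl (@mT T) (tensor_L2Sym (@mT T) hCT ST).2
  (tensor_L2Sym (@mT T) hCT ST').2 (H21_0_hess_Sym hv TTh).2).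
apply: eq_Rintegral => x /set_mem Tx; congr frob.
exact: (tensorB hCT Tx (ST.1 x Tx) (ST'.1 x Tx)).
Qed.

End WellPosedness.

(** The constant is produced before the mesh is introduced, which is the claimed independence. *)
Lemma KL_norm_bound (R : realType) (P : lipschitzPolygon R)
    (C : R * R -> 'M[R]_2 -> 'M[R]_2) (q : (R * R) * (R * R)) :
  P `<=` orect q -> tensor_field P C ->
  exists2 K : R, 0 <= K & forall Th, regular_mesh P Th ->
    forall f u G H eta, KL P C f u G H -> has_trace P Th (Cap C H) eta ->
    norm2T Th u + mhalfnorm P Th eta <= K * L2norm P f.
Proof.
move=> Pq hC; have oP := @dom_open _ P.
have [k k0 hk] := KL_bound oP Pq hC.
(* [k + k] collects the bounds for [u] and its Hessian, [k + 1] those for the moment tensor and its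
   div div, which is [f]. *)
exists (Num.sqrt (k + k) + Num.sqrt (k + 1)); first by rewrite addr_ge0 ?sqrtr_ge0.
move=> Th hTh f u G H eta h te.
have [b1 b2 b3] := hk _ _ _ _ h.
have F0 := @nsq_ge0 _ (plane R) R mu2 P f.
rewrite mulrDl; apply: lerD.
  rewrite -ler_sqr ?nnegrE ?sqrtr_ge0 ?mulr_ge0 ?sqrtr_ge0//.
  rewrite (KL_norm2T hTh h) exprMn sqr_sqrtr ?addr_ge0// L2norm_sq mulrDl.
  exact: lerD.
apply: le_trans (mhalfnorm_le (KL_HdDiv hC h) te) _.
rewrite -ler_sqr ?nnegrE ?sqrtr_ge0 ?mulr_ge0 ?sqrtr_ge0//.
rewrite (KL_dDivnorm h) exprMn sqr_sqrtr ?addr_ge0// L2norm_sq mulrDl mul1r.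
by rewrite lerD2r.
Qed.

Theorem theorem15 (R : realType) (Omega : lipschitzPolygon R)
    (C : R * R -> 'M[R]_2 -> 'M[R]_2) (hC : tensor_field Omega C) :
  exists K : R, forall (kappa : R) (Th : seq (triangle R)),
    regular_mesh Omega Th -> shape_regular kappa Th ->
  [/\ (* existence and uniqueness *)
      (forall f, L2 Omega f ->
        exists u eta, hybrid_solution Omega Th C f u eta /\
          (forall u' eta', hybrid_solution Omega Th C f u' eta' ->
             {ae mu2, forall x, dom Omega x -> u' x = u x} /\
             (forall v, H21_0 Omega Th v -> eta' v = eta v))),
      (* continuous dependence on the data *)
      (forall f u eta, L2 Omega f -> hybrid_solution Omega Th C f u eta ->
        forall eps : R, 0 < eps -> exists2 delta : R, 0 < delta &
          forall f' u' eta', L2 Omega f' ->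
            hybrid_solution Omega Th C f' u' eta' ->
            L2norm Omega (fun x => f' x - f x) < delta ->
            norm2T Th (fun x => u' x - u x)
            + mhalfnorm Omega Th (fun v => eta' v - eta v) < eps)
    & (* properties of the solution *)
      (forall f u eta, L2 Omega f -> hybrid_solution Omega Th C f u eta ->
        let M := fun x => C x (hess Omega u x) in
        [/\ norm2T Th u + mhalfnorm Omega Th eta <= K * L2norm Omega f,
            H2_0 Omega u,
            HdDiv Omega M /\
              (forall v, H21_0 Omega Th v -> eta v = gamma_dDivnn Omega Th M v),
            {ae mu2, forall x, dom Omega x -> divdiv Omega M x = f x}
          & is_trace Omega u (cst 0) /\ is_normal_trace Omega u (cst 0)])].
Proof.
have [q Pq] := bounded_sub_orect (@dom_bounded _ Omega).
have oP := @dom_open _ Omega.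
have [K K0 hK] := KL_norm_bound Pq hC.
exists K => kappa Th hTh _; split.
- move=> f f2; have [u [G [H h]]] := KL_exists oP Pq hC f2.
  exists u, (gamma_dDivnn Omega Th (Cap C H)).
  have s := KL_hybrid hTh hC h; split=> // u' eta' s'.
  exact: (hybrid_unique hTh hC Pq s s').
- move=> f u eta f2 s eps eps0.
  have [[G h] te] := hybrid_KL hTh hC Pq f2 s.
  have K1 : 0 < K + 1 by rewrite ltr_wpDl.
  (* The a priori bound for the load [f' - f] gives [K * delta]; [K + 1] in place of [K] allows
     division. *)
  exists (eps / (K + 1)); first by rewrite divr_gt0.
  move=> f' u' eta' f2' s'; rewrite ltr_pdivlMr// => lt.
  have [[G' h'] te'] := hybrid_KL hTh hC Pq f2' s'.
  have := hK _ hTh _ _ _ _ _ (KL_B oP hC h' h) (has_traceB hTh hC h' h te' te).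
  move/le_lt_trans; apply; apply: le_lt_trans lt.
  by rewrite mulrC ler_wpM2l ?sqrtr_ge0// lerDl.
- move=> f u eta f2 s M.
  have [[G h] te] := hybrid_KL hTh hC Pq f2 s.
  have [[phi hl] d] := h.
  split.
  + exact: (hK _ hTh _ _ _ _ _ h te).
  + exact: H2lim_H2_0 hl.
  + by split=> //; exact: (KL_HdDiv hC h).
  + exact: divdiv_ae oP d.
  + by split; [exact: H2lim_trace hl|exact: H2lim_normal_trace hl].
Qed.
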